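(* For each $\alpha \in (0,1)$ the density $\rho_\alpha$ of $\nu_\alpha$ has a version, defined at every point of $(0,1]$ and still denoted $\rho_\alpha$, such that the following holds. For every $(\alpha, x) \in (0,1) \times (0,1]$ there exists a partial derivative $\partial_\alpha \rho_\alpha(x)$. Both $\rho_\alpha(x)$ and $\partial_\alpha \rho_\alpha(x)$ are jointly continuous in $(\alpha,x)$ on $(0,1) \times (0,1]$. Moreover, for every interval $[\alpha_-, \alpha_+] \subset (0,1)$ there exists a constant $K$ such that for all $x \in (0,1]$ and $\alpha \in [\alpha_-,\alpha_+]$ $$\rho_\alpha(x) \leq K\, x^{-\alpha} \qquad \text{and} \qquad |\partial_\alpha \rho_\alpha(x)| \leq K\, x^{-\alpha}(1-\log x).$$ In particular, for any $q > (1-\alpha_+)^{-1}$ and any $\varphi \in L^q[0,1]$, the map $\alpha \mapsto \int_{[0,1]} \varphi \, d\nu_\alpha$ is continuously differentiable on $[\alpha_-,\alpha_+]$.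
   Context: For $\alpha \in (0,1)$ let $T_\alpha \colon [0,1] \to [0,1]$ be the map $T_\alpha(x) = x(1+2^\alpha x^\alpha)$ for $x \in [0,1/2]$ and $T_\alpha(x) = 2x-1$ for $x \in (1/2,1]$. It is known that each $T_\alpha$ admits a unique absolutely continuous invariant probability measure $\nu_\alpha$; $\rho_\alpha$ denotes its density with respect to Lebesgue measure on $[0,1]$. *)

(* Defs.v *)
From HB Require Import structures.
From mathcomp Require Import all_boot all_order all_algebra.
From mathcomp Require Import all_classical all_reals all_analysis.

Set Implicit Arguments.
Unset Strict Implicit.
Unset Printing Implicit Defensive.

Import Order.TTheory GRing.Theory Num.Theory.
Import numFieldNormedType.Exports.

Local Open Scope classical_set_scope.
Local Open Scope ring_scope.

(* Only the values on [0, 1], which it maps to itself, are meaningful. *)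
Definition lsv_map (R : realType) (alpha x : R) : R :=
  if x <= 2^-1 then x * (1 + 2 `^ alpha * x `^ alpha) else 2 * x - 1.

(* A probability measure on [0, 1] is represented by a Borel probability
   measure on R that gives mass 1 to [0, 1]. *)
Definition acip (R : realType) (alpha : R)
    (nu : probability (measurableTypeR R) R) : Prop :=
  [/\ nu `[0, 1]%classic = 1%E,
      nu `<< @lebesgue_measure R
    & forall A : set (measurableTypeR R), measurable A -> A `<=` `[0, 1]%classic ->
        nu (`[0, 1]%classic `&` lsv_map alpha @^-1` A) = nu A].

(* Measures are compared on measurable sets only: a [probability] is a function
   on all sets, merely required to be nonnegative on the non-measurable ones, so
   Leibniz uniqueness would be unsatisfiable. *)
Definition unique_acip (R : realType) (alpha : R)
    (nu : probability (measurableTypeR R) R) : Prop :=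
  acip alpha nu /\
  forall mu : probability (measurableTypeR R) R, acip alpha mu ->
    forall A : set (measurableTypeR R), measurable A -> mu A = nu A.

(* The point 0 is Lebesgue-null, so a density on [0, 1] is determined by its
   values on ]0, 1]; the values of [rho] elsewhere are ignored. *)
Definition is_density (R : realType)
    (nu : probability (measurableTypeR R) R) (rho : R -> R) : Prop :=
  [/\ measurable_fun (`]0, 1]%classic : set (measurableTypeR R)) rho,
      (forall x, x \in `]0, 1] -> 0 <= rho x)
    & forall A : set (measurableTypeR R), measurable A -> A `<=` `[0, 1]%classic ->
        nu A = (\int[@lebesgue_measure R]_(x in A `&` `]0%R, 1%R]%classic) (rho x)%:E)%E].

Definition lebesgue01 (R : realType) :
    {measure set (measurableTypeR R) -> \bar R} :=
  mrestr (@lebesgue_measure R) (measurable_itv `[0, 1]).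

(* Difference quotients are taken inside D, hence they are one-sided at the
   endpoints of a closed interval. *)
Definition continuously_differentiable_on (R : realType) (D : set R)
    (f : R -> R) : Prop :=
  exists f' : R -> R,
    {within D, continuous f'} /\
    forall a, D a ->
      (f b - f a) / (b - a) @[b --> within (D `\ a) (nbhs a)] --> f' a.

(* Main.v *)
Require Import Defs.
From HB Require Import structures.
From mathcomp Require Import all_boot all_order all_algebra.
From mathcomp Require Import all_classical all_reals all_analysis.
From mathcomp Require Import measurable_realfun ring lra.

Set Implicit Arguments.
Unset Strict Implicit.
Unset Printing Implicit Defensive.

Import Order.TTheory GRing.Theory Num.Theory.
Import numFieldNormedType.Exports.

Local Open Scope classical_set_scope.
Local Open Scope ring_scope.

(** Let [g] be the inverse of the left branch and [tau] the slope of this branch.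
    A density [f] is invariant when
      [f x = 2^-1 * f ((1 + x) / 2) + f (g x) / tau (g x)].
    Solving this equation along the left branch gives [f = S k], where
    [k v = 2^-1 * f ((1 + v) / 2)] is what the right branch supplies and [S r] is
    the series of the [(g^n)' * (r \o g^n)]. Hence [k] is a fixed point of
    [P r v = 2^-1 * S r ((1 + v) / 2)], which is the transfer operator of the first
    return map to the interval from 1/2 to 1 (the definitions [sumS] and
    [transfer]). The singularity of the density at the origin comes from [S] only:
    a supersolution of the form [6 * x `^ (- a)] bounds the series, without any
    asymptotics of the orbits ([powR_supersolution], [psum_supersolution]).

    The operator [P] preserves the mass and maps a cone of functions, given by
    inequalities between values at two points, into a smaller cone. An eighth of
    the mass can thus be removed at each step, so that functions of equal mass are
    brought together exponentially fast ([transfer_contraction]). This yields the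
    fixed point [kfix], the density [rhoh := S kfix] with its bound, and their
    joint continuity in the parameter and the point. All the operators also
    preserve differential inequalities of the first two orders ([reg_branch]), with
    constants that do not depend on the parameter. These hold for finite
    truncations of the density; what they say on difference quotients passes to
    the limit, and the density is continuously differentiable in space
    ([rhoh_quad], [quad_derive]).

    For the derivative in the parameter, take two parameters [c < b]. The density
    for [c] satisfies the equation for [b] up to a source [(b - c) * q], where [q]
    is the difference quotient of the contribution of the left branch to the
    equation for [c]. So the quotient of the densities is [S_b (d + q)], and the
    quotient [d] of the fixed points solves [d = P_b d + Q] with
    [Q v = 2^-1 * S_b q ((1 + v) / 2)]. The mean value theorem bounds [q] and its
    derivative, and shows that [q] is the difference of a function of the cone and
    a multiple of [1 - ln x], uniformly in [b] and [c] ([rhoh_qquot]). Since [Q] is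
    proportional to [P_b k_c - k_c], it has mass 0; its iterates decrease
    exponentially, and [d] is the sum of the series of the [P_b^m Q]. Everything
    converges when [b], [c] and the point move together ([rquot_cont]), which gives
    the derivative, its joint continuity and its bound at the same time.

    The distribution function of the density satisfies the identity that invariance
    means on half-lines ([cdf_invariant]), so that the density divided by its mass
    is that of an absolutely continuous invariant probability, which is the given
    one by uniqueness. Finally the integrals of the density against a function [phi],
    including the mass itself, are differentiated under the integral sign; the
    dominating function [|phi x| * x `^ (- v) * (1 - ln x)] is integrable by Young's
    inequality for some [v] larger than all the parameters
    ([Lfun01_weight_integrable]). *)

(** * Limits, slopes and mean values *)

Section RealSequences.
Context {R : realType}.
Implicit Types (u e : nat -> R) (f : R -> R).

Lemma cvgn_dist u e l : (forall n, `|u n - l| <= e n) ->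
  e n @[n --> \oo] --> 0 -> u n @[n --> \oo] --> l.
Proof.
move=> ue /cvgrPdist_lt e0; apply/cvgrPdist_lt => d d0.
near=> n; rewrite distrC (le_lt_trans (ue n))//.
have : `|0 - e n| < d by near: n; exact: e0.
by rewrite sub0r normrN; apply: le_lt_trans; rewrite ler_norm.
Unshelve. all: end_near. Qed.

Lemma cvgn_mul0 (c : R) u : u n @[n --> \oo] --> 0 -> c * u n @[n --> \oo] --> 0.
Proof. by move=> u0; rewrite -(mulr0 c); apply: cvgM u0; exact: cvg_cst. Qed.

Lemma cvgn_normB0 u l : u n @[n --> \oo] --> l -> `|u n - l| @[n --> \oo] --> 0.
Proof. by move=> ul; rewrite -(normr0 R); apply: cvg_norm; apply/subr_cvg0. Qed.

Lemma harmonic01 n : 0 < (harmonic n : R) <= 1.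
Proof. by rewrite /harmonic invr_gt0 ltr0n invf_le1 ?ltr0n// ler1n. Qed.

Lemma limn_le_near u l C : u n @[n --> \oo] --> l ->
  (\forall n \near \oo, u n <= C) -> l <= C.
Proof.
move=> ul uC; rewrite -(cvg_lim _ ul)//; apply: limr_le => //.
by apply/cvg_ex; exists l.
Qed.

Lemma limn_le_cst u l C : u n @[n --> \oo] --> l -> (forall n, u n <= C) -> l <= C.
Proof. by move=> ul uC; apply: limn_le_near ul _; exact: nearW. Qed.

Lemma limn_ge_cst u l C : u n @[n --> \oo] --> l -> (forall n, C <= u n) -> C <= l.
Proof.
move=> ul uC; rewrite -lerN2; apply: (limn_le_cst (cvgN ul)) => n.
by rewrite lerN2.
Qed.

Lemma limn_dist u e :
  (forall n m, (n <= m)%N -> `|u m - u n| <= e n) -> e n @[n --> \oo] --> 0 ->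
  u n @[n --> \oo] --> limn u /\ forall n, `|limn u - u n| <= e n.
Proof.
move=> ue /cvgrPdist_lt e0.
have cu : cvgn u.
  apply/cauchy_cvgP/cauchy_exP => d d0.
  have [N _ NP] := e0 _ d0.
  exists (u N); exists N => //= n Nn.
  rewrite /ball/= distrC (le_lt_trans (ue _ _ Nn))//.
  have /= := NP N (leqnn _).
  by rewrite sub0r normrN; apply: le_lt_trans; rewrite ler_norm.
split => // n.
have ul : `|u m - u n| @[m --> \oo] --> `|limn u - u n|.
  by apply: cvg_norm; apply: cvgB cu _; exact: cvg_cst.
by apply: limn_le_near ul _; exists n => //= m nm; exact: ue.
Qed.

(** The exchange of two limits: [u] is the limit of [v M], uniformly. *)
Lemma cvgn_uniform_approx (u : nat -> R) (v : nat -> nat -> R) (w : nat -> R)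
    (e : nat -> R) l :
  (forall M, v M n @[n --> \oo] --> w M) ->
  (forall M, \forall n \near \oo, `|u n - v M n| <= e M) ->
  (forall M, `|l - w M| <= e M) -> e n @[n --> \oo] --> 0 ->
  u n @[n --> \oo] --> l.
Proof.
move=> vw uv log_weight /cvgrPdist_lt e0; apply/cvgrPdist_lt => d d0.
have d3 : 0 < d / 3 by rewrite divr_gt0.
have [M _ /(_ M (leqnn _))/=] := e0 _ d3.
rewrite sub0r normrN => /(le_lt_trans (ler_norm _)) eM.
near=> n.
have h1 : `|u n - v M n| <= e M by near: n; exact: uv.
have h2 : `|w M - v M n| < d / 3.
  by near: n; move/cvgrPdist_lt : (vw M); apply.
have h3 := log_weight M.
have -> : l - u n = (l - w M) + (w M - v M n) - (u n - v M n) by ring.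
rewrite (le_lt_trans (ler_normB _ _))// (le_lt_trans (lerD (ler_normD _ _) (lexx _)))//.
by lra.
Unshelve. all: end_near. Qed.

Lemma limn_le2 u v l m : u n @[n --> \oo] --> l -> v n @[n --> \oo] --> m ->
  (forall n, u n <= v n) -> l <= m.
Proof.
move=> ul vm uv; rewrite -subr_ge0.
by apply: (limn_ge_cst (cvgB vm ul)) => n; rewrite subr_ge0.
Qed.

Lemma slope_is_derive f (x l : R) :
  (forall u, (forall n, u n != x) -> u n @[n --> \oo] --> x ->
    (f (u n) - f x) / (u n - x) @[n --> \oo] --> l) -> is_derive x 1 f l.
Proof.
move=> fl.
have cf : h^-1 *: ((f \o shift x) (h *: 1) - f x) @[h --> 0^'] --> l.
  apply/cvgr_dnbhsP => u [u0 ucvg].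
  have := fl (fun n => u n + x).
  have -> : (fun n => (f (u n + x) - f x) / (u n + x - x)) =
     (fun n => (u n)^-1 *: (f (u n *: 1 + x) - f x)).
    by apply/funext => n; rewrite addrK [_ *: 1]mulr1 mulrC.
  apply.
  - by move=> n; rewrite -subr_eq0 addrK.
  - by rewrite -[X in _ --> X]add0r; apply: cvgD => //; exact: cvg_cst.
apply: DeriveDef; first by apply/cvg_ex; exists l.
by rewrite /derive; apply/cvg_lim.
Qed.

Lemma is_derive_slope f (x l : R) u : is_derive x 1 f l ->
  (forall n, u n != x) -> u n @[n --> \oo] --> x ->
  (f (u n) - f x) / (u n - x) @[n --> \oo] --> l.
Proof.
move=> [df <-] ux ucvg.
have := df; rewrite /derivable => /cvg_ex[/= m mP].
have -> : 'D_1 f x = m by apply/cvg_lim.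
have /cvgr_dnbhsP := mP => /(_ (fun n => u n - x)).
have -> : (fun n => (u n - x)^-1 *: (f ((u n - x) *: 1 + x) - f x)) =
  (fun n => (f (u n) - f x) / (u n - x)).
  by apply/funext => n; rewrite [_ *: 1]mulr1 subrK mulrC.
apply; split; first by move=> n; rewrite subr_eq0.
by apply/subr_cvg0.
Qed.

End RealSequences.

Section MeanValue.
Context {R : realType}.
Implicit Types (a b : R) (f df : R -> R).

Definition between (a b z : R) := (Num.min a b <= z) && (z <= Num.max a b).

Lemma between_sym a b z : between a b z = between b a z.
Proof. by rewrite /between minC maxC. Qed.

Lemma between_leE a b z : a <= b -> between a b z = (a <= z <= b).
Proof. by move=> ab; rewrite /between min_l ?max_r. Qed.

Lemma between_dist a b z : between a b z -> `|z - b| <= `|a - b|.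
Proof.
rewrite /between ge_min le_max => /andP[]; have [ab|ba] := leP a b.
- move=> /orP zb /orP za.
  have [azz zbb] : a <= z /\ z <= b by case: zb za => ? [] ?; split; lra.
  by rewrite ler0_norm ?ler0_norm; lra.
- move=> /orP zb /orP za.
  have [azz zbb] : b <= z /\ z <= a by case: zb za => ? [] ?; split; lra.
  by rewrite ger0_norm ?ger0_norm; lra.
Qed.

Lemma between_itv lo hi a b z : lo <= a <= hi -> lo <= b <= hi ->
  between a b z -> lo <= z <= hi.
Proof.
move=> /andP[la ah] /andP[lb bh] /andP[].
rewrite ge_min le_max => /orP h1 /orP h2.
by apply/andP; split; [case: h1 => ? | case: h2 => ?]; lra.
Qed.

(** The endpoints come in either order, so that difference quotients need no
    distinction of cases. *)
Lemma between_mean_value a b f df :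
  (forall z, between a b z -> is_derive z 1 f (df z)) ->
  exists2 z, between a b z & f b - f a = df z * (b - a).
Proof.
have main c d : c < d -> (forall z, between c d z -> is_derive z 1 f (df z)) ->
    exists2 z, between c d z & f d - f c = df z * (d - c).
  move=> cd fd.
  have bt z : between c d z = (c <= z <= d).
    by rewrite /between min_l ?max_r ?(ltW cd).
  have [||w wcd ->] := @MVT R f df c d cd.
  - by move=> z; rewrite in_itv/= => /andP[/ltW ? /ltW ?]; apply: fd; rewrite bt; apply/andP.
  - apply: derivable_within_continuous => z; rewrite in_itv/= => zcd.
    by have := fd z; rewrite bt => /(_ zcd)[].
  - exists w => //; move: wcd; rewrite in_itv/= bt => /andP[? ?].
    by apply/andP; split; exact: ltW.
move=> fd; have [ab|ba|ab] := ltgtP a b.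
- exact: main.
- have [z zab fab] := main b a ba (fun z => fd z \o (fun h => eq_ind _ _ h _ (between_sym b a z))).
  exists z; first by rewrite between_sym.
  by rewrite -opprB fab -mulrN opprB.
- by exists a; rewrite ?ab ?subrr ?mulr0 // /between minxx maxxx lexx.
Qed.

Lemma ge0_derive_le (lo hi : R) f df :
  (forall z, lo < z < hi -> is_derive z 1 f (df z)) ->
  (forall z, lo < z < hi -> 0 <= df z) ->
  forall s t, lo < s -> s <= t -> t < hi -> f s <= f t.
Proof.
move=> fd df0 s t los st thi.
have bt z : between s t z -> lo < z < hi.
  rewrite /between min_l// max_r// => /andP[? ?]; apply/andP; split.
    exact: lt_le_trans los _.
  exact: le_lt_trans thi.
have [z zst fst] := between_mean_value (fun z h => fd z (bt z h)).
by rewrite -subr_ge0 fst mulr_ge0 ?subr_ge0// df0// bt.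
Qed.

End MeanValue.

(** * The left branch and its inverse *)

Section LeftBranch.
Context {R : realType}.
Implicit Types (a b x y : R).

(** The power [(2 * y) `^ a], written so that it is visibly smooth in both variables. *)
Definition wt a y : R := expR (a * ln (2 * y)).
Definition left_branch a y : R := y * (1 + wt a y).
(** The slope of the left branch. *)
Definition tau a y : R := 1 + (1 + a) * wt a y.
(** The inverse of the left branch, from ]0, 1] to ]0, 1/2]; it is 0 at the points
    that have no preimage. *)
Definition ginv a x : R := xget 0 [set y | 0 < y <= 2^-1 /\ left_branch a y = x].

Lemma wt_gt0 a y : 0 < wt a y. Proof. exact: expR_gt0. Qed.

Lemma ln2y_le0 y : y <= 2^-1 -> ln (2 * y) <= 0.
Proof. by move=> y2; apply: ln_le0; lra. Qed.

Lemma wt_le1 a y : 0 <= a -> y <= 2^-1 -> wt a y <= 1.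
Proof. by move=> a0 y2; rewrite /wt expR_le1 mulr_ge0_le0// ln2y_le0. Qed.

Lemma wt_le a y y' : 0 <= a -> 0 < y -> y <= y' -> wt a y <= wt a y'.
Proof.
move=> a0 y0 yy'; rewrite /wt ler_expR ler_wpM2l// ler_ln ?posrE; lra.
Qed.

Lemma wt_le_param a b y : a <= b -> y <= 2^-1 -> wt b y <= wt a y.
Proof.
by move=> ab y2; rewrite /wt ler_expR ler_wnM2r// ln2y_le0.
Qed.

Lemma wt1 y : 0 < y -> wt 1 y = 2 * y.
Proof. by move=> y0; rewrite /wt mul1r lnK// posrE; lra. Qed.

Lemma wt_ge a y : a <= 1 -> 0 < y -> y <= 2^-1 -> 2 * y <= wt a y.
Proof. by move=> a1 y0 y2; rewrite -wt1//; exact: wt_le_param. Qed.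

Lemma wt_half a : wt a 2^-1 = 1.
Proof. by rewrite /wt divff// ln1 mulr0 expR0. Qed.

Lemma left_branch_half a : left_branch a 2^-1 = 1.
Proof. by rewrite /left_branch wt_half; field. Qed.

Lemma tau_ge1 a y : 0 <= a -> 1 <= tau a y.
Proof. by move=> a0; rewrite /tau lerDl mulr_ge0 ?ltW ?wt_gt0//; lra. Qed.

Lemma tau_gt0 a y : 0 <= a -> 0 < tau a y.
Proof. by move=> /(tau_ge1 y); apply: lt_le_trans. Qed.

Lemma left_branch_expand a y y' : 0 <= a -> 0 < y -> y <= y' ->
  y' - y <= left_branch a y' - left_branch a y.
Proof.
move=> a0 y0 yy'; rewrite /left_branch.
have := wt_le a0 y0 yy'; have := wt_gt0 a y; nra.
Qed.

Lemma is_derive_wt a y : 0 < y -> is_derive y 1 (wt a) (a * wt a y / y).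
Proof.
move=> y0; have y20 : 0 < 2 * y by lra.
have d1 : is_derive y 1 (fun z : R => 2 * z) 2.
  by apply: is_derive_eq; rewrite /GRing.scale/= mulr1.
have d2 := @is_derive1_comp _ _ _ _ _ _ (is_derive1_ln y20) d1.
have d3 : is_derive y 1 (fun z : R => a * ln (2 * z)) (a / y).
  apply: (@is_derive_eq _ _ _ _ _ _ _ _ (is_deriveM (is_derive_cst a y 1) d2)).
  rewrite /GRing.scale/= mulr0 addr0; field; lra.
have d4 := @is_derive1_comp R expR (fun z => a * ln (2 * z)) y _ _ (is_derive_expR _) d3.
by apply: (is_derive_eq d4); rewrite /wt; field; lra.
Qed.

Lemma is_derive_wt_param a y :
  is_derive a 1 (wt ^~ y) (ln (2 * y) * wt a y).
Proof.
have d1 : is_derive a 1 (fun z : R => z * ln (2 * y)) (ln (2 * y)).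
  by apply: is_derive_eq; rewrite /GRing.scale/= mulr1 mulr0 add0r.
have d4 := @is_derive1_comp R expR (fun z => z * ln (2 * y)) a _ _ (is_derive_expR _) d1.
by apply: (is_derive_eq d4); rewrite /wt mulrC.
Qed.

Lemma is_derive_left_branch a y : 0 < y -> is_derive y 1 (left_branch a) (tau a y).
Proof.
move=> y0; have d := is_derive_wt a y0.
rewrite /left_branch; apply: is_derive_eq; rewrite /GRing.scale/= /tau; field; lra.
Qed.

Lemma cvg_ln2 (u : nat -> R) y : u n @[n --> \oo] --> y -> 0 < y ->
  ln (2 * u n) @[n --> \oo] --> ln (2 * y).
Proof.
move=> uy y0; have y20 : 0 < 2 * y by lra.
have h : 2 * u n @[n --> \oo] --> 2 * y by apply: cvgM => //; exact: cvg_cst.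
by apply: continuous_cvg h; exact: continuous_ln.
Qed.

Lemma cvg_wt (al u : nat -> R) a y : al n @[n --> \oo] --> a ->
  u n @[n --> \oo] --> y -> 0 < y -> wt (al n) (u n) @[n --> \oo] --> wt a y.
Proof.
move=> ala uy y0; apply: continuous_cvg; first exact: continuous_expR.
by apply: cvgM => //; exact: cvg_ln2.
Qed.

Lemma cvg_tau (al u : nat -> R) a y : al n @[n --> \oo] --> a ->
  u n @[n --> \oo] --> y -> 0 < y -> tau (al n) (u n) @[n --> \oo] --> tau a y.
Proof.
move=> ala uy y0; apply: cvgD; first exact: cvg_cst.
apply: cvgM; last exact: cvg_wt.
by apply: cvgD => //; exact: cvg_cst.
Qed.

Lemma left_branch_inj a y y' : 0 <= a -> 0 < y -> 0 < y' -> left_branch a y = left_branch a y' -> y = y'.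
Proof.
move=> a0 y0 y'0 e; have [yy'|y'y] := leP y y'.
  by have := left_branch_expand a0 y0 yy'; rewrite e => ?; apply/eqP; rewrite eq_le; apply/andP; lra.
by have := left_branch_expand a0 y'0 (ltW y'y); rewrite e => ?; lra.
Qed.

Lemma ginvP a x : 0 < a -> 0 < x <= 1 ->
  [/\ 0 < ginv a x, ginv a x <= 2^-1 & left_branch a (ginv a x) = x].
Proof.
move=> a0 /andP[x0 x1].
suff : [set y | 0 < y <= 2^-1 /\ left_branch a y = x] (ginv a x).
  by move=> [/andP[? ?] ?].
have x2 : x / 2 <= 2^-1 by lra.
have cl : {within `[x / 2, 2^-1], continuous (left_branch a)}.
  apply: derivable_within_continuous => z; rewrite in_itv/= => /andP[xz _].
  have z0 : 0 < z by lra.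
  by have [] := is_derive_left_branch a z0.
have lx : left_branch a (x / 2) <= x.
  rewrite /left_branch; have := wt_le1 (ltW a0) x2; have := wt_gt0 a (x / 2); nra.
have [|y] := @IVT R (left_branch a) (x / 2) 2^-1 x x2 cl.
  rewrite left_branch_half min_l ?max_r; [|lra..].
  by rewrite lx.
rewrite in_itv/= => /andP[xy y2] lyx.
rewrite /ginv; case: xgetP => [z -> //|/(_ y)[]/=].
by split => //; lra.
Qed.

Lemma ginvK a y : 0 < a -> 0 < y <= 2^-1 -> ginv a (left_branch a y) = y.
Proof.
move=> a0 /andP[y0 y2].
have w1 := wt_le1 (ltW a0) y2; have w0 := wt_gt0 a y.
have [|g0 g2 gl] := @ginvP a (left_branch a y) a0.
  by rewrite /left_branch; apply/andP; split; nra.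
exact: (left_branch_inj (ltW a0)).
Qed.

Lemma ginv1 a : 0 < a -> ginv a 1 = 2^-1.
Proof. by move=> a0; have := @ginvK a 2^-1 a0; rewrite left_branch_half; apply; lra. Qed.

Lemma ginv_lt a x : 0 < a -> 0 < x <= 1 -> ginv a x < x.
Proof.
move=> a0 x01; have [g0 g2] := ginvP a0 x01.
by rewrite /left_branch; have := wt_gt0 a (ginv a x) => ? e; rewrite -[ltRHS]e; nra.
Qed.

Lemma ginv_ge a x : 0 < a -> 0 < x <= 1 -> x / 2 <= ginv a x.
Proof.
move=> a0 x01; have [g0 g2] := ginvP a0 x01.
by rewrite /left_branch; have := wt_le1 (ltW a0) g2 => ? e; nra.
Qed.

(** The left branch expands distances, and moves with the parameter at a speed
    at most 1, because [y * - ln (2 * y) <= 1]: this holds up to the neutral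
    fixed point. *)
Lemma ginv_dist a x b x' : 0 < a -> 0 < x <= 1 -> 0 < b -> 0 < x' <= 1 ->
  `|ginv a x - ginv b x'| <= `|x - x'| + `|a - b|.
Proof.
move=> a0 x01 b0 x'01.
have [g0 g2 gx] := ginvP a0 x01.
have [h0 h2 hx] := ginvP b0 x'01.
set y := ginv a x in g0 g2 gx *; set z := ginv b x' in h0 h2 hx *.
have e1 : `|y - z| <= `|left_branch a y - left_branch a z|.
  have [yz|zy] := leP y z.
    have := left_branch_expand (ltW a0) g0 yz => ?.
    by rewrite ler0_norm ?ler0_norm; lra.
  have := left_branch_expand (ltW a0) h0 (ltW zy) => ?.
  by rewrite ger0_norm ?ger0_norm; lra.
have wlip (c d : R) : 0 < c -> c <= d -> z * (wt c z - wt d z) <= d - c.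
  move=> c0 cd.
  have L0 := ln2y_le0 h2.
  have c1 := wt_le1 (ltW c0) h2; have cp := wt_gt0 c z.
  have dE : wt d z = wt c z * expR ((d - c) * ln (2 * z)).
    by rewrite /wt -expRD; congr expR; ring.
  have ex := expR_ge1Dx ((d - c) * ln (2 * z)).
  have Lz : - ln (2 * z) <= (2 * z)^-1 - 1.
    rewrite -lnV ?posrE; last lra.
    have p : 0 < (2 * z)^-1 by rewrite invr_gt0; lra.
    have := @le_ln1Dx R ((2 * z)^-1 - 1).
    by rewrite [1 + _]addrC subrK; apply; lra.
  have zz : z * (2 * z)^-1 = 2^-1 by field; lra.
  have s1 : z * (- ln (2 * z)) <= 1 by nra.
  have s2 : wt c z - wt d z <= (d - c) * (- ln (2 * z)).
    rewrite dE; set E := expR _ in ex *.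
    have t0 : 0 <= (d - c) * - ln (2 * z) by rewrite mulr_ge0 ?oppr_ge0 ?subr_ge0.
    have : wt c z * (1 - E) <= wt c z * ((d - c) * - ln (2 * z)).
      by apply: ler_wpM2l; [exact: ltW | lra].
    by nra.
  by nra.
have e2 : `|left_branch b z - left_branch a z| <= `|a - b|.
  have -> : left_branch b z - left_branch a z = z * (wt b z - wt a z) by rewrite /left_branch; ring.
  have [ab|ba] := leP a b.
    have h1 := wt_le_param ab h2; have h := wlip _ _ a0 ab.
    by rewrite ler0_norm ?ler0_norm; nra.
  have h1 := wt_le_param (ltW ba) h2; have h := wlip _ _ b0 (ltW ba).
  by rewrite ger0_norm ?ger0_norm; nra.
apply: (le_trans e1); rewrite gx -(subrKA (left_branch b z)) (le_trans (ler_normD _ _))// hx.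
by rewrite lerD2l -hx.
Qed.

Lemma cvg_ginv (al u : nat -> R) a x : (forall n, 0 < al n) ->
  (forall n, 0 < u n <= 1) -> 0 < a -> 0 < x <= 1 ->
  al n @[n --> \oo] --> a -> u n @[n --> \oo] --> x ->
  ginv (al n) (u n) @[n --> \oo] --> ginv a x.
Proof.
move=> al0 u01 a0 x01 ala ux.
apply: (@cvgn_dist _ _ (fun n => `|u n - x| + `|al n - a|)).
  by move=> n; exact: ginv_dist.
rewrite -[X in _ --> X]addr0; apply: cvgD.
  by apply: cvgn_normB0.
by apply: cvgn_normB0.
Qed.

Lemma ginv_le a x x' : 0 < a -> 0 < x -> x <= x' -> x' <= 1 ->
  ginv a x <= ginv a x'.
Proof.
move=> a0 x0 xx' x'1.
have [|g0 g2 gx] := @ginvP a x a0; first by lra.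
have [|h0 h2 hx] := @ginvP a x' a0; first by lra.
rewrite leNgt; apply/negP => hg.
by have := left_branch_expand (ltW a0) h0 (ltW hg); rewrite gx hx; lra.
Qed.

Lemma ginv_lt_half a x : 0 < a -> 0 < x < 1 -> ginv a x < 2^-1.
Proof.
move=> a0 /andP[x0 x1]; have [|g0 g2 gx] := @ginvP a x a0.
  by lra.
rewrite lt_neqAle g2 andbT; apply/eqP => g; move: gx; rewrite g left_branch_half; lra.
Qed.

Lemma is_derive_ginv a x : 0 < a -> 0 < x < 1 ->
  is_derive x 1 (ginv a) (tau a (ginv a x))^-1.
Proof.
move=> a0 x01; have /andP[x0 x1] := x01.
have [|g0 g2 gx] := @ginvP a x a0; first by lra.
have gh := ginv_lt_half a0 x01.
rewrite -{1}gx; apply: is_derive_inverse.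
- near=> y; apply: ginvK => //; apply/andP; split.
    by near: y; apply: lt_nbhsr.
  by apply: ltW; near: y; apply: lt_nbhsl.
- near=> y.
  have y0 : 0 < y by near: y; apply: lt_nbhsr.
  have [dy _] := is_derive_left_branch a y0.
  exact/differentiable_continuous/derivable1_diffP.
- exact: is_derive_left_branch.
- by rewrite gt_eqF// tau_gt0// ltW.
Unshelve. all: end_near. Qed.

(** Implicit differentiation of [left_branch t (ginv t x) = x] with respect to [t]. *)
Lemma is_derive_ginv_param a x : 0 < a -> 0 < x <= 1 ->
  is_derive a 1 (ginv ^~ x)
    (- (ginv a x * wt a (ginv a x) * ln (2 * ginv a x)) / tau a (ginv a x)).
Proof.
move=> a0 x01; have [g0 g2 gx] := ginvP a0 x01.
set y := ginv a x in g0 g2 gx *.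
have aux (u : nat -> R) : (forall n, 0 < u n) -> (forall n, u n != a) ->
    u n @[n --> \oo] --> a ->
    (ginv (u n) x - y) / (u n - a) @[n --> \oo] -->
    - (y * wt a y * ln (2 * y)) / tau a y.
  move=> u0 une ua.
  have gn n := ginvP (u0 n) x01.
  pose v n := ginv (u n) x.
  have vy : v n @[n --> \oo] --> y.
    by apply: (@cvg_ginv u (fun=> x)) => //; exact: cvg_cst.
  have /choice[xi xiP] : forall n, exists z, between (v n) y z /\
      left_branch a y - left_branch a (v n) = tau a z * (y - v n).
    move=> n; have [|z zb e] := @between_mean_value _ (v n) y (left_branch a) (tau a).
      move=> z /andP[zm _].
      apply: is_derive_left_branch; apply: lt_le_trans zm.
      by rewrite lt_min g0; have [-> _ _] := gn n.
    by exists z.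
  have /choice[th thP] : forall n, exists z, between (u n) a z /\
      wt a (v n) - wt (u n) (v n) = ln (2 * v n) * wt z (v n) * (a - u n).
    move=> n; have [z zb e] := @between_mean_value _ (u n) a (wt ^~ (v n))
      (fun z => ln (2 * v n) * wt z (v n)) (fun z _ => is_derive_wt_param z (v n)).
    by exists z.
  have xiy : xi n @[n --> \oo] --> y.
    apply: (@cvgn_dist _ _ (fun n => `|v n - y|)).
      by move=> n; apply: between_dist; exact: (xiP n).1.
    by apply: cvgn_normB0.
  have tha : th n @[n --> \oo] --> a.
    apply: (@cvgn_dist _ _ (fun n => `|u n - a|)).
      by move=> n; apply: between_dist; exact: (thP n).1.
    by apply: cvgn_normB0.
  have -> : (fun n => (ginv (u n) x - y) / (u n - a)) =
      (fun n => - (v n * wt (th n) (v n) * ln (2 * v n)) / tau a (xi n)).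
    apply/funext => n; have [v0 v2 vx] := gn n.
    have [_ e1] := xiP n; have [_ e2] := thP n.
    have t0 : tau a (xi n) != 0 by rewrite gt_eqF// tau_gt0// ltW.
    have ua0 : u n - a != 0 by rewrite subr_eq0.
    apply/eqP; rewrite eqr_div//; apply/eqP.
    have : left_branch a y = left_branch (u n) (v n) by rewrite gx vx.
    move: e1 => /[swap] ->; rewrite /left_branch -/(v n) => e1.
    have e3 : v n * (wt (u n) (v n) - wt a (v n)) = tau a (xi n) * (y - v n).
      by rewrite -e1; ring.
    have -> : (v n - y) * tau a (xi n) = v n * (wt a (v n) - wt (u n) (v n)).
      by rewrite -[RHS]opprK -mulrN opprB e3; ring.
    by rewrite e2; ring.
  have y20 : 0 < 2 * y by lra.
  apply: cvgM; last first.
    apply: cvgV; first by rewrite gt_eqF// tau_gt0// ltW.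
    by apply: (@cvg_tau (fun=> a)) => //; exact: cvg_cst.
  apply: cvgN; apply: cvgM; last first.
    exact: cvg_ln2.
  by apply: cvgM => //; exact: cvg_wt.
apply: slope_is_derive => u une ua.
have [N _ NP] : \forall n \near \oo, 0 < u n by apply: (cvgr_gt a ua).
rewrite -(cvg_shiftn N)/=; apply: (aux (fun n => u (n + N)%N)).
- by move=> n; apply: NP => /=; exact: leq_addl.
- by [].
- by rewrite (cvg_shiftn N).
Qed.

End LeftBranch.

(** * Sums over the passages through the left branch *)

Section InducedSum.
Context {R : realType}.
Implicit Types (a b x y C : R) (r : R -> R) (n m : nat).

(** With [g := ginv a], [jac a n] is the derivative of the [n]-th iterate of [g],
    and [psum a r n x] the sum of the [jac a k x * r (iter k g x)] over [k < n].
    Their limit [sumS a r] solves the equation [f = r + (f \o g) / (tau a \o g)]: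
    it is a density on ]0, 1] fed by [r] and transported by the left branch. *)
Fixpoint psum a r n x : R :=
  if n is m.+1 then r x + psum a r m (ginv a x) / tau a (ginv a x) else 0.
Fixpoint jac a n x : R :=
  if n is m.+1 then jac a m (ginv a x) / tau a (ginv a x) else 1.
Definition sumS a r x : R := limn (fun n => psum a r n x).

Lemma ginv01 a x : 0 < a -> 0 < x <= 1 -> 0 < ginv a x <= 1.
Proof.
by move=> a0 x01; have [g0 g2 _] := ginvP a0 x01; lra.
Qed.

Lemma iter_ginv01 a n x : 0 < a -> 0 < x <= 1 -> 0 < iter n (ginv a) x <= 1.
Proof. by move=> a0 x01; elim: n => //= n IH; exact: ginv01. Qed.

Lemma ge1_1Bln x : 0 < x <= 1 -> 1 <= 1 - ln x.
Proof. by move=> /andP[x0 x1]; have := ln_le0 x1; lra. Qed.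

(** The reciprocals of the points of the orbit grow by at least 1 at each step,
    because [wt a y >= 2 * y]. *)
Lemma iter_ginv_le a n x : 0 < a <= 1 -> 0 < x <= 1 ->
  iter n (ginv a) x <= n.+1%:R^-1.
Proof.
move=> /andP[a0 a1] x01.
have n0 k : 0 < k.+1%:R :> R by rewrite ltr0n.
elim: n => [|n IH] /=; first by rewrite invr1; case/andP: x01.
set t := iter n (ginv a) x in IH *.
have t01 : 0 < t <= 1 by exact: iter_ginv01.
have [g0 g2 gt] := ginvP a0 t01; set z := ginv a t in g0 g2 gt *.
have wz := wt_ge a1 g0 g2.
have tn : t * n.+1%:R <= 1 by rewrite -ler_pdivlMr// div1r.
rewrite -[leRHS]div1r ler_pdivlMr//.
have nE : n.+2%:R = n.+1%:R + 1 :> R by rewrite -natr1.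
have N1 : 1 <= n.+1%:R :> R by rewrite ler1n.
rewrite nE; set N := n.+1%:R in tn N1 *.
have zN : z * (1 + 2 * z) * N <= 1.
  apply: le_trans tn; apply: ler_wpM2r; first exact: ler0n.
  by rewrite -gt; apply: ler_wpM2l; [exact: ltW | lra].
rewrite leNgt; apply/negP => p1.
have : (z * (N + 1) - z) * (1 + 2 * z) <= 1 by apply: le_trans zN; lra.
nra.
Qed.

Lemma jac_gt0 a n x : 0 < a -> 0 < jac a n x.
Proof.
move=> a0; elim: n x => [//|n IH] x /=.
by rewrite divr_gt0// tau_gt0// ltW.
Qed.

(** The left branch is convex, so that the iterates of its inverse are concave:
    their slopes are at most those of the chords from the origin. *)
Lemma jac_le a n x : 0 < a -> 0 < x <= 1 -> jac a n x <= iter n (ginv a) x / x.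
Proof.
move=> a0; elim: n x => [|n IH] x x01.
  by rewrite /= divff// gt_eqF//; case/andP: x01.
have /andP[x0 _] := x01; have [g0 g2 gx] := ginvP a0 x01.
have t0 : 0 < tau a (ginv a x) by rewrite tau_gt0// ltW.
have i0 : 0 < iter n (ginv a) (ginv a x).
  by have /andP[] := iter_ginv01 n a0 (ginv01 a0 x01).
rewrite iterSr [jac _ _ _]/=.
rewrite (le_trans (ler_wpM2r _ (IH _ (ginv01 a0 x01))))//; first by rewrite invr_ge0 ltW.
rewrite -mulrA ler_wpM2l ?(ltW i0)// -invfM lef_pV2 ?posrE ?mulr_gt0//.
rewrite -[X in X <= _]gx; apply: ler_wpM2l; first exact: ltW.
by rewrite /tau; have := wt_gt0 a (ginv a x); nra.
Qed.

Lemma psum_add a r n m x :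
  psum a r (n + m) x = psum a r n x + jac a n x * psum a r m (iter n (ginv a) x).
Proof.
elim: n x => [|n IH] x; first by rewrite add0n /= add0r mul1r.
by rewrite addSn iterSr /= IH; ring.
Qed.

Lemma psum_ext a r1 r2 n x : 0 < a -> 0 < x <= 1 ->
  (forall z : R, 0 < z <= 1 -> r1 z = r2 z) -> psum a r1 n x = psum a r2 n x.
Proof.
move=> a0 + r12; elim: n x => [//|n IH] x x01 /=.
by rewrite r12// IH//; exact: ginv01.
Qed.

Lemma psum_lin a r1 r2 (c : R) n x :
  psum a (fun z => r1 z + c * r2 z) n x = psum a r1 n x + c * psum a r2 n x.
Proof. by elim: n x => [|n IH] x /=; [ring | rewrite IH; ring]. Qed.

Lemma psum_le a r1 r2 n x : 0 < a -> 0 < x <= 1 ->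
  (forall z : R, 0 < z <= 1 -> r1 z <= r2 z) -> psum a r1 n x <= psum a r2 n x.
Proof.
move=> a0 + r12; elim: n x => [//|n IH] x x01 /=.
apply: lerD; first exact: r12.
apply: ler_wpM2r; last by apply: IH; exact: ginv01.
by rewrite invr_ge0 ltW// tau_gt0// ltW.
Qed.

Lemma psum_ge0 a r n x : 0 < a -> 0 < x <= 1 ->
  (forall z : R, 0 < z <= 1 -> 0 <= r z) -> 0 <= psum a r n x.
Proof.
move=> a0 + r0; elim: n x => [//|n IH] x x01 /=.
apply: addr_ge0; first exact: r0.
apply: divr_ge0; first by apply: IH; exact: ginv01.
by rewrite ltW// tau_gt0// ltW.
Qed.

(** A pointwise solution of [r + B \o ginv / tau <= B] dominates all the partial
    sums; it replaces any asymptotic study of the iterates of [ginv]. *)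
Lemma psum_supersolution a r (B : R -> R) n x : 0 < a -> 0 < x <= 1 ->
  (forall z : R, 0 < z <= 1 -> 0 <= B z) ->
  (forall z : R, 0 < z <= 1 -> `|r z| + B (ginv a z) / tau a (ginv a z) <= B z) ->
  `|psum a r n x| <= B x.
Proof.
move=> a0 + B0 rB; elim: n x => [|n IH] x x01 /=; first by rewrite normr0 B0.
have g01 := ginv01 a0 x01.
have t0 : 0 < tau a (ginv a x) by rewrite tau_gt0// ltW.
rewrite (le_trans (ler_normD _ _))// (le_trans _ (rB _ x01))// lerD2l.
by rewrite normrM normfV (gtr0_norm t0) ler_wpM2r ?invr_ge0 ?IH// ltW.
Qed.

Lemma powR_expR (x s : R) : 0 < x -> x `^ s = expR (s * ln x).
Proof. by move=> x0; rewrite /powR gt_eqF. Qed.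

(** Bernoulli's inequality for an exponent between 0 and 1, in logarithmic form. *)
Lemma bernoulli_ln a (w : R) : 0 <= a <= 1 -> 0 <= w ->
  a * ln (1 + w) <= ln (1 + a * w).
Proof.
move=> /andP[a0 a1] w0.
have t0 : 0 < 1 + a * w by nra.
have w10 : 0 < 1 + w by lra.
have aux (u : R) : 0 < u -> ln u <= u - 1.
  by move=> u0; rewrite -{1}(subrK 1 u) addrC le_ln1Dx//; lra.
have h1 := aux ((1 + w) / (1 + a * w)) (divr_gt0 w10 t0).
have h2 := aux (1 + a * w)^-1; rewrite invr_gt0 in h2; have {}h2 := h2 t0.
rewrite ln_div ?posrE// in h1; rewrite lnV ?posrE// in h2.
have e : a * ((1 + w) / (1 + a * w) - 1) + (1 - a) * ((1 + a * w)^-1 - 1) = 0.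
  by field; lra.
nra.
Qed.

(** The function [x `^ (- a)] exceeds its transport by the left branch by an amount
    that is bounded below. Hence [6 * x `^ (- a)] is a supersolution for the
    source 1, and [6 * x `^ (- a) * (4 - ln x)] for the source [1 - ln x]. *)
Lemma powR_supersolution a x : 0 < a <= 1 -> 0 < x <= 1 ->
  let y := ginv a x in
  [/\ 1 <= y `^ (- a) * wt a y,
      y `^ (- a) * wt a y / (2 * tau a y) <= x `^ (- a) - y `^ (- a) / tau a y,
      ln x - ln y <= wt a y & tau a y <= 3].
Proof.
move=> /andP[a0 a1] x01 y.
have [y0 y2 yx] := ginvP a0 x01; rewrite -/y in y0 y2 yx.
have w0 := wt_gt0 a y; have w1 := wt_le1 (ltW a0) y2.
have t1 := tau_ge1 y (ltW a0).
have t0 : 0 < tau a y by lra.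
have lx : ln x = ln y + ln (1 + wt a y).
  by rewrite -[in LHS]yx /left_branch lnM ?posrE; lra.
have x0 : 0 < x by case/andP: x01.
split.
- rewrite powR_expR// /wt -expRD lnM ?posrE//.
  rewrite (_ : _ + _ = a * ln 2); last by ring.
  by rewrite -[leLHS]expR0 ler_expR mulr_ge0 ?(ltW a0)// ln_ge0//; lra.
- rewrite (powR_expR _ x0) lx.
  rewrite [- a * (_ + _)]mulrDr [expR (_ + _)]expRD -(powR_expR _ y0).
  have p0 : 0 < y `^ (- a) by exact: powR_gt0.
  set p := y `^ (- a) in p0 *; set w := wt a y in w0 w1 *.
  have E : (1 + a * w)^-1 <= expR (- a * ln (1 + w)).
    rewrite mulNr expRN lef_pV2 ?posrE ?expR_gt0//; last by nra.
    rewrite -[leRHS]lnK ?posrE; last by nra.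
    by rewrite ler_expR bernoulli_ln//; lra.
  have h : p / (1 + a * w) <= p * expR (- a * ln (1 + w)) by rewrite ler_wpM2l// ltW.
  apply: (le_trans _ (lerB h (lexx _))).
  have -> : p / (1 + a * w) - p / tau a y = p * w / ((1 + a * w) * tau a y).
    by rewrite /tau -/w; field; apply/andP; split; nra.
  apply: ler_wpM2l; first by rewrite mulr_ge0// ltW.
  by rewrite lef_pV2 ?posrE ?mulr_gt0// ?ler_wpM2r// ?(ltW t0)//; nra.
- by rewrite lx addrC addKr; apply: le_ln1Dx; lra.
- by rewrite /tau; nra.
Qed.

Lemma psum_bound a r C n x : 0 < a <= 1 -> 0 < x <= 1 -> 0 <= C ->
  (forall z : R, 0 < z <= 1 -> `|r z| <= C) ->
  `|psum a r n x| <= 6 * C * x `^ (- a).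
Proof.
move=> a01 x01 C0 rC; have /andP[a0 a1] := a01.
apply: (psum_supersolution (B := fun x => 6 * C * x `^ (- a))) => // z z01.
  by rewrite mulr_ge0 ?powR_ge0//; nra.
have [h1 h2 h3 h4] := powR_supersolution a01 z01.
have t1 := tau_ge1 (ginv a z) (ltW a0).
set y := ginv a z in h1 h2 h3 h4 t1 *.
have h5 : 6^-1 <= y `^ (- a) * wt a y / (2 * tau a y).
  by rewrite ler_pdivlMr; lra.
have := rC _ z01.
rewrite -[6 * C * _ / _]mulrA; set A := y `^ _ / _ in h2 *; set B := z `^ _ in h2 *.
nra.
Qed.

Lemma psum_log_bound a r C n x : 0 < a <= 1 -> 0 < x <= 1 -> 0 <= C ->
  (forall z : R, 0 < z <= 1 -> `|r z| <= C * (1 - ln z)) ->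
  `|psum a r n x| <= 24 * C * (x `^ (- a) * (1 - ln x)).
Proof.
move=> a01 x01 C0 rC; have /andP[a0 a1] := a01.
have L0 (z : R) : 0 < z <= 1 -> ln z <= 0 by move=> /andP[? /ln_le0].
apply: (@le_trans _ _ (6 * C * (x `^ (- a) * (4 - ln x)))); last first.
  have p0 : 0 <= x `^ (- a) by exact: powR_ge0.
  have := L0 _ x01 => Lx.
  have -> : 24 * C * (x `^ (- a) * (1 - ln x)) =
    6 * C * (x `^ (- a) * (4 * (1 - ln x))) by ring.
  by rewrite !ler_wpM2l//; nra.
apply: (psum_supersolution (B := fun x => 6 * C * (x `^ (- a) * (4 - ln x)))) => // z z01.
  rewrite mulr_ge0//; first by nra.
  by rewrite mulr_ge0 ?powR_ge0//; have := L0 _ z01; lra.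
have [h1 h2 h3 h4] := powR_supersolution a01 z01.
have t1 := tau_ge1 (ginv a z) (ltW a0).
have Lz := L0 _ z01; have rz := rC _ z01.
set y := ginv a z in h1 h2 h3 h4 t1 *.
have p0 : 0 < y `^ (- a).
  by apply: powR_gt0; case/andP: (ginv01 a0 z01).
set p := y `^ _ in h1 h2 p0 *; set q := z `^ _ in h2 *; set t := tau a y in h2 h4 t1 *.
set w := wt a y in h1 h2 h3 *.
have ti : 0 < t^-1 by rewrite invr_gt0; lra.
have ti3 : 3^-1 <= t^-1 by rewrite lef_pV2 ?posrE; lra.
have e1 : p * w / (2 * t) = p * w * t^-1 / 2 by field; lra.
rewrite e1 in h2.
have h6 : 3^-1 <= p * w * t^-1 by nra.
have key : 6^-1 * (1 - ln z) <= q * (4 - ln z) - p * t^-1 * (4 - ln y).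
  have g1 : p * w * t^-1 / 2 * (4 - ln z) <= (q - p / t) * (4 - ln z).
    by apply: ler_wpM2r => //; lra.
  have g2 : p * t^-1 * (ln z - ln y) <= p * t^-1 * w.
    by apply: ler_wpM2l => //; rewrite mulr_ge0// ltW.
  have -> : q * (4 - ln z) - p * t^-1 * (4 - ln y) =
    (q - p / t) * (4 - ln z) - p * t^-1 * (ln z - ln y) by ring.
  by nra.
have -> : 6 * C * (p * (4 - ln y)) / t = 6 * C * (p * t^-1 * (4 - ln y)) by ring.
nra.
Qed.

(** A rate of decay of [z * (z `^ (- a) * (1 - ln z))] for [z <= n.+1%:R^-1], which
    is uniform over the parameters [a <= b]. *)
Definition tail_rate b n : R := (1 + 2 / (1 - b)) * n.+1%:R^-1 `^ ((1 - b) / 2).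

Lemma tail_rate_ge0 b n : b < 1 -> 0 <= tail_rate b n.
Proof.
by move=> b1; rewrite mulr_ge0 ?powR_ge0// addr_ge0// divr_ge0// subr_ge0 ltW.
Qed.

Lemma tail_rate_cvg0 b : b < 1 -> tail_rate b n @[n --> \oo] --> 0.
Proof.
move=> b1; apply: cvgn_mul0.
have e0 : 0 < (1 - b) / 2 by lra.
have /cvg_at_rightP := powR_cvg0 e0.
apply; split; first by move=> n; rewrite invr_gt0 ltr0n.
exact: cvg_harmonic.
Qed.

Lemma tail_rate_ge a b n (z : R) : 0 < z -> z <= n.+1%:R^-1 -> 0 < a <= b -> b < 1 ->
  z * (z `^ (- a) * (1 - ln z)) <= tail_rate b n.
Proof.
move=> z0 zn /andP[a0 ab] b1.
have n0 : 0 < n.+1%:R^-1 :> R by rewrite invr_gt0 ltr0n.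
have n1 : n.+1%:R^-1 <= 1 :> R by rewrite invf_le1 ?ltr0n// ler1n.
have [e e0 eE] : exists2 e : R, 0 < e & e = (1 - b) / 2 by exists ((1 - b) / 2) => //; lra.
have L0 : ln z <= 0 by apply: ln_le0; exact: le_trans zn n1.
have E : expR (- (e * ln z)) >= 1 - e * ln z by apply: le_trans (expR_ge1Dx _).
have k : 1 - ln z <= (1 + e^-1) * expR (- (e * ln z)).
  apply: (@le_trans _ _ ((1 + e^-1) * (1 - e * ln z))); last first.
    by rewrite ler_wpM2l// addr_ge0// invr_ge0 ltW.
  have -> : (1 + e^-1) * (1 - e * ln z) = 1 - ln z + e^-1 - e * ln z by field; lra.
  have e1 : 0 <= e^-1 by rewrite invr_ge0 ltW.
  by nra.
have zE : z * z `^ (- a) <= expR (e * ln z + e * ln z).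
  rewrite -{1}(lnK (_ : z \in Num.pos)) ?posrE// powR_expR// -expRD ler_expR.
  by rewrite eE; nra.
rewrite mulrA (le_trans (ler_wpM2r _ zE))//; first by lra.
rewrite (le_trans (ler_wpM2l (expR_ge0 _) k))// expRD.
rewrite [leLHS](_ : _ = (1 + e^-1) * expR (e * ln z)); last first.
  have E0 := expR_gt0 (e * ln z).
  by rewrite expRN; field; rewrite ?(gt_eqF e0) ?(gt_eqF E0).
rewrite /tail_rate -eE (_ : 2 / (1 - b) = e^-1); last by rewrite eE; field; lra.
rewrite ler_wpM2l//; first by rewrite addr_ge0// invr_ge0 ltW.
by rewrite powR_expR// ler_expR ler_wpM2l ?(ltW e0)// ler_ln ?posrE.
Qed.

(** The tail is the sum started at the [n]-th point of the orbit, which is at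
    most [n.+1%:R^-1], multiplied by a slope that is at most this point over [x].
    The singularity of exponent [a < 1] is weaker than this slope. *)
Lemma psum_tail a b r C n m x : 0 < a <= b -> b < 1 -> 0 < x <= 1 -> 0 <= C ->
  (forall z : R, 0 < z <= 1 -> `|r z| <= C * (1 - ln z)) -> (n <= m)%N ->
  `|psum a r m x - psum a r n x| <= 24 * C * tail_rate b n / x.
Proof.
move=> ab b1 x01 C0 rC nm; have /andP[a0 ab'] := ab.
have a01 : 0 < a <= 1 by lra.
have /andP[x0 x1] := x01.
rewrite -(subnKC nm) psum_add addrAC subrr add0r normrM gtr0_norm ?jac_gt0//.
set z := iter n (ginv a) x.
have z01 : 0 < z <= 1 by exact: iter_ginv01.
have zn : z <= n.+1%:R^-1 by exact: iter_ginv_le.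
have h1 := psum_log_bound (m - n) a01 z01 C0 rC.
have h2 := tail_rate_ge (proj1 (andP z01)) zn ab b1.
apply: (@le_trans _ _ (z / x * (24 * C * (z `^ (- a) * (1 - ln z))))).
  by apply: ler_pM => //; [exact/ltW/jac_gt0 | exact: jac_le].
rewrite (_ : z / x * _ = 24 * C * (z * (z `^ (- a) * (1 - ln z))) / x); last by ring.
by rewrite ler_wpM2r ?invr_ge0 ?(ltW x0)// ler_wpM2l//; nra.
Qed.

Lemma sumS_approx a b r C x : 0 < a <= b -> b < 1 -> 0 < x <= 1 -> 0 <= C ->
  (forall z : R, 0 < z <= 1 -> `|r z| <= C * (1 - ln z)) ->
  psum a r n x @[n --> \oo] --> sumS a r x /\
  forall n, `|sumS a r x - psum a r n x| <= 24 * C * tail_rate b n / x.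
Proof.
move=> ab b1 x01 C0 rC; apply: limn_dist.
  by move=> n m nm; exact: psum_tail rC nm.
rewrite -[X in _ --> X](mul0r x^-1); apply: cvgM; last exact: cvg_cst.
rewrite -[X in _ --> X](mulr0 (24 * C)); apply: cvgM; first exact: cvg_cst.
exact: tail_rate_cvg0.
Qed.

End InducedSum.

(** * Limits of the sums *)

Section InducedSumLimit.
Context {R : realType}.
Implicit Types (a b x y C : R) (r : R -> R) (n m : nat).

Definition log_bounded C r := forall z : R, 0 < z <= 1 -> `|r z| <= C * (1 - ln z).

Lemma bounded_log C r : (forall z : R, 0 < z <= 1 -> `|r z| <= C) -> log_bounded C r.
Proof.
move=> rC z z01; apply: le_trans (rC z z01) _.
have C0 : 0 <= C by apply: le_trans (rC z z01).
by have := ge1_1Bln z01; nra.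
Qed.

Lemma log_bounded_lin C1 C2 r1 r2 (c : R) : log_bounded C1 r1 -> log_bounded C2 r2 ->
  log_bounded (C1 + `|c| * C2) (fun z => r1 z + c * r2 z).
Proof.
move=> h1 h2 z z01; apply: le_trans (ler_normD _ _) _.
by rewrite normrM mulrDl -mulrA lerD ?h1// ler_wpM2l// h2.
Qed.

Lemma log_bounded_ge0 C r : log_bounded C r -> 0 <= C.
Proof.
have o : 0 < (1 : R) <= 1 by rewrite ltr01 lexx.
by move=> /(_ 1 o); rewrite ln1 subr0 mulr1; apply: le_trans.
Qed.

Lemma sumS_cvg a r C x : 0 < a < 1 -> 0 < x <= 1 -> log_bounded C r ->
  psum a r n x @[n --> \oo] --> sumS a r x.
Proof.
move=> /andP[a0 a1] x01 rC.
have aa : 0 < a <= a by rewrite a0 lexx.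
by have [] := sumS_approx aa a1 x01 (log_bounded_ge0 rC) rC.
Qed.

Lemma sumS_log_bound a r C x : 0 < a < 1 -> 0 < x <= 1 -> log_bounded C r ->
  `|sumS a r x| <= 24 * C * (x `^ (- a) * (1 - ln x)).
Proof.
move=> a01 x01 rC; apply: (limn_le_cst (cvg_norm (sumS_cvg a01 x01 rC))) => n.
apply: psum_log_bound => //; last exact: log_bounded_ge0 rC.
by case/andP: a01 => -> /ltW ->.
Qed.

Lemma sumS_bound a r C x : 0 < a < 1 -> 0 < x <= 1 ->
  (forall z : R, 0 < z <= 1 -> `|r z| <= C) ->
  `|sumS a r x| <= 6 * C * x `^ (- a).
Proof.
move=> a01 x01 rC.
apply: (limn_le_cst (cvg_norm (sumS_cvg a01 x01 (bounded_log rC)))) => n.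
apply: psum_bound => //; last by apply: le_trans (rC _ x01).
by case/andP: a01 => -> /ltW ->.
Qed.

Lemma sumS_eq a r C x : 0 < a < 1 -> 0 < x <= 1 -> log_bounded C r ->
  sumS a r x = r x + sumS a r (ginv a x) / tau a (ginv a x).
Proof.
move=> a01 x01 rC; have a0 : 0 < a by case/andP: a01.
have h1 := sumS_cvg a01 x01 rC.
have h2 := sumS_cvg a01 (ginv01 a0 x01) rC.
have h3 : psum a r n.+1 x @[n --> \oo] --> sumS a r x by rewrite (cvg_shiftS (psum a r ^~ x)).
have h4 : psum a r n.+1 x @[n --> \oo] -->
    r x + sumS a r (ginv a x) / tau a (ginv a x).
  by rewrite /=; apply: cvgD; [exact: cvg_cst | apply: cvgM => //; exact: cvg_cst].
by rewrite -(cvg_lim _ h3)// -(cvg_lim _ h4).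
Qed.

Lemma sumS_lin a r1 r2 C1 C2 (c : R) x : 0 < a < 1 -> 0 < x <= 1 ->
  log_bounded C1 r1 -> log_bounded C2 r2 ->
  sumS a (fun z => r1 z + c * r2 z) x = sumS a r1 x + c * sumS a r2 x.
Proof.
move=> a01 x01 h1 h2.
rewrite /sumS; under eq_fun do rewrite psum_lin.
apply: cvg_lim => //; apply: cvgD; first exact: sumS_cvg h1.
by apply: cvgM; [exact: cvg_cst | exact: sumS_cvg h2].
Qed.

Lemma sumS_ext a r1 r2 x : 0 < a -> 0 < x <= 1 ->
  (forall z : R, 0 < z <= 1 -> r1 z = r2 z) -> sumS a r1 x = sumS a r2 x.
Proof.
by move=> a0 x01 r12; congr (limn _); apply/funext => n; exact: psum_ext.
Qed.

Lemma psum_le_sumS a r C n x : 0 < a < 1 -> 0 < x <= 1 -> log_bounded C r ->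
  (forall z : R, 0 < z <= 1 -> 0 <= r z) -> psum a r n x <= sumS a r x.
Proof.
move=> a01 x01 rC r0; have a0 : 0 < a by case/andP: a01.
rewrite -subr_ge0.
have := sumS_cvg a01 x01 rC; rewrite -(cvg_shiftn n) => h.
apply: (@limn_ge_cst _ (fun m => psum a r (m + n) x - psum a r n x)).
  by apply: cvgB h _; exact: cvg_cst.
move=> m; rewrite addnC psum_add addrAC subrr add0r mulr_ge0//; first exact/ltW/jac_gt0.
by apply: psum_ge0 => //; exact: iter_ginv01.
Qed.

(** Continuous convergence along a sequence of parameters. It is stable under
    all the constructions below, and it yields joint continuity. *)
Definition cont_cvg (f : nat -> R -> R) (f0 : R -> R) :=
  forall (u : nat -> R) x, (forall n, 0 < u n <= 1) -> 0 < x <= 1 ->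
    u n @[n --> \oo] --> x -> f n (u n) @[n --> \oo] --> f0 x.

Lemma cont_cvg_pt f f0 x : cont_cvg f f0 -> 0 < x <= 1 ->
  f n x @[n --> \oo] --> f0 x.
Proof. by move=> ff x01; apply: (ff (fun=> x)) => //; exact: cvg_cst. Qed.

Lemma cont_cvg_bound (f : nat -> R -> R) f0 C : cont_cvg f f0 ->
  (forall n, log_bounded C (f n)) -> log_bounded C f0.
Proof.
move=> ff fC z z01; apply: (limn_le_cst (cvg_norm (cont_cvg_pt ff z01))) => n.
exact: fC.
Qed.

Section ParameterSequence.
Variables (al : nat -> R) (a b : R).
Hypotheses (alb : forall n, 0 < al n <= b) (b1 : b < 1) (a0 : 0 < a).
Hypothesis (ala : al n @[n --> \oo] --> a).

Let a0b : 0 < a <= b.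
Proof.
by rewrite a0/=; apply: (limn_le_cst ala) => n; case/andP: (alb n).
Qed.

Lemma cont_cvg_branch (f : nat -> R -> R) f0 : cont_cvg f f0 ->
  cont_cvg (fun n x => f n (ginv (al n) x) / tau (al n) (ginv (al n) x))
           (fun x => f0 (ginv a x) / tau a (ginv a x)).
Proof.
move=> ff u x u01 x01 ux.
have al0 n : 0 < al n by case/andP: (alb n).
have cg := cvg_ginv al0 u01 a0 x01 ala ux.
have [g0 g2 _] := ginvP a0 x01.
apply: cvgM; first by apply: ff => // [n|]; exact: ginv01.
apply: cvgV; first by rewrite gt_eqF// tau_gt0// ltW.
exact: cvg_tau.
Qed.

Lemma psum_cont (f : nat -> R -> R) f0 M : cont_cvg f f0 ->
  cont_cvg (fun n => psum (al n) (f n) M) (psum a f0 M).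
Proof.
move=> ff; elim: M => [|M IH]; first by move=> u x *; exact: cvg_cst.
move=> u x u01 x01 ux /=; apply: cvgD; first exact: ff.
exact: (cont_cvg_branch IH).
Qed.

Lemma cvg_approx_tail_rate (f : nat -> R -> R) f0 C (F : nat -> R) (u : nat -> R) x :
  cont_cvg f f0 -> (forall n, log_bounded C (f n)) ->
  (forall n, 0 < u n <= 1) -> 0 < x <= 1 -> u n @[n --> \oo] --> x ->
  (forall M n, (M <= n)%N ->
    `|F n - psum (al n) (f n) M (u n)| <= 24 * C * tail_rate b M / u n) ->
  F n @[n --> \oo] --> sumS a f0 x.
Proof.
move=> ff fC u01 x01 ux FM.
have C0 := log_bounded_ge0 (fC 0).
have x0 : 0 < x by case/andP: x01.
apply: (@cvgn_uniform_approx _ _ (fun M n => psum (al n) (f n) M (u n))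
  (fun M => psum a f0 M x) (fun M => 24 * C * tail_rate b M / (x / 2))).
- by move=> M; exact: (psum_cont ff).
- move=> M; near=> n.
  apply: le_trans (FM M n _) _; first by near: n; exact: nbhs_infty_ge.
  have ux2 : x / 2 < u n by near: n; apply: (cvgr_gt x ux); lra.
  apply: ler_wpM2l; last by rewrite lef_pV2 ?posrE; lra.
  by rewrite mulr_ge0 ?tail_rate_ge0// mulr_ge0.
- move=> M.
  have [_ /(_ M) h] := sumS_approx a0b b1 x01 C0 (cont_cvg_bound ff fC).
  apply: le_trans h _; apply: ler_wpM2l; last by rewrite lef_pV2 ?posrE; lra.
  by rewrite mulr_ge0 ?tail_rate_ge0// mulr_ge0.
- rewrite -(mul0r (x / 2)^-1); apply: cvgM; last exact: cvg_cst.
  apply: cvgn_mul0.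
  exact: tail_rate_cvg0.
Unshelve. all: end_near. Qed.

Lemma sumS_cont (f : nat -> R -> R) f0 C :
  cont_cvg f f0 -> (forall n, log_bounded C (f n)) ->
  cont_cvg (fun n => sumS (al n) (f n)) (sumS a f0).
Proof.
move=> ff fC u x u01 x01 ux; apply: (cvg_approx_tail_rate ff fC u01 x01 ux) => M n _.
by have [_] := sumS_approx (alb n) b1 (u01 n) (log_bounded_ge0 (fC n)) (fC n); apply.
Qed.

Lemma psum_sumS_cont (f : nat -> R -> R) f0 C :
  cont_cvg f f0 -> (forall n, log_bounded C (f n)) ->
  cont_cvg (fun n => psum (al n) (f n) n) (sumS a f0).
Proof.
move=> ff fC u x u01 x01 ux; apply: (cvg_approx_tail_rate ff fC u01 x01 ux) => M n Mn.
exact: psum_tail (alb n) b1 (u01 n) (log_bounded_ge0 (fC n)) (fC n) Mn.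
Qed.

End ParameterSequence.

End InducedSumLimit.

(** * Cones of functions with slowly varying logarithm *)

Section Cones.
Context {R : realType}.
Implicit Types (a b x y C : R) (f r : R -> R) (D : R -> bool) (v : R -> R) (n m : nat).

(** Nonnegative functions [f] such that [f * v] is nondecreasing and [f / v]
    nonincreasing: a Lipschitz condition on [ln f] that asks for no derivative
    and passes to pointwise limits. *)
Definition cone D v f := forall s t : R, D s -> D t -> s <= t ->
  [/\ 0 <= f s, f s * v s <= f t * v t & f t * v s <= f s * v t].

(** The right branch turns [sqcone] into [pcone 2], whereas [pcone 4] is enough to
    imply [sqcone]: this gain makes the transfer operator contract. *)
Definition sqcone f := cone (fun x => 0 < x <= 1) (fun x => x ^+ 2) f.
Definition pcone n f := cone (fun x => 0 <= x <= 1) (fun x => (1 + x) ^+ n) f.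

Lemma cone_ge0 D v f x : cone D v f -> D x -> 0 <= f x.
Proof. by move=> h Dx; have [] := h _ _ Dx Dx (lexx x). Qed.

Lemma cone_add D v f1 f2 : cone D v f1 -> cone D v f2 ->
  cone D v (fun x => f1 x + f2 x).
Proof.
move=> h1 h2 s t Ds Dt st.
have [a1 a2 a3] := h1 _ _ Ds Dt st; have [b1 b2 b3] := h2 _ _ Ds Dt st.
by rewrite !mulrDl; split; [exact: addr_ge0 | exact: lerD | exact: lerD].
Qed.

Lemma cone_lim D v (f : nat -> R -> R) f0 : (forall n, cone D v (f n)) ->
  (forall x, D x -> f n x @[n --> \oo] --> f0 x) -> cone D v f0.
Proof.
move=> h ff s t Ds Dt st; have fs := ff _ Ds; have ft := ff _ Dt; split.
- by apply: (limn_ge_cst fs) => n; have [] := h n _ _ Ds Dt st.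
- apply: (@limn_le2 _ (fun n => f n s * v s) (fun n => f n t * v t)).
  + by apply: cvgM fs _; exact: cvg_cst.
  + by apply: cvgM ft _; exact: cvg_cst.
  + by move=> n; have [] := h n _ _ Ds Dt st.
- apply: (@limn_le2 _ (fun n => f n t * v s) (fun n => f n s * v t)).
  + by apply: cvgM ft _; exact: cvg_cst.
  + by apply: cvgM fs _; exact: cvg_cst.
  + by move=> n; have [] := h n _ _ Ds Dt st.
Qed.

Lemma cone_ext D v f1 f2 : (forall x, D x -> f1 x = f2 x) -> cone D v f1 -> cone D v f2.
Proof. by move=> e h s t Ds Dt st; rewrite -!e//; exact: h. Qed.

(** The slope of the branch is absorbed by the weight: [(1 + w)^2 / tau] is
    nondecreasing in [w], because [1 + a <= 2]. *)
Lemma sqcone_branch a f : 0 < a <= 1 -> sqcone f ->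
  sqcone (fun x => f (ginv a x) / tau a (ginv a x)).
Proof.
move=> /andP[a0 a1] h s t s01 t01 st.
have [p0 p2 ps] := ginvP a0 s01; have [q0 q2 qt] := ginvP a0 t01.
have pq : ginv a s <= ginv a t.
  by apply: ginv_le => //; [case/andP: s01 | case/andP: t01].
have [f0 f1 f2] := h _ _ (ginv01 a0 s01) (ginv01 a0 t01) pq.
have fq0 := cone_ge0 h (ginv01 a0 t01).
have w0 := wt_gt0 a (ginv a s); have w1 := wt_le1 (ltW a0) q2.
have ww := wt_le (ltW a0) p0 pq.
have tp := tau_gt0 (ginv a s) (ltW a0); have tq := tau_gt0 (ginv a t) (ltW a0).
have ps2 : s ^+ 2 = (ginv a s * (1 + wt a (ginv a s))) ^+ 2 by rewrite -{1}ps.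
have qt2 : t ^+ 2 = (ginv a t * (1 + wt a (ginv a t))) ^+ 2 by rewrite -{1}qt.
rewrite ps2 qt2; rewrite /tau in tp tq *.
clear ps qt ps2 qt2.
set p := ginv a s in p0 f0 f1 f2 w0 ww tp pq *.
set q := ginv a t in q0 f1 f2 fq0 w1 ww tq pq *.
set u := wt a p in w0 ww tp *; set w := wt a q in w1 ww tq *.
have T1 : (1 + u) ^+ 2 / (1 + (1 + a) * u) <= (1 + w) ^+ 2 / (1 + (1 + a) * w).
  by rewrite ler_pdivrMr// mulrAC ler_pdivlMr// -subr_ge0
    (_ : _ - _ = (w - u) * (2 + w + u - (1 + a) + (1 + a) * (w * u)));
    [apply: mulr_ge0; nra | ring].
have T2 : (1 + u) ^+ 2 / (1 + (1 + a) * w) <= (1 + w) ^+ 2 / (1 + (1 + a) * u).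
  apply: ler_pM; rewrite ?sqr_ge0 ?invr_ge0 ?(ltW tq)//.
    by rewrite ler_pXn2r ?nnegrE//; lra.
  by rewrite lef_pV2 ?posrE//; nra.
have e (c d y z : R) : c / d * (y * z) ^+ 2 = c * y ^+ 2 * (z ^+ 2 / d) by ring.
split.
- by rewrite divr_ge0// ltW.
- rewrite !e; apply: ler_pM => //; first by rewrite mulr_ge0// sqr_ge0.
  by rewrite divr_ge0 ?sqr_ge0// ltW.
- rewrite !e; apply: ler_pM => //; first by rewrite mulr_ge0// sqr_ge0.
  by rewrite divr_ge0 ?sqr_ge0// ltW.
Qed.

Lemma sqcone_psum a r n : 0 < a <= 1 -> sqcone r -> sqcone (psum a r n).
Proof.
move=> a01 h; elim: n => [|n IH] /=; last by apply: cone_add h _; exact: sqcone_branch.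
by move=> s t *; rewrite !mul0r.
Qed.

Lemma sqcone_sumS a r C : 0 < a < 1 -> log_bounded C r -> sqcone r -> sqcone (sumS a r).
Proof.
move=> a01 rC h; apply: (@cone_lim _ _ (fun n => psum a r n)).
  by move=> n; apply: sqcone_psum => //; case/andP: a01 => -> /ltW ->.
by move=> x x01; exact: sumS_cvg rC.
Qed.

Lemma half01 (u : R) : 0 <= u <= 1 -> 0 < (1 + u) / 2 <= 1.
Proof. by move=> /andP[? ?]; lra. Qed.

Lemma pcone_half f : sqcone f -> pcone 2 (fun u => 2^-1 * f ((1 + u) / 2)).
Proof.
move=> h s t s01 t01 st.
have [|f0 f1 f2] := h _ _ (half01 s01) (half01 t01); first by lra.
by split; [apply: mulr_ge0 | nra | nra].
Qed.

(** The function [(1 + x) ^+ 2 / x] is nonincreasing on the unit interval. *)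
Lemma sqcone_pcone4 r : pcone 4 r -> sqcone r.
Proof.
move=> h s t s01 t01 st.
have /andP[s0 s1] := s01; have /andP[t0 t1] := t01.
have [||f0 f1 f2] := h s t _ _ st; [by lra..|].
have ft : 0 <= r t by apply: (cone_ge0 h); lra.
have k : s ^+ 2 * (1 + t) ^+ 4 <= t ^+ 2 * (1 + s) ^+ 4.
  have k1 : s * (1 + t) ^+ 2 <= t * (1 + s) ^+ 2.
    by rewrite -subr_ge0 (_ : _ - _ = (t - s) * (1 - s * t)); [apply: mulr_ge0; nra | ring].
  have -> : s ^+ 2 * (1 + t) ^+ 4 = (s * (1 + t) ^+ 2) ^+ 2 by ring.
  have -> : t ^+ 2 * (1 + s) ^+ 4 = (t * (1 + s) ^+ 2) ^+ 2 by ring.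
  by rewrite ler_pXn2r ?nnegrE// ?mulr_ge0 ?sqr_ge0//; lra.
have S0 : 0 < (1 + s) ^+ 4 by rewrite exprn_gt0//; lra.
split=> //.
- rewrite -(ler_pM2r S0).
  have -> : r s * s ^+ 2 * (1 + s) ^+ 4 = (r s * (1 + s) ^+ 4) * s ^+ 2 by ring.
  have -> : r t * t ^+ 2 * (1 + s) ^+ 4 = r t * (t ^+ 2 * (1 + s) ^+ 4) by ring.
  apply: le_trans (ler_wpM2r (sqr_ge0 s) f1) _.
  by rewrite -mulrA ler_wpM2l// mulrC.
- rewrite -(ler_pM2r S0).
  have -> : r t * s ^+ 2 * (1 + s) ^+ 4 = (r t * (1 + s) ^+ 4) * s ^+ 2 by ring.
  have -> : r s * t ^+ 2 * (1 + s) ^+ 4 = r s * (t ^+ 2 * (1 + s) ^+ 4) by ring.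
  apply: le_trans (ler_wpM2r (sqr_ge0 s) f2) _.
  by rewrite -mulrA ler_wpM2l// mulrC.
Qed.

(** Room for subtracting a constant: the cone of exponent 2 sits strictly inside
    that of exponent 4. *)
Lemma pcone_sub p (d : R) : pcone 2 p ->
  (forall x : R, 0 <= x <= 1 -> 2 * d <= p x) -> 0 <= d -> pcone 4 (fun x => p x - d).
Proof.
move=> h pd d0 s t s01 t01 st.
have [f0 f1 f2] := h _ _ s01 t01 st.
have /andP[s0 s1] := s01; have /andP[t0 t1] := t01.
have ps := pd _ s01; have pt := pd _ t01.
pose A := (1 + s) ^+ 2; pose B := (1 + t) ^+ 2.
have A1 : 1 <= A by rewrite /A; nra.
have AB : A <= B by rewrite /A /B; nra.
have e4 (z : R) : (1 + z) ^+ 4 = ((1 + z) ^+ 2) * ((1 + z) ^+ 2) by ring.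
rewrite !e4 -/A -/B in f1 f2 *.
split; first by lra.
- have h1 : p s * A * A <= p t * B * A by apply: ler_wpM2r => //; lra.
  have h2 : d * (B * B - A * A) <= p t * B * (B - A).
    have -> : d * (B * B - A * A) = d * (B + A) * (B - A) by ring.
    by apply: ler_wpM2r; [lra | nra].
  by nra.
- have h1 : p t * A * A <= p s * B * A by apply: ler_wpM2r => //; lra.
  have h2 : d * (B * B - A * A) <= p s * B * (B - A).
    have -> : d * (B * B - A * A) = d * (B + A) * (B - A) by ring.
    by apply: ler_wpM2r; [lra | nra].
  by nra.
Qed.

Lemma pcone24 p : pcone 2 p -> pcone 4 p.
Proof.
move=> h; apply: (@cone_ext _ _ (fun x => p x - 0)); first by move=> x _; rewrite subr0.
by apply: pcone_sub => // x x01; rewrite mulr0; exact: (cone_ge0 h).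
Qed.

Lemma pcone_osc n p x y : pcone n p -> 0 <= x <= 1 -> 0 <= y <= 1 ->
  p x <= 2 ^+ n * p y.
Proof.
move=> h x01 y01; have /andP[x0 x1] := x01; have /andP[y0 y1] := y01.
have px := cone_ge0 h x01; have py := cone_ge0 h y01.
have b (z : R) : 0 <= z <= 1 -> 1 <= (1 + z) ^+ n <= 2 ^+ n.
  move=> /andP[z0 z1]; apply/andP; split; first by rewrite exprn_ege1//; lra.
  by apply: lerXn2r; rewrite ?nnegrE; lra.
have /andP[bx1 bx2] := b _ x01; have /andP[by1 by2] := b _ y01.
by have [xy|/ltW yx] := leP x y;
  [have [_ h1 _] := h _ _ x01 y01 xy | have [_ _ h1] := h _ _ y01 x01 yx]; nra.
Qed.

End Cones.

(** * Mass *)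

Section Mass.
Context {R : realType}.
Implicit Types (a b x y z u v s t C K : R) (f g r p : R -> R) (n m : nat).

Definition mass f : R := \int[@lebesgue_measure R]_(x in `[0, 1]) f x.

Definition lip01 K f := forall x y, 0 <= x <= 1 -> 0 <= y <= 1 ->
  `|f x - f y| <= K * `|x - y|.

(** The retraction of the line onto the unit interval makes a function that is
    Lipschitz there continuous on the line. *)
Definition clamp x : R := Num.max 0 (Num.min 1 x).

Lemma clamp01 x : 0 <= clamp x <= 1.
Proof. by rewrite /clamp le_max lexx/= ge_max ge_min ler01 lexx. Qed.

Lemma clampE x : 0 <= x <= 1 -> clamp x = x.
Proof. by move=> /andP[x0 x1]; rewrite /clamp min_r// max_r. Qed.

Lemma clamp_dist x y : `|clamp x - clamp y| <= `|x - y|.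
Proof.
wlog xy : x y / x <= y.
  move=> h; have [xy|/ltW yx] := leP x y; first exact: h.
  by rewrite distrC [leRHS]distrC; exact: h.
rewrite /clamp ler0_norm ?[leRHS]ler0_norm; [|lra|].
  by have [?|?] := leP 1 x; have [?|?] := leP 1 y; rewrite ?(max_r ler01);
    try (have [?|?] := leP 0 x); try (have [?|?] := leP 0 y); lra.
by have [?|?] := leP 1 x; have [?|?] := leP 1 y; rewrite ?(max_r ler01);
    try (have [?|?] := leP 0 x); try (have [?|?] := leP 0 y); lra.
Qed.

Lemma lip01_ge0 K f : lip01 K f -> 0 <= K.
Proof.
have o : 0 <= (1 : R) <= 1 by rewrite ler01 lexx.
have z : 0 <= (0 : R) <= 1 by rewrite ler01 lexx.
by move=> /(_ 1 0 o z); rewrite subr0 normr1 mulr1; apply: le_trans.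
Qed.

Lemma lip01_clamp K f : lip01 K f -> continuous (f \o clamp).
Proof.
move=> fK x; apply/cvgrPdist_le => e e0.
have K0 := lip01_ge0 fK.
have d0 : 0 < e / (K + 1) by rewrite divr_gt0//; lra.
near=> y; apply: (le_trans (fK _ _ (clamp01 _) (clamp01 _))).
apply: (le_trans (ler_wpM2l K0 (clamp_dist _ _))).
have : `|x - y| <= e / (K + 1) by near: y; exact: cvgr_dist_le.
rewrite ler_pdivlMr; last by lra.
by have := normr_ge0 (x - y); nra.
Unshelve. all: end_near. Qed.

Lemma lip01_within K f : lip01 K f -> {within `[0, 1], continuous f}.
Proof.
move=> fK; apply: (@subspace_eq_continuous _ _ _ (f \o clamp)).
  by move=> x; rewrite inE/= in_itv/= => x01; rewrite clampE.
by apply: continuous_subspaceT; exact: lip01_clamp fK.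
Qed.

Lemma lip01_primitive K f : lip01 K f ->
  exists F : R -> R, forall x, 0 <= x <= 1 -> is_derive x 1 F (f x).
Proof.
move=> fK; have cf := lip01_clamp fK.
exists (fun x => \int[@lebesgue_measure R]_(t in `[-1, x]) (f \o clamp) t) => x x01.
have /andP[x0 x1] := x01.
have [|||d e] := @continuous_FTC1_closed R (f \o clamp) (-1) x 2 _ _ _ (cf x).
- by lra.
- apply: continuous_compact_integrable; first exact: segment_compact.
  exact: continuous_subspaceT.
- by lra.
- by apply: DeriveDef; [exact: d | rewrite -derive1E e /= clampE].
Qed.

Lemma mass_primitive K K' f F : lip01 K f -> lip01 K' F ->
  (forall x, 0 < x < 1 -> is_derive x 1 F (f x)) -> mass f = F 1 - F 0.
Proof.
move=> fK FK Ff; rewrite /mass /Rintegral.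
have h0 : 0 <= (0 : R) <= 1 by rewrite ler01 lexx.
have h1 : 0 <= (1 : R) <= 1 by rewrite ler01 lexx.
have cF := lip01_clamp FK.
rewrite (@continuous_FTC2 _ f F)//.
- exact: lip01_within fK.
- split.
  + by move=> x; rewrite in_itv/= => /Ff[].
  + rewrite -{2}(clampE h0).
    apply: (@cvg_trans _ ((F \o clamp) x @[x --> 0^'+])).
      apply: near_eq_cvg; near=> x; rewrite /= clampE//.
      by apply/andP; split; [|near: x; exact: nbhs_right_le].
    by apply: cvg_at_right_filter; exact: cF.
  + rewrite -{2}(clampE h1).
    apply: (@cvg_trans _ ((F \o clamp) x @[x --> 1^'-])).
      apply: near_eq_cvg; near=> x; rewrite /= clampE//.
      by apply/andP; split; [near: x; exact: nbhs_left_ge|].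
    by apply: cvg_at_left_filter; exact: cF.
- by move=> x; rewrite in_itv/= => /Ff[_ <-]; rewrite derive1E.
Unshelve. all: end_near. Qed.

Lemma primitive_lip K f F : lip01 K f ->
  (forall x, 0 <= x <= 1 -> is_derive x 1 F (f x)) -> lip01 (`|f 0| + K) F.
Proof.
move=> fK Ff x y x01 y01.
have [z zxy ->] := between_mean_value (fun z h => Ff z (between_itv y01 x01 h)).
rewrite normrM ler_wpM2r//.
have z01 := between_itv y01 x01 zxy.
have h0 : 0 <= (0 : R) <= 1 by rewrite ler01 lexx.
have := fK z 0 z01 h0; rewrite subr0 => h.
have : K * `|z| <= K.
  have K0 := lip01_ge0 fK; have /andP[z0 z1] := z01.
  by rewrite ger0_norm//; nra.
by have := ler_normD (f z - f 0) (f 0); rewrite subrK; lra.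
Qed.

Lemma in01oo x : 0 < x < 1 -> 0 <= x <= 1.
Proof. by move=> /andP[? ?]; rewrite !ltW. Qed.

Lemma mass_mean K f : lip01 K f -> exists2 z, 0 <= z <= 1 & mass f = f z.
Proof.
move=> fK; have [F Ff] := lip01_primitive fK.
have h0 : 0 <= (0 : R) <= 1 by rewrite ler01 lexx.
have h1 : 0 <= (1 : R) <= 1 by rewrite ler01 lexx.
have FK := primitive_lip fK Ff.
rewrite (mass_primitive fK FK (fun x h => Ff x (in01oo h))).
have [z zb ->] := between_mean_value (fun z h => Ff z (between_itv h0 h1 h)).
by exists z; [exact: (between_itv h0 h1 zb) | rewrite subr0 mulr1].
Qed.

Lemma lip01_lin K1 K2 f g (c : R) : lip01 K1 f -> lip01 K2 g ->
  lip01 (K1 + `|c| * K2) (fun x => f x + c * g x).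
Proof.
move=> h1 h2 x y x01 y01.
rewrite (_ : _ - _ = (f x - f y) + c * (g x - g y)); last by ring.
rewrite (le_trans (ler_normD _ _))// mulrDl lerD ?h1// normrM -mulrA ler_wpM2l// h2//.
Qed.

Lemma mass_lin K1 K2 f g (c : R) : lip01 K1 f -> lip01 K2 g ->
  mass (fun x => f x + c * g x) = mass f + c * mass g.
Proof.
move=> h1 h2; have [F Ff] := lip01_primitive h1; have [G Gg] := lip01_primitive h2.
have FK := primitive_lip h1 Ff; have GK := primitive_lip h2 Gg.
have d x : 0 < x < 1 -> is_derive x 1 (fun x => F x + c * G x) (f x + c * g x).
  move=> /in01oo x01; have d1 := Ff _ x01; have d2 := Gg _ x01.
  by apply: is_derive_eq; rewrite /GRing.scale/=; ring.
rewrite (mass_primitive h1 FK (fun x h => Ff x (in01oo h))).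
rewrite (mass_primitive h2 GK (fun x h => Gg x (in01oo h))).
by rewrite (mass_primitive (lip01_lin c h1 h2) (lip01_lin c FK GK) d); ring.
Qed.

Lemma lip01_cst (c : R) : lip01 0 (fun=> c).
Proof. by move=> x y _ _; rewrite subrr normr0 mul0r. Qed.

Lemma mass_cst (c : R) : mass (fun=> c) = c.
Proof. by have [z _ ->] := mass_mean (lip01_cst c). Qed.

Lemma mass_dist K1 K2 f g (e : R) : lip01 K1 f -> lip01 K2 g ->
  (forall x, 0 <= x <= 1 -> `|f x - g x| <= e) -> `|mass f - mass g| <= e.
Proof.
move=> h1 h2 fg; rewrite -(mulN1r (mass g)) -(mass_lin (-1) h1 h2).
have [z z01 ->] := mass_mean (lip01_lin (-1) h1 h2).
by rewrite mulN1r; exact: fg.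
Qed.

Lemma pcone_lip p : pcone 4 p -> lip01 (512 * p 0) p.
Proof.
move=> h.
have h0 : 0 <= (0 : R) <= 1 by rewrite ler01 lexx.
have main s t : 0 <= s <= 1 -> 0 <= t <= 1 -> s <= t ->
    `|p s - p t| <= 512 * p 0 * `|s - t|.
  move=> s01 t01 st; have [f0 f1 f2] := h _ _ s01 t01 st.
  have ft := cone_ge0 h t01.
  have /andP[s0 s1] := s01; have /andP[t0 t1] := t01.
  have bs := pcone_osc h s01 h0; have bt := pcone_osc h t01 h0.
  rewrite [X in _ <= _ * X]ler0_norm; last by lra.
  have A1 : 1 <= (1 + s) ^+ 4 by rewrite exprn_ege1//; lra.
  have A2 : (1 + t) ^+ 4 - (1 + s) ^+ 4 <= 32 * (t - s).
    have -> : (1 + t) ^+ 4 - (1 + s) ^+ 4 =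
      (t - s) * ((2 + t + s) * ((1 + t) ^+ 2 + (1 + s) ^+ 2)) by ring.
    rewrite mulrC ler_wpM2r ?subr_ge0//.
    have : (1 + t) ^+ 2 <= 4 by nra.
    have : (1 + s) ^+ 2 <= 4 by nra.
    by nra.
  have A3 : (1 + s) ^+ 4 <= (1 + t) ^+ 4 by apply: lerXn2r; rewrite ?nnegrE; lra.
  have -> : 512 * p 0 * - (s - t) = 16 * p 0 * (32 * (t - s)) by ring.
  have e16 : (2 : R) ^+ 4 = 16 by ring.
  rewrite e16 in bs bt.
  set A := (1 + s) ^+ 4 in f1 f2 A1 A2 A3; set B := (1 + t) ^+ 4 in f1 f2 A2 A3.
  have [pst|pts] := leP (p s) (p t).
  - rewrite ler0_norm; last by lra.
    apply: (@le_trans _ _ (p s * (B - A))); last by apply: ler_pM => //; lra.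
    by nra.
  - rewrite gtr0_norm; last by lra.
    apply: (@le_trans _ _ (p t * (B - A))); last by apply: ler_pM => //; lra.
    by nra.
move=> x y x01 y01; have [xy|/ltW yx] := leP x y; first exact: main.
by rewrite distrC [`|x - y|]distrC; exact: main.
Qed.

End Mass.

(** * Contraction of the transfer operator *)

Section Transfer.
Context {R : realType}.
Implicit Types (a b x y z u v s t C K : R) (f g r p : R -> R) (n m : nat).

(** The transfer operator of the first return map to [1/2, 1], read on the unit
    interval through the right branch. *)
Definition transfer a r (u : R) : R := 2^-1 * sumS a r ((1 + u) / 2).

Lemma pcone_bounded n p x : pcone n p -> 0 <= x <= 1 -> `|p x| <= 2 ^+ n * p 0.
Proof.
move=> h x01; rewrite ger0_norm ?(cone_ge0 h)//.
by apply: (pcone_osc h) => //; rewrite lexx ler01.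
Qed.

Lemma in01W (z : R) : 0 < z <= 1 -> 0 <= z <= 1.
Proof. by move=> /andP[/ltW-> ->]. Qed.

Lemma pcone_log n p : pcone n p -> log_bounded (2 ^+ n * p 0) p.
Proof. by move=> h; apply: bounded_log => z /in01W; exact: pcone_bounded. Qed.

Lemma pcone_transfer a r : 0 < a < 1 -> pcone 4 r -> pcone 2 (transfer a r).
Proof.
move=> a01 h; apply: pcone_half; apply: sqcone_sumS (pcone_log h) _ => //.
exact: sqcone_pcone4.
Qed.

Lemma powR_half_le a (u : R) : 0 < a <= 1 -> 0 <= u <= 1 -> ((1 + u) / 2) `^ (- a) <= 2.
Proof.
move=> /andP[a0 a1] u01; have /andP[v0 v1] := half01 u01.
have /andP[u0 _] := u01.
rewrite powRN -[leRHS]invrK lef_pV2 ?posrE ?powR_gt0//.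
apply: (@le_trans _ _ (((1 + u) / 2) `^ 1)); first by rewrite powRr1; lra.
by apply: ger_powR => //; rewrite v0.
Qed.

Lemma transfer_bound a r C u : 0 < a < 1 -> 0 <= u <= 1 ->
  (forall z : R, 0 < z <= 1 -> `|r z| <= C) -> `|transfer a r u| <= 6 * C.
Proof.
move=> a01 u01 rC.
have C0 : 0 <= C by apply: le_trans (rC 1 _); rewrite // ltr01 lexx.
have h := sumS_bound a01 (half01 u01) rC.
have a01' : 0 < a <= 1 by case/andP: a01 => -> /ltW ->.
have := powR_half_le a01' u01; set p := _ `^ _ in h * => p2.
rewrite /transfer normrM gtr0_norm ?invr_gt0//; nra.
Qed.

Lemma transfer_ext a r1 r2 u : 0 < a -> 0 <= u <= 1 ->
  (forall z : R, 0 < z <= 1 -> r1 z = r2 z) -> transfer a r1 u = transfer a r2 u.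
Proof. by move=> a0 u01 e; rewrite /transfer (sumS_ext _ _ e)//; exact: half01. Qed.

Lemma transfer_lin a r1 r2 C1 C2 (c : R) u : 0 < a < 1 -> 0 <= u <= 1 ->
  log_bounded C1 r1 -> log_bounded C2 r2 ->
  transfer a (fun z => r1 z + c * r2 z) u = transfer a r1 u + c * transfer a r2 u.
Proof.
move=> a01 u01 h1 h2; rewrite /transfer (sumS_lin c a01 (half01 u01) h1 h2).
by ring.
Qed.

Lemma iter_transfer_bound a r C m u : 0 < a < 1 -> 0 <= u <= 1 ->
  (forall z : R, 0 <= z <= 1 -> `|r z| <= C) -> `|iter m (transfer a) r u| <= 6 ^+ m * C.
Proof.
move=> a01 + rC; elim: m u => [|m IH] u u01; first by rewrite expr0 mul1r rC.
rewrite exprS -mulrA /=; apply: transfer_bound => // z z01; exact/IH/in01W.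
Qed.

Lemma iter_transfer_lin a r1 r2 C1 C2 (c : R) m u : 0 < a < 1 -> 0 <= u <= 1 ->
  (forall z : R, 0 <= z <= 1 -> `|r1 z| <= C1) ->
  (forall z : R, 0 <= z <= 1 -> `|r2 z| <= C2) ->
  iter m (transfer a) (fun z => r1 z + c * r2 z) u =
  iter m (transfer a) r1 u + c * iter m (transfer a) r2 u.
Proof.
move=> a01 + h1 h2; elim: m u => [//|m IH] u u01 /=.
have a0 : 0 < a by case/andP: a01.
rewrite (transfer_ext a0 u01 (fun z z01 => IH z (in01W z01))).
apply: transfer_lin => //; apply: bounded_log => z /in01W z01;
  [exact: iter_transfer_bound h1 | exact: iter_transfer_bound h2].
Qed.

Lemma pcone_iter_transfer a r m : 0 < a < 1 -> pcone 4 r ->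
  pcone 4 (iter m (transfer a) r).
Proof.
by move=> a01 h; elim: m => //= m IH; apply: pcone24; exact: pcone_transfer.
Qed.

(** Conservation of mass: the primitives of the summands telescope along the
    backward orbit of 1, since [ginv a 1 = 1/2]. *)
Lemma mass_transfer a r : 0 < a < 1 -> pcone 4 r -> mass (transfer a r) = mass r.
Proof.
move=> a01 h; have /andP[a0 a1] := a01.
have a01' : 0 < a <= 1 by rewrite a0 ltW.
have rK := pcone_lip h; have [F Ff] := lip01_primitive rK.
have FK := primitive_lip rK Ff.
set L := _ + _ in FK.
have L0 := lip01_ge0 FK.
pose psi := fix psi m x := if m is k.+1 then F x + psi k (ginv a x) else 0 : R.
have dpsi m x : 0 < x < 1 -> is_derive x 1 (psi m) (psum a r m x).
  elim: m x => [|m IH] x x01; first exact: is_derive_cst.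
  have /andP[x0 x1] := x01.
  have x01' : 0 < x <= 1 by rewrite x0 ltW.
  have [g0 g2 _] := ginvP a0 x01'.
  have g01 : 0 < ginv a x < 1 by rewrite g0; lra.
  have d1 : is_derive x 1 F (r x) by apply: Ff; exact: in01W.
  have d2 := @is_derive1_comp R (psi m) (ginv a) x _ _ (IH _ g01) (is_derive_ginv a0 x01).
  exact: is_deriveD.
have lpsi m x y : 0 < x <= 1 -> 0 < y <= 1 ->
    `|psi m x - psi m y| <= m%:R * L * `|x - y|.
  elim: m x y => [|m IH] x y x01 y01; first by rewrite /= subrr normr0 !mul0r.
  rewrite /= (_ : _ - _ = (F x - F y) + (psi m (ginv a x) - psi m (ginv a y))); last by ring.
  rewrite (le_trans (ler_normD _ _))// -natr1 mulrDl mulrDl mul1r addrC lerD//.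
    apply: le_trans (IH _ _ (ginv01 a0 x01) (ginv01 a0 y01)) _.
    apply: ler_wpM2l; first by rewrite mulr_ge0.
    by have := ginv_dist a0 x01 a0 y01; rewrite subrr normr0 addr0.
  by apply: FK; exact: in01W.
have tpsi m x : psi m x - psi m (ginv a x) = F x - F (iter m (ginv a) x).
  elim: m x => [|m IH] x; first by rewrite /= !subrr.
  rewrite iterSr /= (_ : _ - _ = F x - F (ginv a x) +
    (psi m (ginv a x) - psi m (ginv a (ginv a x)))); last by ring.
  by rewrite IH; ring.
have o1 : 0 < (1 : R) <= 1 by rewrite ltr01 lexx.
pose T m u := 2^-1 * psum a r m ((1 + u) / 2).
have TC m : pcone 2 (T m) by apply: pcone_half; apply: sqcone_psum => //; exact: sqcone_pcone4.
have mT m : mass (T m) = F 1 - F (iter m (ginv a) 1).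
  have lH : lip01 (m%:R * L) (fun u => psi m ((1 + u) / 2)).
    move=> x y x01 y01; apply: le_trans (lpsi m _ _ (half01 x01) (half01 y01)) _.
    rewrite ler_wpM2l ?mulr_ge0// (_ : _ - _ = (x - y) / 2); last by field.
    by rewrite normrM [X in _ * X]gtr0_norm ?invr_gt0// ler_piMr// invf_le1//; lra.
  have dH u : 0 < u < 1 -> is_derive u 1 (fun u => psi m ((1 + u) / 2)) (T m u).
    move=> /andP[u0 u1]; have v01 : 0 < (1 + u) / 2 < 1 by lra.
    have d1 : is_derive u 1 (fun u : R => (1 + u) / 2) 2^-1.
      by apply: is_derive_eq; rewrite /GRing.scale/=; ring.
    have d2 := @is_derive1_comp R (psi m) _ u _ _ (dpsi m _ v01) d1.
    by apply: (is_derive_eq d2); rewrite /T mulrC.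
  rewrite (mass_primitive (pcone_lip (pcone24 (TC m))) lH dH).
  rewrite (_ : (1 + 1) / 2 = 1); last by lra.
  by rewrite (_ : (1 + 0) / 2 = ginv a 1) ?tpsi// ginv1//; lra.
have zc : iter m (ginv a) 1 @[m --> \oo] --> (0 : R).
  apply: (@cvgn_dist _ _ harmonic); last exact: cvg_harmonic.
  move=> m; have /andP[i0 i1] := iter_ginv01 m a0 o1.
  by rewrite subr0 gtr0_norm//; exact: iter_ginv_le.
have c1 : mass (T m) @[m --> \oo] --> mass r.
  rewrite (mass_primitive rK FK (fun x h => Ff x (in01oo h))).
  under eq_fun do rewrite mT.
  apply: cvgB; first exact: cvg_cst.
  apply: (@cvgn_dist _ _ (fun m => L * iter m (ginv a) 1)).
    move=> m; have i01 := iter_ginv01 m a0 o1; have /andP[i0 _] := i01.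
    apply: le_trans (FK _ _ (in01W i01) _) _; first by rewrite lexx ler01.
    by rewrite subr0 gtr0_norm.
  by rewrite -(mulr0 L); apply: cvgM zc; exact: cvg_cst.
have c2 : mass (T m) @[m --> \oo] --> mass (transfer a r).
  have aa : 0 < a <= a by rewrite a0 lexx.
  have rl := pcone_log h; set C := _ * _ in rl; have C0 := log_bounded_ge0 rl.
  apply: (@cvgn_dist _ _ (fun m => 24 * C * tail_rate a m)); last first.
    apply: cvgn_mul0; exact: tail_rate_cvg0.
  move=> m; apply: (mass_dist (pcone_lip (pcone24 (TC m)))
    (pcone_lip (pcone24 (pcone_transfer a01 h)))) => u u01.
  rewrite /T /transfer -mulrBr normrM gtr0_norm ?invr_gt0// distrC.
  have [_ /(_ m) k] := sumS_approx aa a1 (half01 u01) C0 rl.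
  apply: le_trans (ler_wpM2l _ k) _; first by rewrite invr_ge0.
  have K0 : 0 <= 24 * C * tail_rate a m by rewrite mulr_ge0 ?tail_rate_ge0// mulr_ge0.
  have /andP[u0 _] := u01.
  set K := 24 * C * _ in K0 *.
  have -> : 2^-1 * (K / ((1 + u) / 2)) = K / (1 + u) by field; lra.
  by rewrite ler_pdivrMr; nra.
by rewrite -(cvg_lim _ c1)// -(cvg_lim _ c2).
Qed.

Lemma pcone_le_mass n p x : pcone 4 p -> pcone n p -> 0 <= x <= 1 ->
  p x <= 2 ^+ n * mass p /\ mass p <= 2 ^+ n * p x.
Proof.
move=> h hn x01; have [z z01 ->] := mass_mean (pcone_lip h).
by split; exact: (pcone_osc hn).
Qed.

(** Two functions of the cone with equal mass stay in the cone, with equal and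
    smaller masses, after one application of the operator and the removal of an
    eighth of their common mass. *)
Lemma transfer_contraction a m p1 p2 (c : R) u : 0 < a < 1 ->
  pcone 4 p1 -> pcone 4 p2 -> mass p1 = c -> mass p2 = c -> 0 <= u <= 1 ->
  `|iter m (transfer a) p1 u - iter m (transfer a) p2 u| <= 16 * c * (7 / 8) ^+ m.
Proof.
move=> a01; elim: m p1 p2 c u => [|m IH] p1 p2 c u h1 h2 m1 m2 u01.
  have e16 : (2 : R) ^+ 4 = 16 by ring.
  have [b1 _] := pcone_le_mass h1 h1 u01; have [b2 _] := pcone_le_mass h2 h2 u01.
  rewrite e16 m1 in b1; rewrite e16 m2 in b2.
  have q1 := cone_ge0 h1 u01; have q2 := cone_ge0 h2 u01.
  by rewrite /= expr0 mulr1 ler_norml; lra.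
have c0 : 0 <= c by have [z z01 e] := mass_mean (pcone_lip h1); rewrite -m1 e (cone_ge0 h1).
have sub p : pcone 4 p -> mass p = c ->
    pcone 4 (fun x => transfer a p x - c / 8) /\
    mass (fun x => transfer a p x - c / 8) = c * (7 / 8).
  move=> h mp; have h' := pcone_transfer a01 h; have h'4 := pcone24 h'.
  split.
    apply: pcone_sub => //; last by lra.
    move=> x x01; have [_] := pcone_le_mass h'4 h' x01.
    by rewrite mass_transfer// mp; lra.
  have := mass_lin (- (c / 8)) (pcone_lip h'4) (lip01_cst (1 : R)).
  rewrite mass_transfer// mp mass_cst; under [X in mass X]eq_fun do rewrite mulr1.
  by move=> ->; lra.
have [s1 e1] := sub _ h1 m1; have [s2 e2] := sub _ h2 m2.
have split p v : pcone 4 p -> 0 <= v <= 1 -> iter m.+1 (transfer a) p v =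
    iter m (transfer a) (fun x => transfer a p x - c / 8) v +
    c / 8 * iter m (transfer a) (fun=> 1) v.
  move=> h v01; have h'4 := pcone24 (pcone_transfer a01 h).
  have bd z : 0 <= z <= 1 ->
      `|transfer a p z - c / 8| <= 2 ^+ 4 * transfer a p 0 + `|c / 8|.
    by move=> z01; apply: le_trans (ler_normB _ _) _; rewrite lerD2r; exact: pcone_bounded.
  have b1 (z : R) : 0 <= z <= 1 -> `|1 : R| <= 1 by rewrite normr1.
  rewrite -(iter_transfer_lin (c / 8) m a01 v01 bd b1) iterSr.
  have -> : (fun z => transfer a p z - c / 8 + c / 8 * 1) = transfer a p.
    by apply/funext => z; ring.
  by [].
rewrite (split _ _ h1 u01) (split _ _ h2 u01).
set w := c / 8 * _; set A1 := iter m _ _ u; set A2 := iter m _ _ u.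
have -> : A1 + w - (A2 + w) = A1 - A2 by ring.
apply: le_trans (IH _ _ _ _ s1 s2 e1 e2 u01) _.
by rewrite exprS; lra.
Qed.

End Transfer.

(** * The fixed density *)

Section FixedDensity.
Context {R : realType}.
Implicit Types (a b x y z v s t C K : R) (f g r p : R -> R) (n m : nat).

(** The invariant density of the first return map in the coordinate of [transfer],
    with mass 1, and the invariant density [rhoh] of the map itself that has
    mass 1 on the interval from 1/2 to 1. *)
Definition kfix a (v : R) : R := limn (fun n => iter n (transfer a) (fun=> 1) v).
Definition rhoh a : R -> R := sumS a (kfix a).

Lemma cvg_geometric78 C : C * (7 / 8) ^+ n @[n --> \oo] --> (0 : R).
Proof.
apply: cvgn_mul0.
by apply: cvg_expr; rewrite ger0_norm; lra.
Qed.

Lemma pcone_one n : pcone n (fun=> 1 : R).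
Proof.
move=> s t /andP[s0 s1] /andP[t0 t1] st; rewrite !mul1r.
by split => //; apply: lerXn2r; rewrite ?nnegrE; lra.
Qed.

Lemma iter_transfer_one a n : 0 < a < 1 ->
  pcone 4 (iter n (transfer a) (fun=> 1)) /\ mass (iter n (transfer a) (fun=> 1)) = 1.
Proof.
move=> a01; split; first exact/pcone_iter_transfer/pcone_one.
elim: n => [|n IH] /=; first exact: mass_cst.
by rewrite mass_transfer//; exact/pcone_iter_transfer/pcone_one.
Qed.

Lemma kfix_approx a v : 0 < a < 1 -> 0 <= v <= 1 ->
  iter n (transfer a) (fun=> 1) v @[n --> \oo] --> kfix a v /\
  forall n, `|kfix a v - iter n (transfer a) (fun=> 1) v| <= 16 * (7 / 8) ^+ n.
Proof.
move=> a01 v01; apply: limn_dist; last exact: cvg_geometric78.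
move=> n m nm; rewrite -(subnKC nm) iterD.
have [h1 e1] := iter_transfer_one (m - n) a01.
have := transfer_contraction n a01 h1 (pcone_one 4) e1 (mass_cst 1) v01.
by rewrite mulr1.
Qed.

Lemma pcone4_kfix a : 0 < a < 1 -> pcone 4 (kfix a).
Proof.
move=> a01; apply: (@cone_lim _ _ _ (fun n => iter n (transfer a) (fun=> 1))).
  by move=> n; have [] := iter_transfer_one n a01.
by move=> v v01; have [] := kfix_approx a01 v01.
Qed.

Lemma mass_kfix a : 0 < a < 1 -> mass (kfix a) = 1.
Proof.
move=> a01.
have c : (1 : R) @[n --> \oo] --> mass (kfix a).
  apply: (@cvgn_dist _ _ (fun n => 16 * (7 / 8) ^+ n)); last exact: cvg_geometric78.
  move=> n; have [h1 e1] := iter_transfer_one n a01.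
  have := @mass_dist _ _ _ _ _ (16 * (7 / 8) ^+ n) (pcone_lip h1) (pcone_lip (pcone4_kfix a01)).
  rewrite e1; apply => v v01.
  by rewrite distrC; have [_] := kfix_approx a01 v01; apply.
by rewrite -(cvg_lim _ c)//; exact: lim_cst.
Qed.

Lemma transfer_kfix a v : 0 < a < 1 -> 0 <= v <= 1 -> transfer a (kfix a) v = kfix a v.
Proof.
move=> a01 v01; have a0 : 0 < a by case/andP: a01.
have [c1 _] := kfix_approx a01 v01.
have c2 : iter n.+1 (transfer a) (fun=> 1) v @[n --> \oo] --> kfix a v.
  by rewrite (cvg_shiftS (fun n => iter n (transfer a) (fun=> 1) v)).
have c3 : iter n.+1 (transfer a) (fun=> 1) v @[n --> \oo] --> transfer a (kfix a) v.
  apply: (@cvgn_dist _ _ (fun n => 6 * 16 * (7 / 8) ^+ n)); last exact: cvg_geometric78.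
  move=> n /=; have [h1 _] := iter_transfer_one n a01.
  rewrite -mulrA -mulN1r -(transfer_lin (-1) a01 v01 (pcone_log h1) (pcone_log (pcone4_kfix a01))).
  apply: transfer_bound => // z /in01W z01; rewrite mulN1r distrC.
  by have [_] := kfix_approx a01 z01; apply.
by rewrite -(cvg_lim _ c2)// -(cvg_lim _ c3).
Qed.

Lemma pcone2_kfix a : 0 < a < 1 -> pcone 2 (kfix a).
Proof.
move=> a01; apply: (@cone_ext _ _ _ (transfer a (kfix a))).
  by move=> v v01; exact: transfer_kfix.
exact/pcone_transfer/pcone4_kfix.
Qed.

Lemma kfix_bounds a v : 0 < a < 1 -> 0 <= v <= 1 -> 4^-1 <= kfix a v <= 4.
Proof.
move=> a01 v01.
have [] := pcone_le_mass (pcone4_kfix a01) (pcone2_kfix a01) v01.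
rewrite mass_kfix// (_ : (2 : R) ^+ 2 = 4); last by ring.
by move=> h1 h2; lra.
Qed.

Lemma kfix_norm a v : 0 < a < 1 -> 0 < v <= 1 -> `|kfix a v| <= 4.
Proof.
move=> a01 /in01W v01; have /andP[h1 h2] := kfix_bounds a01 v01.
by rewrite ger0_norm//; lra.
Qed.

Lemma kfix_log a : 0 < a < 1 -> log_bounded 4 (kfix a).
Proof. by move=> a01; apply: bounded_log => z; exact: kfix_norm. Qed.

Lemma rhoh_le a x : 0 < a < 1 -> 0 < x <= 1 -> `|rhoh a x| <= 24 * x `^ (- a).
Proof.
move=> a01 x01; have := sumS_bound a01 x01 (fun z => @kfix_norm a z a01).
by rewrite (_ : 6 * 4 = 24); last by ring.
Qed.

Lemma rhoh_ge a x : 0 < a < 1 -> 0 < x <= 1 -> 4^-1 <= rhoh a x.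
Proof.
move=> a01 x01.
have k0 z : 0 < z <= 1 -> 0 <= kfix a z.
  by move=> /in01W/(kfix_bounds a01)/andP[]; lra.
apply: le_trans (psum_le_sumS 1 a01 x01 (kfix_log a01) k0).
by rewrite /= mul0r addr0; have /andP[] := kfix_bounds a01 (in01W x01).
Qed.

Lemma kfix_rhoh a v : 0 < a < 1 -> 0 <= v <= 1 -> kfix a v = 2^-1 * rhoh a ((1 + v) / 2).
Proof. by move=> a01 v01; rewrite -transfer_kfix. Qed.

(** The equation of invariance: the two terms are the contributions of the two
    branches. *)
Lemma rhoh_eq a x : 0 < a < 1 -> 0 < x <= 1 ->
  rhoh a x = 2^-1 * rhoh a ((1 + x) / 2) + rhoh a (ginv a x) / tau a (ginv a x).
Proof.
move=> a01 x01; rewrite /rhoh (sumS_eq a01 x01 (kfix_log a01)).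
by rewrite kfix_rhoh//; exact: in01W.
Qed.

Section ParameterSequence.
Variables (al : nat -> R) (a b : R).
Hypotheses (alb : forall n, 0 < al n <= b) (b1 : b < 1) (a0 : 0 < a).
Hypothesis (ala : al n @[n --> \oo] --> a).

Let al01 n : 0 < al n < 1.
Proof. by have /andP[-> h] := alb n; exact: le_lt_trans h b1. Qed.

Let a01 : 0 < a < 1.
Proof.
rewrite a0/=; apply: le_lt_trans b1.
by apply: (limn_le_cst ala) => n; case/andP: (alb n).
Qed.

Lemma transfer_cont (f : nat -> R -> R) f0 C :
  cont_cvg f f0 -> (forall n, log_bounded C (f n)) ->
  cont_cvg (fun n => transfer (al n) (f n)) (transfer a f0).
Proof.
move=> ff fC u x u01 x01 ux; apply: cvgM; first exact: cvg_cst.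
apply: (sumS_cont alb b1 a0 ala ff fC (u := fun n => (1 + u n) / 2)).
- by move=> n; apply: half01; exact: in01W.
- by apply: half01; exact: in01W.
- by apply: cvgM; [apply: cvgD => //; exact: cvg_cst | exact: cvg_cst].
Qed.

Lemma iter_transfer_cont (f : nat -> R -> R) f0 C m :
  cont_cvg f f0 -> (forall n z, 0 <= z <= 1 -> `|f n z| <= C) ->
  cont_cvg (fun n => iter m (transfer (al n)) (f n)) (iter m (transfer a) f0).
Proof.
move=> ff fC; elim: m => [//|m IH] /=.
apply: (transfer_cont IH (C := 6 ^+ m * C)) => n; apply: bounded_log => z /in01W z01.
by apply: iter_transfer_bound => //; exact: fC.
Qed.

Lemma kfix_cont : cont_cvg (fun n => kfix (al n)) (kfix a).
Proof.
move=> u x u01 x01 ux.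
apply: (@cvgn_uniform_approx _ _ (fun M n => iter M (transfer (al n)) (fun=> 1) (u n))
  (fun M => iter M (transfer a) (fun=> 1) x) (fun M => 16 * (7 / 8) ^+ M)).
- move=> M; apply: (@iter_transfer_cont (fun _ _ => 1) (fun=> 1) 1 M) => //.
    by move=> ? ? *; exact: cvg_cst.
  by move=> n z _; rewrite normr1.
- move=> M; apply: nearW => n.
  by have [_] := kfix_approx (al01 n) (in01W (u01 n)); apply.
- by move=> M; have [_] := kfix_approx a01 (in01W x01); apply.
- exact: cvg_geometric78.
Qed.

Lemma rhoh_cont : cont_cvg (fun n => rhoh (al n)) (rhoh a).
Proof. by apply: (sumS_cont alb b1 a0 ala kfix_cont) => n; exact: kfix_log. Qed.

End ParameterSequence.

End FixedDensity.

(** * Differential inequalities *)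

Section Regularity.
Context {R : realType}.
Implicit Types (a b x y z v s t C K : R) (F f g r p : R -> R) (n m : nat).

(** Differential inequalities of order one and two, homogeneous in [F] and with
    constants independent of the parameter. The values 2 and 20 are large enough
    for [reg_branch] to reproduce them. *)
Definition reg F := exists F1 F2 : R -> R, forall x, 0 < x < 1 ->
  [/\ is_derive x 1 F (F1 x), is_derive x 1 F1 (F2 x),
      `|F1 x| <= 2 / x * F x & `|F2 x| <= 20 / x ^+ 2 * F x].

Lemma is_derive_tau a y : 0 < y -> is_derive y 1 (tau a) ((1 + a) * a * wt a y / y).
Proof.
move=> y0; have d := is_derive_wt a y0.
rewrite /tau; apply: is_derive_eq; rewrite /GRing.scale/=; field; lra.
Qed.

Lemma is_derive_tauV a y : 0 < a -> 0 < y ->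
  is_derive y 1 (fun z => (tau a z)^-1) (- ((1 + a) * a * wt a y / y) / tau a y ^+ 2).
Proof.
move=> a0 y0; have t0 : tau a y != 0 by rewrite gt_eqF// tau_gt0// ltW.
have d := is_deriveV t0 (is_derive_tau a y0).
by apply: (is_derive_eq d); rewrite /GRing.scale/=; field; rewrite t0 gt_eqF.
Qed.

Lemma is_derive_inv y : 0 < y -> is_derive y 1 (fun z : R => z^-1) (- 1 / y ^+ 2).
Proof.
move=> y0; have t0 : y != 0 by rewrite gt_eqF.
have d := @is_deriveV R id y 1 1 t0 (is_derive_id y 1).
by apply: (is_derive_eq d); rewrite /GRing.scale/=; field.
Qed.

Lemma is_derive_branch a (H : R -> R) (h : R) x : 0 < a -> 0 < x < 1 ->
  is_derive (ginv a x) 1 H h -> is_derive x 1 (fun x => H (ginv a x)) (h / tau a (ginv a x)).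
Proof.
by move=> a0 x01 d; exact: (@is_derive1_comp R H (ginv a) x _ _ d (is_derive_ginv a0 x01)).
Qed.

Lemma is_derive_branch1 a F (F1 : R -> R) x : 0 < a -> 0 < x < 1 ->
  (forall y, 0 < y < 1 -> is_derive y 1 F (F1 y)) ->
  is_derive x 1 (fun x => F (ginv a x) / tau a (ginv a x))
    (let y := ginv a x in F1 y / tau a y ^+ 2
      - F y * ((1 + a) * a * wt a y) / (y * tau a y ^+ 3)).
Proof.
move=> a0 x01 dF; have /andP[x0 x1] := x01.
have [|g0 g2 _] := @ginvP _ a x a0; first by rewrite x0 ltW.
set y := ginv a x in g0 g2 *.
have t0 : tau a y != 0 by rewrite gt_eqF// tau_gt0// ltW.
have y0 : y != 0 by rewrite gt_eqF.
have d1 : is_derive y 1 F (F1 y) by apply: dF; lra.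
have d2 := is_derive_tauV a0 g0.
have d : is_derive y 1 (fun z => F z * (tau a z)^-1) (F1 y / tau a y
      - F y * ((1 + a) * a * wt a y) / (y * tau a y ^+ 2)).
  by apply: is_derive_eq; rewrite /GRing.scale/=; field; rewrite t0 y0.
have := is_derive_branch a0 x01 d; rewrite -/y => d'.
by apply: (is_derive_eq d') => /=; rewrite -/y; field; rewrite t0 y0.
Qed.

(** With [w := wt a (ginv a x)] one has [x = ginv a x * (1 + w)] and
    [tau = 1 + (1 + a) * w]: both bounds reduce to inequalities between
    polynomials in [a] and [w] on the unit square. *)
Lemma reg_branch a F : 0 < a <= 1 -> (forall x, 0 < x <= 1 -> 0 <= F x) ->
  reg F -> reg (fun x => F (ginv a x) / tau a (ginv a x)).
Proof.
move=> /andP[a0 a1] F0 [F1 [F2 FP]].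
pose c := (1 + a) * a.
exists (fun x => let y := ginv a x in F1 y / tau a y ^+ 2
      - F y * ((1 + a) * a * wt a y) / (y * tau a y ^+ 3)).
exists (fun x => let y := ginv a x in (F2 y / tau a y ^+ 2
      - 3 * F1 y * (c * wt a y) / (y * tau a y ^+ 3)
      + F y * (c * (1 - a) * wt a y) / (y ^+ 2 * tau a y ^+ 3)
      + 3 * F y * (c * wt a y) ^+ 2 / (y ^+ 2 * tau a y ^+ 4)) / tau a y).
move=> x x01; have /andP[x0 x1] := x01.
have x01' : 0 < x <= 1 by rewrite x0 ltW.
have [g0 g2 gx] := ginvP a0 x01'.
have d1 := @is_derive_branch1 a F F1 x a0 x01 (fun y h => let: And4 d _ _ _ := FP y h in d).
have xE : x = ginv a x * (1 + wt a (ginv a x)) by rewrite -[LHS]gx.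
have y01 : 0 < ginv a x < 1 by lra.
have Fy : 0 <= F (ginv a x) by apply: F0; exact: ginv01.
have [dF dF1 b1 b2] := FP _ y01.
have w0 := wt_gt0 a (ginv a x); have w1 := wt_le1 (ltW a0) g2.
have tE : tau a (ginv a x) = 1 + (1 + a) * wt a (ginv a x) by [].
have tp := tau_gt0 (ginv a x) (ltW a0).
have t0 : tau a (ginv a x) != 0 by rewrite gt_eqF.
have y0 : ginv a x != 0 by rewrite gt_eqF.
split => //=.
- have d2 := is_derive_tauV a0 g0; have d3 := is_derive_wt a g0.
  have d4 := is_derive_inv g0.
  have d : is_derive (ginv a x) 1 (fun z => F1 z * ((tau a z)^-1 * (tau a z)^-1)
      - F z * (c * wt a z) * (z^-1 * ((tau a z)^-1 * (tau a z)^-1 * (tau a z)^-1)))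
     (F2 (ginv a x) / tau a (ginv a x) ^+ 2
      - 3 * F1 (ginv a x) * (c * wt a (ginv a x)) / (ginv a x * tau a (ginv a x) ^+ 3)
      + F (ginv a x) * (c * (1 - a) * wt a (ginv a x)) / (ginv a x ^+ 2 * tau a (ginv a x) ^+ 3)
      + 3 * F (ginv a x) * (c * wt a (ginv a x)) ^+ 2 / (ginv a x ^+ 2 * tau a (ginv a x) ^+ 4)).
    by apply: is_derive_eq; rewrite /GRing.scale/= /c; field; rewrite t0 y0.
  have d5 := is_derive_branch a0 x01 d.
  rewrite [X in is_derive _ _ X _](_ : _ = (fun x : R => F1 (ginv a x) *
     ((tau a (ginv a x))^-1 * (tau a (ginv a x))^-1)
      - F (ginv a x) * (c * wt a (ginv a x)) * ((ginv a x)^-1 *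
      ((tau a (ginv a x))^-1 * (tau a (ginv a x))^-1 * (tau a (ginv a x))^-1)))); first exact: d5.
  apply/funext => z; rewrite /c !exprS expr0 mulr1 !invfM.
  by ring.
- clear d1 dF dF1 FP F0 x01 x01' y01 gx b2 F2.
  rewrite [X in 2 / X]xE.
  set y := ginv a x in g0 g2 y0 w0 w1 tE tp t0 Fy b1 *.
  set w := wt a y in w0 w1 tE *; set T := tau a y in tE tp t0 *.
  apply: le_trans (ler_normB _ _) _.
  have e1 : `|F1 y / T ^+ 2| <= 2 / y * F y / T ^+ 2.
    rewrite normrM [X in _ * X]ger0_norm ?invr_ge0 ?sqr_ge0//.
    by rewrite ler_wpM2r// invr_ge0 sqr_ge0.
  have e2 : `|F y * ((1 + a) * a * w) / (y * T ^+ 3)| = F y * ((1 + a) * a * w) / (y * T ^+ 3).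
    rewrite ger0_norm// divr_ge0//; first by rewrite !mulr_ge0//; lra.
    by rewrite mulr_ge0 ?exprn_ge0// ltW.
  rewrite e2; apply: le_trans (lerD e1 (lexx _)) _.
  rewrite -subr_ge0 (_ : _ - _ = F y * (2 * T ^+ 2 - (2 * T + (1 + a) * a * w) * (1 + w)) /
    (y * (1 + w) * T ^+ 3)); last first.
    by field; rewrite t0 y0 gt_eqF//; lra.
  rewrite divr_ge0//; last by rewrite !mulr_ge0 ?exprn_ge0 ?(ltW tp)//; lra.
  rewrite mulr_ge0// tE.
  rewrite (_ : _ - _ = a * w * (1 - a + (1 + a) * w)); last by ring.
  by rewrite !mulr_ge0//; nra.
- clear d1 dF dF1 FP F0 x01 x01' y01 gx.
  rewrite [X in 20 / X ^+ 2]xE /c.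
  set y := ginv a x in g0 g2 y0 w0 w1 tE tp t0 Fy b1 b2 *.
  set w := wt a y in w0 w1 tE *; set T := tau a y in tE tp t0 *.
  have Ti : 0 < T^-1 by rewrite invr_gt0.
  have yi : 0 < y^-1 by rewrite invr_gt0.
  have cw : 0 <= (1 + a) * a * w by rewrite !mulr_ge0//; lra.
  have P : forall k : nat, 0 <= (y ^+ k)^-1 by move=> k; rewrite invr_ge0 exprn_ge0// ltW.
  rewrite normrM [X in _ * X]gtr0_norm//.
  have q1 : `|F2 y / T ^+ 2| <= 20 / y ^+ 2 * F y / T ^+ 2.
    rewrite normrM [X in _ * X]ger0_norm ?invr_ge0 ?sqr_ge0//.
    by rewrite ler_wpM2r// invr_ge0 sqr_ge0.
  have q2 : `|3 * F1 y * ((1 + a) * a * w) / (y * T ^+ 3)| <=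
      6 * F y * ((1 + a) * a * w) / (y ^+ 2 * T ^+ 3).
    rewrite !normrM (ger0_norm (_ : 0 <= 3))// normfV.
    rewrite [`|y * _|]gtr0_norm ?mulr_gt0 ?exprn_gt0//.
    rewrite (ger0_norm (_ : 0 <= 1 + a)) ?(ger0_norm (_ : 0 <= a)) ?(ger0_norm (_ : 0 <= w)); [|lra..].
    rewrite (_ : 6 * F y * _ / _ = 3 * (2 / y * F y) * ((1 + a) * a * w) / (y * T ^+ 3)).
      rewrite ler_wpM2r ?invr_ge0 ?mulr_ge0 ?exprn_ge0 ?(ltW tp) ?(ltW g0)//.
      by rewrite ler_wpM2r// ler_wpM2l.
    by field; rewrite t0 y0.
  have q3 : 0 <= F y * ((1 + a) * a * (1 - a) * w) / (y ^+ 2 * T ^+ 3).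
    rewrite divr_ge0//; first by rewrite !mulr_ge0//; lra.
    by rewrite mulr_ge0 ?exprn_ge0// ltW.
  have q4 : 0 <= 3 * F y * ((1 + a) * a * w) ^+ 2 / (y ^+ 2 * T ^+ 4).
    rewrite divr_ge0//; first by rewrite mulr_ge0 ?sqr_ge0// mulr_ge0.
    by rewrite mulr_ge0 ?exprn_ge0// ltW.
  set A1 := F2 y / _ in q1 *; set A2 := 3 * F1 y * _ / _ in q2 *.
  set A3 := F y * _ / _ in q3 *; set A4 := 3 * F y * _ / _ in q4 *.
  have q5 : `|A1 - A2 + A3 + A4| <= 20 / y ^+ 2 * F y / T ^+ 2 +
     6 * F y * ((1 + a) * a * w) / (y ^+ 2 * T ^+ 3) + A3 + A4.
    apply: le_trans (ler_normD _ _) _; rewrite (ger0_norm q4) lerD2r.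
    apply: le_trans (ler_normD _ _) _; rewrite (ger0_norm q3) lerD2r.
    by apply: le_trans (ler_normB _ _) _; exact: lerD.
  apply: le_trans (ler_wpM2r (ltW Ti) q5) _.
  rewrite -subr_ge0 (_ : _ - _ = F y * (20 * T ^+ 4 - (20 * T ^+ 2
      + (7 - a) * ((1 + a) * a * w) * T + 3 * ((1 + a) * a * w) ^+ 2) * (1 + w) ^+ 2) /
    (y ^+ 2 * (1 + w) ^+ 2 * T ^+ 5)); last first.
    by rewrite /A3 /A4; field; rewrite t0 y0 gt_eqF//; lra.
  rewrite divr_ge0//; last first.
    by rewrite !mulr_ge0 ?exprn_ge0 ?sqr_ge0 ?(ltW tp)//; lra.
  rewrite mulr_ge0//.
  (* [c w <= a T] and [T >= (1 + w) (1 + a w / 2)] *)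
  have k1 : (1 + a) * a * w <= a * T by rewrite tE; nra.
  have k2 : (1 + w) * (1 + a * w / 2) <= T by rewrite tE; nra.
  have k3 : (1 + w) ^+ 2 * (1 + a * w) <= T ^+ 2.
    apply: (@le_trans _ _ (((1 + w) * (1 + a * w / 2)) ^+ 2)).
      by rewrite exprMn ler_wpM2l ?sqr_ge0//; nra.
    by apply: lerXn2r => //; rewrite nnegrE ?(ltW tp)// mulr_ge0//; nra.
  have T1 : 1 <= T by rewrite tE; nra.
  have k4 : (7 - a) * ((1 + a) * a * w) * T + 3 * ((1 + a) * a * w) ^+ 2 <= 20 * (a * w) * T ^+ 2.
    have h1 : ((1 + a) * a * w) ^+ 2 <= (1 + a) * a * w * (a * T).
      by rewrite expr2 ler_wpM2l.
    have h2 : (7 - a) * ((1 + a) * a * w) * T + 3 * ((1 + a) * a * w * (a * T)) =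
      (7 + 2 * a) * (1 + a) * (a * w * T) by ring.
    have h3 : (7 + 2 * a) * (1 + a) <= 20 by nra.
    have h4 : 0 <= a * w * T by rewrite !mulr_ge0//; lra.
    have h5 : 20 * (a * w * T) <= 20 * (a * w) * T ^+ 2 by nra.
    nra.
  have k5 : 0 <= (1 + w) ^+ 2 by rewrite sqr_ge0.
  have k6 := ler_wpM2r k5 k4.
  have k7 : T ^+ 2 * ((1 + w) ^+ 2 * (1 + a * w)) <= T ^+ 2 * T ^+ 2 by rewrite ler_wpM2l ?sqr_ge0.
  have -> : T ^+ 4 = T ^+ 2 * T ^+ 2 by ring.
  by nra.
Qed.

Lemma reg_add F f : reg F -> reg f -> reg (fun x => F x + f x).
Proof.
move=> [F1 [F2 FP]] [f1 [f2 fP]].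
exists (fun x => F1 x + f1 x), (fun x => F2 x + f2 x) => x x01.
have [a1 a2 a3 a4] := FP _ x01; have [b1 b2 b3 b4] := fP _ x01.
split; [exact: is_deriveD | exact: is_deriveD | |].
- by rewrite mulrDr (le_trans (ler_normD _ _))// lerD.
- by rewrite mulrDr (le_trans (ler_normD _ _))// lerD.
Qed.

Lemma reg_half F : (forall x, 0 < x <= 1 -> 0 <= F x) ->
  reg F -> reg (fun x => 2^-1 * F ((1 + x) / 2)).
Proof.
move=> F0 [F1 [F2 FP]].
exists (fun x => 4^-1 * F1 ((1 + x) / 2)), (fun x => 8^-1 * F2 ((1 + x) / 2)) => x /andP[x0 x1].
have v01 : 0 < (1 + x) / 2 < 1 by lra.
have [a1 a2 a3 a4] := FP _ v01.
have Fv : 0 <= F ((1 + x) / 2) by apply: F0; case/andP: v01 => -> /ltW->.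
have d1 : is_derive x 1 (fun v : R => (1 + v) / 2) 2^-1.
  by apply: is_derive_eq; rewrite /GRing.scale/=; ring.
have e1 := @is_derive1_comp R F _ x _ _ a1 d1.
have e2 := @is_derive1_comp R F1 _ x _ _ a2 d1.
rewrite /comp in e1 e2.
have i1 : 0 < x^-1 by rewrite invr_gt0.
split.
- by apply: is_derive_eq; rewrite /GRing.scale/=; field.
- by apply: is_derive_eq; rewrite /GRing.scale/=; field.
- rewrite normrM gtr0_norm ?invr_gt0//.
  apply: le_trans (ler_wpM2l _ a3) _; first by rewrite invr_ge0.
  rewrite [leLHS](_ : _ = F ((1 + x) / 2) / (1 + x)); last by field; lra.
  rewrite [leRHS](_ : _ = F ((1 + x) / 2) / x); last by field; lra.
  by rewrite ler_wpM2l// lef_pV2 ?posrE; lra.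
- rewrite normrM gtr0_norm ?invr_gt0//.
  apply: le_trans (ler_wpM2l _ a4) _; first by rewrite invr_ge0.
  rewrite [leLHS](_ : _ = 10 * F ((1 + x) / 2) / (1 + x) ^+ 2); last by field; lra.
  rewrite [leRHS](_ : _ = 10 * F ((1 + x) / 2) / x ^+ 2); last by field; lra.
  rewrite ler_wpM2l ?mulr_ge0// lef_pV2 ?posrE ?exprn_gt0//; last by lra.
  by apply: lerXn2r; rewrite ?nnegrE; lra.
Qed.

Lemma reg_cst (c : R) : 0 <= c -> reg (fun=> c).
Proof.
move=> c0; exists (fun=> 0), (fun=> 0) => x /andP[x0 x1].
split; [exact: is_derive_cst | exact: is_derive_cst | |]; rewrite normr0 mulr_ge0//.
- by rewrite divr_ge0// ltW.
- by rewrite divr_ge0// sqr_ge0.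
Qed.

Lemma reg_psum a r n : 0 < a <= 1 -> (forall x, 0 < x <= 1 -> 0 <= r x) ->
  reg r -> reg (psum a r n).
Proof.
move=> a01 r0 h; elim: n => [|n IH] /=; first exact: reg_cst.
apply: reg_add h _; apply: reg_branch => // x x01.
by apply: psum_ge0 => //; case/andP: a01.
Qed.

End Regularity.

(** * Differentiability of the density in space *)

Section Approximation.
Context {R : realType}.
Implicit Types (a b x y z v s t C K B l h : R) (F f g r p : R -> R) (n m : nat).

Definition ptransfer a m r (v : R) : R := 2^-1 * psum a r m ((1 + v) / 2).
(** Truncations of the iterates of [transfer], which are finite sums of smooth
    functions. *)
Definition approx_k a n m : R -> R := iter n (ptransfer a m) (fun=> 1).

Lemma approx_k_props a n m : 0 < a < 1 ->
  [/\ reg (approx_k a n m), (forall x, 0 < x <= 1 -> 0 <= approx_k a n m x)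
    & forall x, 0 < x <= 1 -> approx_k a n m x <= iter n (transfer a) (fun=> 1) x].
Proof.
move=> a01; have /andP[a0 a1] := a01.
have a01' : 0 < a <= 1 by rewrite a0 ltW.
rewrite /approx_k; elim: n => [|n [IH1 IH2 IH3]] /=.
  by split => // *; exact: reg_cst.
set r := iter n _ _ in IH1 IH2 IH3 *.
have p0 x : 0 < x <= 1 -> 0 <= psum a r m x by move=> x01; exact: psum_ge0.
split.
- by apply: reg_half => //; exact: reg_psum.
- by move=> x /in01W/half01 x01; rewrite mulr_ge0 ?invr_ge0// p0.
- move=> x /in01W/half01 x01; rewrite ler_wpM2l ?invr_ge0//.
  apply: le_trans (psum_le _ a0 x01 IH3) _.
  have [h1 _] := iter_transfer_one n a01.
  have h0 z : 0 < z <= 1 -> 0 <= iter n (transfer a) (fun=> 1) z.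
    by move=> /in01W; exact: (cone_ge0 h1).
  exact: (psum_le_sumS m a01 x01 (pcone_log h1) h0).
Qed.

Lemma iter_transfer_one_le a n x : 0 < a < 1 -> 0 <= x <= 1 ->
  `|iter n (transfer a) (fun=> 1) x| <= 16.
Proof.
move=> a01 x01; have [h1 e1] := iter_transfer_one n a01.
rewrite ger0_norm ?(cone_ge0 h1)//.
have [] := pcone_le_mass h1 h1 x01; rewrite e1 mulr1.
by rewrite (_ : (2 : R) ^+ 4 = 16); last by ring.
Qed.

Lemma approx_k_le a n m x : 0 < a < 1 -> 0 < x <= 1 -> `|approx_k a n m x| <= 16.
Proof.
move=> a01 x01; have [_ h0 h1] := approx_k_props n m a01.
rewrite ger0_norm ?h0//; apply: le_trans (h1 _ x01) _.
exact: le_trans (ler_norm _) (iter_transfer_one_le n a01 (in01W x01)).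
Qed.

Lemma approx_k_cvg a n : 0 < a < 1 ->
  cont_cvg (approx_k a n) (iter n (transfer a) (fun=> 1)).
Proof.
move=> a01; have /andP[a0 a1] := a01.
have aa : forall n : nat, 0 < (fun=> a) n <= a by move=> _; rewrite a0 lexx.
elim: n => [|n IH]; first by move=> *; exact: cvg_cst.
have bd m : log_bounded 16 (approx_k a n m).
  by apply: bounded_log => z; exact: approx_k_le.
have ca : (fun=> a) n @[n --> \oo] --> a by exact: cvg_cst.
have cc := psum_sumS_cont aa a1 a0 ca IH bd.
move=> u x u01 x01 ux; rewrite /approx_k /=; apply: cvgM; first exact: cvg_cst.
apply: (cc (fun n => (1 + u n) / 2)).
- by move=> k; apply: half01; exact: in01W.
- by apply: half01; exact: in01W.
- by apply: cvgM; [apply: cvgD => //; exact: cvg_cst | exact: cvg_cst].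
Qed.

(** The density is an iterated pointwise limit of finite sums of smooth
    functions, to which the differential inequalities apply. *)
Lemma rhoh_closed a (Q : (R -> R) -> Prop) : 0 < a < 1 ->
  (forall F, reg F -> (forall x, 0 < x <= 1 -> 0 <= F x <= 96 * x `^ (- a)) -> Q F) ->
  (forall (f : nat -> R -> R) F, (forall n, Q (f n)) ->
    (forall x, 0 < x <= 1 -> f n x @[n --> \oo] --> F x) -> Q F) ->
  Q (rhoh a).
Proof.
move=> a01 Qreg Qlim; have /andP[a0 a1] := a01.
have a01' : 0 < a <= 1 by rewrite a0 ltW.
have aa : forall n : nat, 0 < (fun=> a) n <= a by move=> _; rewrite a0 lexx.
have ca : (fun=> a) n @[n --> \oo] --> a by exact: cvg_cst.
apply: (Qlim (fun n => sumS a (iter n (transfer a) (fun=> 1)))).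
  move=> n; apply: (Qlim (fun m => psum a (approx_k a n m) m)).
    move=> m; have [h1 h2 h3] := approx_k_props n m a01.
    apply: Qreg; first exact: reg_psum.
    move=> x x01; rewrite psum_ge0//=.
    apply: le_trans (ler_norm _) _.
    rewrite (_ : 96 = 6 * 16); last by ring.
    by apply: psum_bound => // z z01; exact: approx_k_le.
  move=> x x01.
  have bd m : log_bounded 16 (approx_k a n m).
    by apply: bounded_log => z; exact: approx_k_le.
  exact: (cont_cvg_pt (psum_sumS_cont aa a1 a0 ca (@approx_k_cvg a n a01) bd) x01).
move=> x x01.
apply: (@cvgn_dist _ _ (fun n => 6 * x `^ (- a) * 16 * (7 / 8) ^+ n)); last exact: cvg_geometric78.
move=> n; have [h1 _] := iter_transfer_one n a01.
rewrite -mulN1r -(sumS_lin (-1) a01 x01 (pcone_log h1) (kfix_log a01)).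
rewrite (_ : 6 * _ * _ * _ = 6 * (16 * (7 / 8) ^+ n) * x `^ (- a)); last by ring.
apply: sumS_bound => // z /in01W z01; rewrite mulN1r distrC.
by have [_] := kfix_approx a01 z01; apply.
Qed.

(** A bound on the second derivative, in a form that passes to pointwise limits
    and yields the first derivative of the limit. *)
Definition quad l B f := forall x h h', l <= x < 1 -> l <= x + h < 1 -> l <= x + h' < 1 ->
  `|h' * (f (x + h) - f x) - h * (f (x + h') - f x)| <= B * (`|h| * `|h'| * (`|h| + `|h'|)).

Lemma powR_Na_le a l x : 0 < a < 1 -> 0 < l <= x -> x <= 1 -> x `^ (- a) <= l^-1.
Proof.
move=> /andP[a0 a1] /andP[l0 lx] x1; have x0 : 0 < x by lra.
rewrite powRN lef_pV2 ?posrE ?powR_gt0//; apply: le_trans lx _.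
by apply: ger1_powR; rewrite ?x0// ltW.
Qed.

Lemma reg_quad a F l : 0 < a < 1 -> reg F ->
  (forall x, 0 < x <= 1 -> 0 <= F x <= 96 * x `^ (- a)) -> 0 < l ->
  quad l (20 * 96 / l ^+ 3) F.
Proof.
move=> a01 [F1 [F2 FP]] Fb l0; set B := _ / _.
have itv z : l <= z < 1 -> 0 < z < 1 by move=> /andP[? ->]; rewrite andbT; lra.
have F2B z : l <= z < 1 -> `|F2 z| <= B.
  move=> lz; have z01 := itv _ lz; have /andP[z0 z1] := z01.
  have z01' : 0 < z <= 1 by rewrite z0 ltW.
  have [_ _ _ b] := FP _ z01; apply: le_trans b _.
  have /andP[f0 f1] := Fb _ z01'.
  have /andP[lz' _] := lz.
  have p : z `^ (- a) <= l^-1 by apply: powR_Na_le => //; [rewrite l0 | exact: ltW].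
  have -> : B = 20 / l ^+ 2 * (96 / l) by rewrite /B; field; rewrite gt_eqF.
  apply: ler_pM => //; first by rewrite divr_ge0// sqr_ge0.
    rewrite ler_wpM2l// lef_pV2 ?posrE ?exprn_gt0//.
    by apply: lerXn2r; rewrite ?nnegrE; lra.
  by apply: le_trans f1 _; rewrite ler_wpM2l.
have bt x y z : l <= x < 1 -> l <= y < 1 -> between x y z -> l <= z < 1.
  move=> /andP[lx x1] /andP[ly y1] /andP[h1 h2]; apply/andP; split.
    by apply: le_trans h1; rewrite le_min lx.
  by apply: le_lt_trans h2 _; rewrite gt_max x1.
have T x h : l <= x < 1 -> l <= x + h < 1 -> `|F (x + h) - F x - h * F1 x| <= B * (h * h).
  move=> lx lxh.
  have d z (zb : between x (x + h) z) : is_derive z 1 F (F1 z).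
    by have [] := FP _ (itv _ (bt _ _ _ lx lxh zb)).
  have [z zb ->] := between_mean_value d.
  have lz := bt _ _ _ lx lxh zb.
  have d1 w (wb : between x z w) : is_derive w 1 F1 (F2 w).
    by have [] := FP _ (itv _ (bt _ _ _ lx lz wb)).
  have [w wb e] := between_mean_value d1.
  rewrite (_ : _ - _ = (F1 z - F1 x) * h); last by ring.
  rewrite e !normrM (_ : B * (h * h) = B * `|h| * `|h|); last first.
    by rewrite -mulrA -normrM -expr2 ger0_norm ?sqr_ge0// expr2.
  rewrite ler_wpM2r// ler_pM// ?F2B//; first exact: bt lx lz wb.
  by rewrite between_sym in zb; have := between_dist zb; rewrite [x + h]addrC addrK.
move=> x h h' lx lxh lxh'.
have t1 := T _ _ lx lxh; have t2 := T _ _ lx lxh'.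
rewrite (_ : _ - _ = h' * (F (x + h) - F x - h * F1 x) - h * (F (x + h') - F x - h' * F1 x)); last by ring.
apply: le_trans (ler_normB _ _) _; rewrite !normrM.
apply: le_trans (lerD (ler_wpM2l (normr_ge0 h') t1) (ler_wpM2l (normr_ge0 h) t2)) _.
have sq z : z * z = `|z| * `|z| by rewrite -normrM -expr2 ger0_norm ?sqr_ge0// expr2.
by rewrite (sq h) (sq h'); lra.
Qed.

Lemma quad_lim l B (f : nat -> R -> R) F : 0 < l -> (forall n, quad l B (f n)) ->
  (forall x, 0 < x <= 1 -> f n x @[n --> \oo] --> F x) -> quad l B F.
Proof.
move=> l0 q fF x h h' lx lxh lxh'.
have itv z : l <= z < 1 -> 0 < z <= 1 by move=> /andP[? /ltW->]; rewrite andbT; lra.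
have cx := fF _ (itv _ lx); have ch := fF _ (itv _ lxh); have ch' := fF _ (itv _ lxh').
have c : `|h' * (f n (x + h) - f n x) - h * (f n (x + h') - f n x)| @[n --> \oo] -->
    `|h' * (F (x + h) - F x) - h * (F (x + h') - F x)|.
  apply: cvg_norm; apply: cvgB; apply: cvgM; try exact: cvg_cst; exact: cvgB.
by apply: (limn_le_cst c) => n; exact: q.
Qed.

Lemma rhoh_quad a l : 0 < a < 1 -> 0 < l -> quad l (20 * 96 / l ^+ 3) (rhoh a).
Proof.
move=> a01 l0; apply: (rhoh_closed a01).
  by move=> F h1 h2; exact: (reg_quad a01).
by move=> f F h1 h2; exact: (quad_lim l0 h1).
Qed.

(** The bound says that the slopes for the steps [h] and [h'] differ by at most
    [B * (|h| + |h'|)], so that the slopes converge as the step tends to 0. *)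
Lemma quad_derive l B f x : quad l B f -> 0 < l -> l < x < 1 -> 0 <= B ->
  exists d : R, forall h, l <= x + h < 1 -> `|f (x + h) - f x - h * d| <= B * (h * h).
Proof.
move=> q l0 /andP[lx x1] B0.
pose e := Num.min (x - l) (1 - x).
have e0 : 0 < e by rewrite lt_min !subr_gt0 lx.
have ex : e <= x - l by rewrite ge_min lexx.
have e1 : e <= 1 - x by rewrite ge_min lexx orbT.
pose hn n : R := e / n.+2%:R.
have hn0 n : 0 < hn n by rewrite divr_gt0// ltr0n.
have hne n : hn n < e by rewrite /hn ltr_pdivrMr ?ltr0n// ltr_pMr// ltr1n.
have hnd n m : (n <= m)%N -> hn m <= hn n.
  by move=> nm; rewrite /hn ler_wpM2l ?(ltW e0)// lef_pV2 ?posrE ?ltr0n// ler_nat.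
have hnc : hn n @[n --> \oo] --> (0 : R).
  rewrite /hn -(mulr0 e); apply: cvgM; first exact: cvg_cst.
  by have := @cvg_harmonic R; rewrite -cvg_shiftS.
have lxx : l <= x < 1 by rewrite (ltW lx).
have lh n : l <= x + hn n < 1 by have := hne n; have := hn0 n; move=> ? ?; lra.
pose D n := (f (x + hn n) - f x) / hn n.
have qD h n : l <= x + h < 1 -> `|f (x + h) - f x - h * D n| <= B * (`|h| * (`|h| + hn n)).
  move=> lxh; have := q x h (hn n) lxx lxh (lh n).
  rewrite (gtr0_norm (hn0 n)).
  rewrite (_ : hn n * _ - _ = hn n * (f (x + h) - f x - h * D n)); last first.
    by rewrite /D; field; rewrite gt_eqF.
  rewrite normrM gtr0_norm//.
  rewrite (_ : B * _ = hn n * (B * (`|h| * (`|h| + hn n)))); last by ring.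
  by rewrite ler_pM2l.
have [||cD bD] := @limn_dist _ D (fun n => B * (hn n + hn n)).
- move=> n m nm; have := qD (hn m) n (lh m).
  rewrite (gtr0_norm (hn0 m)).
  rewrite (_ : f _ - f _ - _ = hn m * (D m - D n)); last first.
    by rewrite {2}/D; field; rewrite gt_eqF.
  rewrite normrM gtr0_norm// mulrCA ler_pM2l// => h; apply: le_trans h _.
  by rewrite ler_wpM2l// lerD2r hnd.
- by rewrite -(mulr0 B) -[X in _ * X]addr0; apply: cvgM; [exact: cvg_cst | exact: cvgD].
exists (limn D) => h lxh.
have c1 : `|f (x + h) - f x - h * D n| @[n --> \oo] --> `|f (x + h) - f x - h * limn D|.
  apply: cvg_norm; apply: cvgB; first exact: cvg_cst.
  by apply: cvgM => //; exact: cvg_cst.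
have c2 : B * (`|h| * (`|h| + hn n)) @[n --> \oo] --> B * (`|h| * (`|h| + 0)).
  apply: cvgM; first exact: cvg_cst.
  apply: cvgM; first exact: cvg_cst.
  by apply: cvgD => //; exact: cvg_cst.
have := limn_le2 c1 c2 (fun n => qD h n lxh).
by rewrite addr0 -normrM -expr2 ger0_norm ?sqr_ge0.
Qed.

Definition drhoh_dx a : R -> R := derive1 (rhoh a).

Lemma taylor_is_derive f x d B (e : R) : 0 < e -> 0 <= B ->
  (forall h, `|h| < e -> `|f (x + h) - f x - h * d| <= B * (h * h)) ->
  is_derive x 1 f d.
Proof.
move=> e0 B0 fd; apply: slope_is_derive => u ux uc.
have [N _ NP] : \forall n \near \oo, `|u n - x| < e.
  by near=> n; rewrite distrC; near: n; move/cvgrPdist_lt : uc; apply.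
rewrite -(cvg_shiftn N).
apply: (@cvgn_dist _ _ (fun n => B * `|u (n + N)%N - x|)); last first.
  apply: cvgn_mul0.
  apply: cvgn_normB0.
  by rewrite (cvg_shiftn N).
move=> n /=; set z := u (n + N)%N.
have zx : z - x != 0 by rewrite subr_eq0; exact: ux.
have h := fd (z - x) (NP _ (leq_addl _ _)); rewrite [x + _]addrC subrK in h.
rewrite -(ler_pM2r (_ : 0 < `|z - x|)) ?normr_gt0// -normrM.
rewrite (_ : (_ - d) * _ = f z - f x - (z - x) * d); last by field.
by rewrite -mulrA -normrM -expr2 [X in _ <= _ * X]ger0_norm ?sqr_ge0// expr2.
Unshelve. all: end_near. Qed.

Lemma drhoh_dxP a l x : 0 < a < 1 -> 0 < l -> l < x < 1 ->
  is_derive x 1 (rhoh a) (drhoh_dx a x) /\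
  forall h, l <= x + h < 1 ->
    `|rhoh a (x + h) - rhoh a x - h * drhoh_dx a x| <= 20 * 96 / l ^+ 3 * (h * h).
Proof.
move=> a01 l0 lx; have /andP[lx' x1] := lx.
have B0 : 0 <= 20 * 96 / l ^+ 3.
  by apply: divr_ge0; [exact: mulr_ge0 | rewrite exprn_ge0// ltW].
have [d dP] := quad_derive (rhoh_quad a01 l0) l0 lx B0.
have e0 : 0 < Num.min (x - l) (1 - x) by rewrite lt_min !subr_gt0 lx'.
have id : is_derive x 1 (rhoh a) d.
  apply: (taylor_is_derive e0 B0) => h.
  rewrite lt_min !ltr_norml => /andP[/andP[h1 h2] /andP[h3 h4]].
  by apply: dP; lra.
have -> : drhoh_dx a x = d by rewrite /drhoh_dx derive1E; case: id.
by [].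
Qed.

Lemma drhoh_dx_cont (al : nat -> R) a b (u : nat -> R) x :
  (forall n, 0 < al n <= b) -> b < 1 -> 0 < a -> al n @[n --> \oo] --> a ->
  (forall n, 0 < u n <= 2^-1) -> 0 < x <= 2^-1 -> u n @[n --> \oo] --> x ->
  drhoh_dx (al n) (u n) @[n --> \oo] --> drhoh_dx a x.
Proof.
move=> alb b1 a0 ala u2 x2 ux.
have al01 n : 0 < al n < 1 by have /andP[-> h] := alb n; exact: le_lt_trans h b1.
have a01 : 0 < a < 1.
  rewrite a0/=; apply: le_lt_trans b1.
  by apply: (limn_le_cst ala) => n; case/andP: (alb n).
have /andP[x0 xh] := x2.
pose l := x / 2; have l0 : 0 < l by rewrite /l; lra.
pose B := 20 * 96 / l ^+ 3.
pose h M : R := 4^-1 * harmonic M.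
have hr := @harmonic01 R.
have h0 M : 0 < h M <= 4^-1 by have /andP[? ?] := hr M; rewrite /h; lra.
have cc := rhoh_cont alb b1 a0 ala.
have step (c : R) M (z : R) : 0 < c < 1 -> l < z <= 2^-1 ->
    `|drhoh_dx c z - (rhoh c (z + h M) - rhoh c z) / h M| <= B * h M.
  move=> c01 /andP[lz z2]; have /andP[hM hM4] := h0 M.
  have lz1 : l < z < 1 by lra.
  have lzh : l <= z + h M < 1 by lra.
  have [_ /(_ _ lzh) H] := drhoh_dxP c01 l0 lz1.
  rewrite distrC -(ler_pM2r hM) -[X in _ * X <= _](gtr0_norm hM) -normrM.
  rewrite (_ : (_ - _) * _ = rhoh c (z + h M) - rhoh c z - h M * drhoh_dx c z); last first.
    by field; rewrite gt_eqF.
  by rewrite -[leRHS]mulrA.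
apply: (@cvgn_uniform_approx _ _
  (fun M n => (rhoh (al n) (u n + h M) - rhoh (al n) (u n)) / h M)
  (fun M => (rhoh a (x + h M) - rhoh a x) / h M) (fun M => B * h M)).
- move=> M; have /andP[hM hM4] := h0 M.
  apply: cvgM; last exact: cvg_cst.
  apply: cvgB.
    apply: (cc (fun n => u n + h M)).
    + by move=> n; have /andP[? ?] := u2 n; lra.
    + by lra.
    + by apply: cvgD => //; exact: cvg_cst.
  apply: cc => //; last by lra.
  by move=> n; have /andP[? ?] := u2 n; lra.
- move=> M; near=> n; apply: step => //; apply/andP; split; last by case/andP: (u2 n).
  by near: n; apply: (cvgr_gt x ux); rewrite /l; lra.
- by move=> M; apply: step => //; apply/andP; split => //; rewrite /l; lra.
- apply: cvgn_mul0.
  rewrite /h -(mulr0 4^-1); apply: cvgM; first exact: cvg_cst.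
  exact: cvg_harmonic.
Unshelve. all: end_near. Qed.

End Approximation.

(** * Moving the left branch under a fixed density *)

Section ParameterDerivative.
Context {R : realType}.
Implicit Types (a b c x y z v s t C K L w T : R) (F f g r p : R -> R) (n m : nat).

(** The contribution of the left branch to the equation of invariance. *)
Definition push a F x : R := F (ginv a x) / tau a (ginv a x).

Lemma is_derive_wt_ginv a x : 0 < a -> 0 < x <= 1 ->
  is_derive a 1 (fun t => wt t (ginv t x))
    (let y := ginv a x in wt a y * ln (2 * y) * (1 + wt a y) / tau a y).
Proof.
move=> a0 x01; have [g0 g2 gx] := ginvP a0 x01.
have dY := is_derive_ginv_param a0 x01.
set y := ginv a x in g0 g2 gx dY *.
set y' := _ / _ in dY.
have y20 : 0 < 2 * y by lra.
have t0 : tau a y != 0 by rewrite gt_eqF// tau_gt0// ltW.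
have d1 : is_derive a 1 (fun t : R => 2 * ginv t x) (2 * y').
  by apply: is_derive_eq; rewrite /GRing.scale/=; ring.
have d2 := @is_derive1_comp R (@ln R) (fun t : R => 2 * ginv t x) a _ _ (is_derive1_ln y20) d1.
rewrite /comp in d2.
have d3 : is_derive a 1 (fun t : R => t * ln (2 * ginv t x)) (ln (2 * y) + a * y' / y).
  by apply: is_derive_eq; rewrite /GRing.scale/= -/y; field; lra.
have d4 := @is_derive1_comp R expR (fun t => t * ln (2 * ginv t x)) a _ _ (is_derive_expR _) d3.
apply: (is_derive_eq d4) => /=; rewrite -/y -/(wt a y) /y'.
have e : tau a y = 1 + (1 + a) * wt a y by [].
rewrite e in t0 *; by field; rewrite t0 gt_eqF.
Qed.

Definition dtau a y : R := wt a y + (1 + a) * (wt a y * ln (2 * y) * (1 + wt a y) / tau a y).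

Lemma is_derive_tau_ginv a x : 0 < a -> 0 < x <= 1 ->
  is_derive a 1 (fun t => tau t (ginv t x)) (dtau a (ginv a x)).
Proof.
move=> a0 x01; have d := is_derive_wt_ginv a0 x01.
by rewrite /tau /dtau; apply: is_derive_eq; rewrite /GRing.scale/= /tau; ring.
Qed.

Lemma is_derive_tauV_ginv a x : 0 < a -> 0 < x <= 1 ->
  is_derive a 1 (fun t => (tau t (ginv t x))^-1)
    (- dtau a (ginv a x) / tau a (ginv a x) ^+ 2).
Proof.
move=> a0 x01; have [g0 g2 gx] := ginvP a0 x01.
have t0 : tau a (ginv a x) != 0 by rewrite gt_eqF// tau_gt0// ltW.
have d := @is_deriveV R (fun t => tau t (ginv t x)) a _ 1 t0 (is_derive_tau_ginv a0 x01).
by apply: (is_derive_eq d); rewrite /GRing.scale/=; field.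
Qed.

Definition dginv a y : R := - (y * wt a y * ln (2 * y)) / tau a y.

(** The derivative of [push a F x] with respect to the parameter [a], as a
    function of [y = ginv a x]. *)
Definition dpush a F F1 y : R :=
  F1 y * dginv a y / tau a y - F y * dtau a y / tau a y ^+ 2.

Lemma is_derive_comp_ginv a F (d : R) x : 0 < a -> 0 < x <= 1 ->
  is_derive (ginv a x) 1 F d ->
  is_derive a 1 (fun t => F (ginv t x)) (d * dginv a (ginv a x)).
Proof.
move=> a0 x01 dF.
exact: (@is_derive1_comp R F (fun t => ginv t x) a _ _ dF (is_derive_ginv_param a0 x01)).
Qed.

Lemma is_derive_push_param a F F1 x : 0 < a -> 0 < x <= 1 ->
  is_derive (ginv a x) 1 F (F1 (ginv a x)) ->
  is_derive a 1 (fun t => push t F x) (dpush a F F1 (ginv a x)).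
Proof.
move=> a0 x01 dF; have d1 := is_derive_comp_ginv a0 x01 dF.
have d2 := is_derive_tauV_ginv a0 x01.
rewrite /push; apply: is_derive_eq; rewrite /GRing.scale/= /dpush.
by ring.
Qed.

(** The derivative of [push a F] in space, where [F1] is the derivative of [F]. *)
Definition push1 a F F1 x : R := let y := ginv a x in
  F1 y / tau a y ^+ 2 - F y * ((1 + a) * a * wt a y) / (y * tau a y ^+ 3).

(** The derivative of [push1 a F F1 x] with respect to the parameter [a], as a
    function of [y = ginv a x], where [F2] is the derivative of [F1]. *)
Definition dpush1 a F F1 F2 y : R :=
  F2 y * dginv a y / tau a y ^+ 2 - 2 * F1 y * dtau a y / tau a y ^+ 3
  - F1 y * dginv a y * ((1 + a) * a * wt a y) / (y * tau a y ^+ 3)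
  - F y * (1 + 2 * a) * wt a y / (y * tau a y ^+ 3)
  - F y * ((1 + a) * a) * (wt a y * ln (2 * y) * (1 + wt a y) / tau a y) / (y * tau a y ^+ 3)
  + F y * ((1 + a) * a * wt a y) * dginv a y / (y ^+ 2 * tau a y ^+ 3)
  + 3 * F y * ((1 + a) * a * wt a y) * dtau a y / (y * tau a y ^+ 4).

Lemma is_derive_push1_param a F F1 F2 x : 0 < a -> 0 < x <= 1 ->
  is_derive (ginv a x) 1 F (F1 (ginv a x)) ->
  is_derive (ginv a x) 1 F1 (F2 (ginv a x)) ->
  is_derive a 1 (fun t => push1 t F F1 x) (dpush1 a F F1 F2 (ginv a x)).
Proof.
move=> a0 x01 dF dF1; have [g0 g2 gx] := ginvP a0 x01.
have d1 := is_derive_comp_ginv a0 x01 dF.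
have d1' := is_derive_comp_ginv a0 x01 dF1.
have d2 := is_derive_tauV_ginv a0 x01.
have d3 := is_derive_wt_ginv a0 x01; rewrite /= in d3.
have d4 := is_derive_comp_ginv a0 x01 (is_derive_inv g0).
have t0 : tau a (ginv a x) != 0 by rewrite gt_eqF// tau_gt0// ltW.
have y0 : ginv a x != 0 by rewrite gt_eqF.
have d : is_derive a 1 (fun t => F1 (ginv t x) *
      ((tau t (ginv t x))^-1 * (tau t (ginv t x))^-1)
    - F (ginv t x) * ((1 + t) * t * wt t (ginv t x)) * ((ginv t x)^-1 *
      ((tau t (ginv t x))^-1 * (tau t (ginv t x))^-1 * (tau t (ginv t x))^-1)))
    (dpush1 a F F1 F2 (ginv a x)).
  apply: is_derive_eq; rewrite /GRing.scale/= /dpush1.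
  set D := dtau _ _; set G := dginv _ _.
  set y := ginv a x in y0 t0 *; set T := tau a y in t0 *; set W := wt a y.
  by field; rewrite t0 y0.
rewrite [X in is_derive _ _ X _](_ : _ = (fun t : R => F1 (ginv t x) *
      ((tau t (ginv t x))^-1 * (tau t (ginv t x))^-1)
    - F (ginv t x) * ((1 + t) * t * wt t (ginv t x)) * ((ginv t x)^-1 *
      ((tau t (ginv t x))^-1 * (tau t (ginv t x))^-1 * (tau t (ginv t x))^-1)))); first exact: d.
by apply/funext => t; rewrite /push1 !exprS expr0 mulr1 !invfM; ring.
Qed.

Lemma normM_le (x y A B : R) : `|x| <= A -> `|y| <= B -> `|x * y| <= A * B.
Proof. by move=> h1 h2; rewrite normrM ler_pM. Qed.

Lemma normV_le1 T n : 1 <= T -> `|(T ^+ n)^-1| <= 1.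
Proof.
move=> T1; have p : 0 < T ^+ n by rewrite exprn_gt0//; lra.
rewrite ger0_norm; last by rewrite invr_ge0 ltW.
by rewrite invf_le1// exprn_ege1.
Qed.

Lemma dginv_le a y : 0 < a <= 1 -> 0 < y <= 2^-1 ->
  `|dginv a y| <= y * (wt a y * (1 - ln (2 * y))).
Proof.
move=> /andP[a0 a1] /andP[y0 y2].
have w0 := wt_gt0 a y; have L0 := ln2y_le0 y2; have T1 := tau_ge1 y (ltW a0).
have := normV_le1 1 T1; rewrite expr1 => h.
rewrite /dginv -[leRHS]mulr1; apply: normM_le h.
rewrite -mulrN -mulrA ger0_norm; last by rewrite !mulr_ge0 ?(ltW y0) ?(ltW w0) ?oppr_ge0.
by rewrite ler_wpM2l ?(ltW y0)// ler_wpM2l ?(ltW w0)//; lra.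
Qed.

Lemma dwt_le a y : 0 < a <= 1 -> 0 < y <= 2^-1 ->
  `|wt a y * ln (2 * y) * (1 + wt a y) / tau a y| <= 2 * (wt a y * (1 - ln (2 * y))).
Proof.
move=> /andP[a0 a1] /andP[y0 y2].
have w0 := wt_gt0 a y; have L0 := ln2y_le0 y2; have T1 := tau_ge1 y (ltW a0).
have w1 := wt_le1 (ltW a0) y2.
have := normV_le1 1 T1; rewrite expr1 => h.
rewrite -[leRHS]mulr1; apply: normM_le h; rewrite [leRHS]mulrC; apply: normM_le.
  rewrite ler0_norm; last by rewrite mulr_ge0_le0// ltW.
  by rewrite -mulrN ler_wpM2l ?(ltW w0)//; lra.
by rewrite ger0_norm; lra.
Qed.

Lemma dtau_le a y : 0 < a <= 1 -> 0 < y <= 2^-1 ->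
  `|dtau a y| <= 5 * (wt a y * (1 - ln (2 * y))).
Proof.
move=> a01 y02; have /andP[a0 a1] := a01; have /andP[y0 y2] := y02.
have w0 := wt_gt0 a y; have L0 := ln2y_le0 y2.
rewrite /dtau; apply: le_trans (ler_normD _ _) _.
have h1 : `|wt a y| <= wt a y * (1 - ln (2 * y)).
  by rewrite gtr0_norm// ler_peMr ?(ltW w0)//; lra.
have a2 : `|1 + a| <= 2 by rewrite ger0_norm; lra.
have := normM_le a2 (dwt_le a01 y02).
by lra.
Qed.

Lemma dpush_le a F F1 y : 0 < a <= 1 -> 0 < y <= 2^-1 -> 0 <= F y ->
  `|F1 y| <= 2 / y * F y ->
  `|dpush a F F1 y| <= 7 * (F y * (wt a y * (1 - ln (2 * y)))).
Proof.
move=> a01 y02 F0 b1; have /andP[a0 a1] := a01; have /andP[y0 y2] := y02.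
have T1 := tau_ge1 y (ltW a0).
have h0 := normV_le1 1 T1; rewrite expr1 in h0; have h2 := normV_le1 2 T1.
have h3 := dginv_le a01 y02; have h4 := dtau_le a01 y02.
have Fn : `|F y| <= F y by rewrite ger0_norm.
rewrite /dpush; apply: le_trans (ler_normB _ _) _.
have k1 := normM_le (normM_le b1 h3) h0; have k2 := normM_le (normM_le Fn h4) h2.
apply: le_trans (lerD k1 k2) _.
set M := wt a y * _; rewrite (_ : 2 / y * F y * (y * M) = 2 * F y * M); last by field; lra.
by lra.
Qed.

Lemma dpush1_le a F F1 F2 y : 0 < a <= 1 -> 0 < y <= 2^-1 -> 0 <= F y ->
  `|F1 y| <= 2 / y * F y -> `|F2 y| <= 20 / y ^+ 2 * F y ->
  `|dpush1 a F F1 F2 y| <= 83 * (F y * (wt a y * (1 - ln (2 * y)))) / y.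
Proof.
move=> a01 y02 F0 b1 b2; have /andP[a0 a1] := a01; have /andP[y0 y2] := y02.
have T1 := tau_ge1 y (ltW a0); have w0 := wt_gt0 a y; have w1 := wt_le1 (ltW a0) y2.
have L0 := ln2y_le0 y2.
have h2 := normV_le1 2 T1; have h3 := normV_le1 3 T1; have h4 := normV_le1 4 T1.
have g1 := dginv_le a01 y02; have g2 := dtau_le a01 y02; have g3 := dwt_le a01 y02.
have yi : 0 < y^-1 by rewrite invr_gt0.
have Fn : `|F y| <= F y by rewrite ger0_norm.
have cn : `|(1 + a) * a| <= 2 by rewrite ger0_norm; nra.
have wn : `|wt a y| <= 1 by rewrite gtr0_norm.
have cwn : `|(1 + a) * a * wt a y| <= 2 by rewrite -[leRHS]mulr1; exact: normM_le.
have yn : `|y^-1| <= y^-1 by rewrite gtr0_norm.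
have n2 : `|2 : R| <= 2 by rewrite gtr0_norm.
have n3 : `|3 : R| <= 3 by rewrite gtr0_norm.
have a3 : `|1 + 2 * a| <= 3 by rewrite gtr0_norm; lra.
have y3 : `|(y * tau a y ^+ 3)^-1| <= y^-1.
  by rewrite invfM -[leRHS]mulr1; exact: normM_le.
have y23 : `|(y ^+ 2 * tau a y ^+ 3)^-1| <= (y ^+ 2)^-1.
  rewrite invfM -[leRHS]mulr1; apply: normM_le => //.
  by rewrite ger0_norm// invr_ge0 sqr_ge0.
have y4 : `|(y * tau a y ^+ 4)^-1| <= y^-1.
  by rewrite invfM -[leRHS]mulr1; exact: normM_le.
have M1 : wt a y <= wt a y * (1 - ln (2 * y)) by rewrite ler_peMr ?(ltW w0)//; lra.
set M := wt a y * (1 - ln (2 * y)) in g1 g2 g3 M1 *.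
have wM : `|wt a y| <= M by rewrite gtr0_norm.
have k1 := normM_le (normM_le b2 g1) h2.
have k2 := normM_le (normM_le (normM_le n2 b1) g2) h3.
have k3 := normM_le (normM_le (normM_le b1 g1) cwn) y3.
have k4 := normM_le (normM_le (normM_le Fn a3) wM) y3.
have k5 := normM_le (normM_le (normM_le Fn cn) g3) y3.
have k6 := normM_le (normM_le (normM_le Fn cwn) g1) y23.
have k7 := normM_le (normM_le (normM_le (normM_le n3 Fn) cwn) g2) y4.
rewrite /dpush1.
apply: le_trans (ler_normD _ _) _; apply: le_trans (lerD (ler_normD _ _) k7) _.
apply: le_trans (lerD (lerD (ler_normB _ _) k6) (lexx _)) _.
apply: le_trans (lerD (lerD (lerD (ler_normB _ _) k5) (lexx _)) (lexx _)) _.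
apply: le_trans (lerD (lerD (lerD (lerD (ler_normB _ _) k4) (lexx _)) (lexx _)) (lexx _)) _.
apply: le_trans (lerD (lerD (lerD (lerD (lerD (ler_normB _ _) k3) (lexx _)) (lexx _)) (lexx _)) (lexx _)) _.
apply: le_trans (lerD (lerD (lerD (lerD (lerD (lerD k1 k2) (lexx _)) (lexx _)) (lexx _)) (lexx _)) (lexx _)) _.
rewrite le_eqVlt; apply/orP; left; apply/eqP; field; lra.
Qed.

(** The parameter of the density is at most the parameter of the branch, so that
    [wt] compensates the singularity of the density. *)
Lemma powR_wt_le c a x K (Fy : R) : 0 < c <= a -> a <= 1 -> 0 < x <= 1 -> 0 <= K ->
  0 <= Fy <= K * ginv a x `^ (- c) ->
  let y := ginv a x in
  Fy * (wt a y * (1 - ln (2 * y))) <= 2 * K * (1 - ln x) /\ y^-1 <= 2 / x.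
Proof.
move=> /andP[c0 ca] a1 x01 K0 /andP[F0 FK] y; have a0 : 0 < a by lra.
have [y0 y2 _] := ginvP a0 x01; have xy := ginv_ge a0 x01.
have /andP[x0 x1] := x01.
rewrite -/y in y0 y2 xy FK *.
have w0 := wt_gt0 a y; have L0 := ln2y_le0 y2.
split; last first.
  by rewrite -[2 / x]invf_div lef_pV2 ?posrE// divr_gt0.
have lx : 1 - ln (2 * y) <= 1 - ln x.
  by rewrite lerD2l lerN2 ler_ln ?posrE//; lra.
have pw : y `^ (- c) * wt a y <= 2.
  rewrite powR_expR// /wt -expRD lnM ?posrE//.
  rewrite -[leRHS]lnK ?posrE// ler_expR.
  have l2 : 0 <= ln (2 : R) by rewrite ln_ge0//; lra.
  have ly : ln y <= 0 by rewrite ln_le0//; lra.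
  by nra.
have h1 : Fy * wt a y <= K * 2.
  apply: le_trans (ler_wpM2r (ltW w0) FK) _.
  by rewrite -mulrA ler_wpM2l.
rewrite mulrA [2 * K]mulrC.
by apply: ler_pM => //; [rewrite mulr_ge0// ltW | lra].
Qed.

Definition qquot F b c x : R := (push b F x - push c F x) / (b - c).

Lemma cvg_left1 : 1 - 2^-1 * harmonic n @[n --> \oo] --> (1 : R).
Proof.
rewrite -[X in _ --> X](subr0 1); apply: cvgB; first exact: cvg_cst.
apply: cvgn_mul0; exact: cvg_harmonic.
Qed.

(** A multiple of [1 - ln x] lies well inside the cone: added to a function that
    has logarithmic bounds on its values and its slope, it brings it into the cone. *)
Lemma sqcone_of_derive q (q1 : R -> R) C0 C1 :
  (forall x, 0 < x < 1 -> is_derive x 1 q (q1 x)) ->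
  q (1 - 2^-1 * harmonic n) @[n --> \oo] --> q 1 ->
  log_bounded C0 q -> 0 <= C1 ->
  (forall x, 0 < x < 1 -> `|q1 x| <= C1 * (1 - ln x) / x) ->
  sqcone (fun x => q x + (C1 + 2 * C0) * (1 - ln x)).
Proof.
move=> dq cq qC C1p q1C; have C0p := log_bounded_ge0 qC.
set N := C1 + 2 * C0; set f := fun x => q x + N * (1 - ln x).
have lb x : 0 < x < 1 -> 1 <= 1 - ln x by move=> /andP[x0 x1]; apply: ge1_1Bln; rewrite x0 ltW.
have N0 : 0 <= N by rewrite /N; lra.
have df x : 0 < x < 1 -> is_derive x 1 f (q1 x - N / x).
  move=> x01; have /andP[x0 x1] := x01; have d := dq _ x01.
  have d2 := is_derive1_ln x0.
  by rewrite /f; apply: is_derive_eq; rewrite /GRing.scale/=; field; lra.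
have f0 x : 0 < x <= 1 -> 0 <= f x.
  move=> x01; have := qC _ x01; rewrite ler_norml => /andP[h _].
  have := ge1_1Bln x01; rewrite /f /N; nra.
have up s t : 0 < s -> s <= t -> t < 1 -> f s * s ^+ 2 <= f t * t ^+ 2.
  apply: (@ge0_derive_le _ 0 1 (fun x => f x * x ^+ 2)
    (fun x => (q1 x - N / x) * x ^+ 2 + f x * (2 * x))).
  - move=> x x01; have d := df _ x01.
    by apply: is_derive_eq; rewrite /GRing.scale/=; ring.
  - move=> x x01; have /andP[x0 x1] := x01.
    have x01' : 0 < x <= 1 by rewrite x0 ltW.
    have := qC _ x01'; rewrite ler_norml => /andP[h1 _].
    have := q1C _ x01; rewrite ler_norml => /andP[h2 _].
    have l1 := lb _ x01.
    have e : (q1 x - N / x) * x ^+ 2 + f x * (2 * x) =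
      x * (q1 x * x + 2 * q x + N * (2 * (1 - ln x) - 1)).
      by rewrite /f; field; lra.
    rewrite e mulr_ge0 ?(ltW x0)//.
    have h3 : - (C1 * (1 - ln x)) <= q1 x * x.
      by rewrite -ler_pdivrMr// mulNr.
    have h4 : N * (1 - ln x) <= N * (2 * (1 - ln x) - 1) by rewrite ler_wpM2l//; lra.
    by rewrite /N in h4 *; lra.
have dn s t : 0 < s -> s <= t -> t < 1 -> f t * s ^+ 2 <= f s * t ^+ 2.
  move=> s0 st t1; have t0 : 0 < t by lra.
  have h : - (f s * (s^-1 * s^-1)) <= - (f t * (t^-1 * t^-1)).
    apply: (@ge0_derive_le _ 0 1 (fun x => - (f x * (x^-1 * x^-1)))
      (fun x => - ((q1 x - N / x) * (x^-1 * x^-1) + f x * (2 * (- 1 / x ^+ 2) * x^-1)))) => //.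
    - move=> x x01; have /andP[x0 x1] := x01; have d := df _ x01; have d2 := is_derive_inv x0.
      by apply: is_derive_eq; rewrite /GRing.scale/=; ring.
    - move=> x x01; have /andP[x0 x1] := x01.
      have x01' : 0 < x <= 1 by rewrite x0 ltW.
      have := qC _ x01'; rewrite ler_norml => /andP[h1 _].
      have := q1C _ x01; rewrite ler_norml => /andP[_ h2].
      have l1 := lb _ x01.
      rewrite (_ : - _ = (N + 2 * f x - q1 x * x) / x ^+ 3); last by field; lra.
      rewrite divr_ge0 ?exprn_ge0 ?(ltW x0)//.
      have h3 : q1 x * x <= C1 * (1 - ln x).
        by rewrite -(ler_pM2r x0) divfK ?gt_eqF in h2.
      rewrite /f; have : N * (1 - ln x) >= (C1 + 2 * C0) * (1 - ln x) by [].
      by nra.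
  move: h; rewrite -!invfM -!expr2 lerN2 ler_pdivrMr ?exprn_gt0// mulrAC ler_pdivlMr ?exprn_gt0//.
move=> s t s01 t01 st; have /andP[s0 s1] := s01; have /andP[t0 t1] := t01.
have [t1'|t1'] := ltP t 1; first by split; [exact: f0 | exact: up | exact: dn].
have tE : t = 1 by apply/eqP; rewrite eq_le t1.
subst t; clear t1 t1' st.
have [s1'|s1'] := ltP s 1; last first.
  have -> : s = 1 by apply/eqP; rewrite eq_le s1 s1'.
  by split; [exact: f0 | |].
have hr := @harmonic01 R.
pose u n : R := 1 - 2^-1 * harmonic n.
have uc : u n @[n --> \oo] --> (1 : R) by exact: cvg_left1.
have fu : f (u n) @[n --> \oo] --> f 1.
  apply: cvgD; first exact: cq.
  apply: cvgM; first exact: cvg_cst.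
  apply: cvgB; first exact: cvg_cst.
  by apply: continuous_cvg uc; apply: continuous_ln.
have u1 n : u n < 1 by have /andP[? ?] := hr n; rewrite /u; lra.
have u0 n : 0 < u n by have /andP[? ?] := hr n; rewrite /u; lra.
have su : \forall n \near \oo, s <= u n by apply: (cvgr_ge 1 uc).
have u2 : u n ^+ 2 @[n --> \oo] --> (1 : R) ^+ 2 by rewrite !expr2; exact: cvgM.
split; first exact: f0.
- rewrite -lerN2; apply: (limn_le_near (cvgN (cvgM fu u2))).
  by near=> n; rewrite lerN2; apply: up => //; near: n.
- rewrite -subr_le0.
  have c : f (u n) * s ^+ 2 - f s * u n ^+ 2 @[n --> \oo] --> f 1 * s ^+ 2 - f s * 1 ^+ 2.
    apply: cvgB; apply: cvgM => //; exact: cvg_cst.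
  apply: (limn_le_near c).
  by near=> n; rewrite subr_le0; apply: dn => //; near: n.
Unshelve. all: end_near. Qed.

Lemma push_cvg a F (u : nat -> R) x : 0 < a -> (forall n, 0 < u n <= 1) ->
  0 < x <= 1 -> u n @[n --> \oo] --> x -> {for ginv a x, continuous F} ->
  push a F (u n) @[n --> \oo] --> push a F x.
Proof.
move=> a0 u01 x01 ux cF.
have ca : (fun=> a) n @[n --> \oo] --> a by exact: cvg_cst.
have cg : ginv a (u n) @[n --> \oo] --> ginv a x by apply: (@cvg_ginv _ (fun=> a)).
have [g0 _ _] := ginvP a0 x01.
apply: cvgM; first exact: (continuous_cvg _ cF cg).
apply: cvgV; first by rewrite gt_eqF// tau_gt0// ltW.
exact: (cvg_tau ca cg g0).
Qed.

(** The factor 83 is that of [dpush1_le], and both bounds of [powR_wt_le] have a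
    factor 2. *)
Definition qcst : R := 83 * 4.

Lemma qcst_ge0 : 0 <= qcst.
Proof. by rewrite mulr_ge0 ?ler0n. Qed.

(** The mean value theorem in the parameter, for [push] and for its derivative in
    space. All the intermediate parameters are at least [c], as [powR_wt_le]
    requires. *)
Lemma reg_qquot F b c K : 0 < c -> c < b -> b <= 1 -> reg F -> 0 <= K ->
  (forall x, 0 < x <= 1 -> 0 <= F x <= K * x `^ (- c)) ->
  log_bounded (14 * K) (qquot F b c) /\
  sqcone (fun x => qquot F b c x + (qcst * K + 2 * (14 * K)) * (1 - ln x)).
Proof.
move=> c0 cb b1 [F1 [F2 FP]] K0 FK.
have bc0 : 0 < b - c by rewrite subr_gt0.
have b0 : 0 < b by lra.
have mid t x : 0 < x <= 1 -> between c b t ->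
    [/\ 0 < t <= 1, 0 < c <= t, 0 < ginv t x <= 2^-1, 0 < ginv t x < 1
      & 0 <= F (ginv t x) <= K * ginv t x `^ (- c)].
  move=> x01; rewrite between_leE; last exact: ltW.
  move=> /andP[ct tb].
  have t0 : 0 < t by lra.
  have [g0 g2 _] := ginvP t0 x01.
  split; try by lra.
  by apply: FK; exact: ginv01.
have q0 : log_bounded (14 * K) (qquot F b c).
  move=> x x01.
  have d t (tb : between c b t) :
      is_derive t 1 (fun t => push t F x) (dpush t F F1 (ginv t x)).
    have [/andP[t0 _] _ _ y01 _] := mid _ _ x01 tb.
    by apply: is_derive_push_param => //; have [] := FP _ y01.
  have [t tb e] := between_mean_value d.
  have [t01 ct y2 y01 Fy] := mid _ _ x01 tb.
  have [_ _ p1 _] := FP _ y01.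
  rewrite /qquot e mulfK ?gt_eqF//.
  have /andP[Fy0 _] := Fy; have /andP[_ t1] := t01.
  apply: le_trans (dpush_le t01 y2 Fy0 p1) _.
  have [h _] := powR_wt_le ct t1 x01 K0 Fy.
  rewrite (_ : 14 * K * _ = 7 * (2 * K * (1 - ln x))); last by ring.
  by rewrite ler_wpM2l.
split; first exact: q0.
apply: (@sqcone_of_derive _ (fun x => (push1 b F F1 x - push1 c F F1 x) / (b - c))).
- move=> x x01; rewrite /qquot.
  have dF y : 0 < y < 1 -> is_derive y 1 F (F1 y) by move=> /FP[].
  have d1 : is_derive x 1 (push b F) (push1 b F F1 x) by exact: is_derive_branch1 dF.
  have d2 : is_derive x 1 (push c F) (push1 c F F1 x) by exact: is_derive_branch1 dF.
  by apply: is_derive_eq; rewrite /GRing.scale/= mulr0 add0r mulrC.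
- have one01 : 0 < (1 : R) <= 1 by rewrite ltr01 lexx.
  have hr := @harmonic01 R.
  have u01 n : 0 < 1 - 2^-1 * (harmonic n : R) <= 1.
    by have /andP[? ?] := hr n; lra.
  have cF : {for 2^-1, continuous F}.
    have [|[d _] _ _ _] := FP 2^-1; first by lra.
    exact/differentiable_continuous/derivable1_diffP.
  rewrite /qquot; apply: cvgM; last exact: cvg_cst.
  apply: cvgB; apply: push_cvg => //; try exact: cvg_left1.
    by rewrite ginv1.
  by rewrite ginv1.
- exact: q0.
- exact: mulr_ge0 qcst_ge0 K0.
- move=> x /andP[x0 x1]; have x01 : 0 < x <= 1 by rewrite x0 ltW.
  have d t (tb : between c b t) :
      is_derive t 1 (fun t => push1 t F F1 x) (dpush1 t F F1 F2 (ginv t x)).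
    have [/andP[t0 _] _ _ y01 _] := mid _ _ x01 tb.
    by apply: is_derive_push1_param => //; have [] := FP _ y01.
  have [t tb e] := between_mean_value d.
  have [t01 ct y2 y01 Fy] := mid _ _ x01 tb.
  have [_ _ p1 p2] := FP _ y01.
  rewrite e mulfK ?gt_eqF//.
  have /andP[Fy0 _] := Fy; have /andP[_ t1] := t01.
  apply: le_trans (dpush1_le t01 y2 Fy0 p1 p2) _.
  have [h hy] := powR_wt_le ct t1 x01 K0 Fy.
  have y0 : 0 < ginv t x by case/andP: y2.
  have yi : 0 <= (ginv t x)^-1 by rewrite invr_ge0 ltW.
  have := ge1_1Bln x01 => l1.
  apply: (@le_trans _ _ (83 * (2 * K * (1 - ln x)) * (2 / x))).
    apply: ler_pM => //; last by rewrite ler_wpM2l.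
    have /andP[_ /ln2y_le0 l2] := y2.
    have l3 : 0 <= 1 - ln (2 * ginv t x) by rewrite subr_ge0 (le_trans l2 ler01).
    exact: mulr_ge0 (ler0n _ _) (mulr_ge0 Fy0 (mulr_ge0 (ltW (wt_gt0 _ _)) l3)).
  rewrite /qcst.
  set L := 1 - ln x; set k : R := 83; rewrite le_eqVlt; apply/orP; left; apply/eqP.
  by ring.
Qed.

(** The values that [reg_qquot] gives for [K = 96], the constant of [rhoh_closed]. *)
Definition qbnd : R := 14 * 96.
Definition qcone : R := qcst * 96 + 2 * qbnd.

Lemma rhoh_qquot b c : 0 < c -> c < b -> b < 1 ->
  log_bounded qbnd (qquot (rhoh c) b c) /\
  sqcone (fun x => qquot (rhoh c) b c x + qcone * (1 - ln x)).
Proof.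
move=> c0 cb b1.
have c01 : 0 < c < 1 by rewrite c0; lra.
have b0 : 0 < b by lra.
apply: (rhoh_closed c01 (Q := fun F => log_bounded qbnd (qquot F b c) /\
  sqcone (fun x => qquot F b c x + qcone * (1 - ln x)))).
  by move=> F h1 h2; exact: (reg_qquot c0 cb (ltW b1) h1 (ler0n _ _) h2).
move=> f F fQ fF.
have cq x : 0 < x <= 1 -> qquot (f n) b c x @[n --> \oo] --> qquot F b c x.
  move=> x01; apply: cvgM; last exact: cvg_cst.
  by apply: cvgB; (apply: cvgM; last exact: cvg_cst); apply: fF; exact: ginv01.
split.
  move=> x x01; apply: (limn_le_cst (cvg_norm (cq _ x01))) => n.
  by have [h _] := fQ n; exact: h.
apply: (@cone_lim _ _ _ (fun n x => qquot (f n) b c x + qcone * (1 - ln x))).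
  by move=> n; have [] := fQ n.
by move=> x x01; apply: cvgD; [exact: cq | exact: cvg_cst].
Qed.

(** The mean value theorem in the parameter, where the intermediate parameters
    converge to [a]. *)
Lemma qquot_cont (be ga : nat -> R) a b :
  (forall n, 0 < ga n) -> (forall n, ga n < be n) -> (forall n, be n <= b) -> b < 1 ->
  0 < a -> be n @[n --> \oo] --> a -> ga n @[n --> \oo] --> a ->
  cont_cvg (fun n => qquot (rhoh (ga n)) (be n) (ga n))
    (fun x => dpush a (rhoh a) (drhoh_dx a) (ginv a x)).
Proof.
move=> ga0 gabe beb b1 a0 bea gaa u x u01 x01 ux.
have gab n : 0 < ga n <= b by rewrite ga0/=; apply: le_trans (beb n); exact: ltW.
have ga01 n : 0 < ga n < 1 by have /andP[-> h] := gab n; exact: le_lt_trans h b1.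
have /choice[th thP] : forall n, exists t, between (ga n) (be n) t /\
    qquot (rhoh (ga n)) (be n) (ga n) (u n) =
    dpush t (rhoh (ga n)) (drhoh_dx (ga n)) (ginv t (u n)).
  move=> n.
  have d t (tb : between (ga n) (be n) t) :
      is_derive t 1 (fun t => push t (rhoh (ga n)) (u n))
        (dpush t (rhoh (ga n)) (drhoh_dx (ga n)) (ginv t (u n))).
    have t0 : 0 < t.
      move: tb; rewrite between_leE; last exact: ltW.
      by move=> /andP[h _]; exact: lt_le_trans h.
    have [g0 g2 _] := ginvP t0 (u01 n).
    apply: is_derive_push_param => //.
    have l0 : 0 < ginv t (u n) / 2 by lra.
    by have [|] := @drhoh_dxP _ (ga n) (ginv t (u n) / 2) (ginv t (u n)) (ga01 n) l0;
      first by lra.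
  have [t tb e] := between_mean_value d.
  exists t; split => //; rewrite /qquot e mulfK// subr_eq0 gt_eqF//.
have tha : th n @[n --> \oo] --> a.
  apply: (@cvgn_dist _ _ (fun n => `|ga n - be n| + `|be n - a|)).
    move=> n; have [tb _] := thP n.
    have := between_dist tb; have := ler_normD (th n - be n) (be n - a).
    by rewrite subrKA; lra.
  rewrite -[X in _ --> X]addr0; apply: cvgD; rewrite -(normr0 R); apply: cvg_norm.
    by rewrite -(subrr a); exact: cvgB.
  exact/subr_cvg0.
have th0 n : 0 < th n.
  have [+ _] := thP n.
  rewrite between_leE; last exact: ltW.
  by move=> /andP[h _]; exact: lt_le_trans h.
have [g0 g2 _] := ginvP a0 x01.
have gn n := ginvP (th0 n) (u01 n).
have cg := cvg_ginv th0 u01 a0 x01 tha ux.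
pose y n := ginv (th n) (u n).
have y2 n : 0 < y n <= 2^-1 by have [h1 h2 _] := gn n; rewrite /y h1.
have y01 n : 0 < y n <= 1 by have /andP[-> h] := y2 n; lra.
have cw := cvg_wt tha cg g0; have ct := cvg_tau tha cg g0; have cl := cvg_ln2 cg g0.
have t0 : tau a (ginv a x) != 0 by rewrite gt_eqF// tau_gt0// ltW.
have cti : (tau (th n) (ginv (th n) (u n)))^-1 @[n --> \oo] --> (tau a (ginv a x))^-1.
  exact: cvgV.
have cr : rhoh (ga n) (y n) @[n --> \oo] --> rhoh a (ginv a x).
  by apply: (rhoh_cont gab b1 a0 gaa) => //; exact: ginv01.
have cd : drhoh_dx (ga n) (y n) @[n --> \oo] --> drhoh_dx a (ginv a x).
  by apply: (drhoh_dx_cont gab b1 a0 gaa y2 _ cg); rewrite g0.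
have cdg : dginv (th n) (y n) @[n --> \oo] --> dginv a (ginv a x).
  by apply: cvgM cti; apply: cvgN; apply: cvgM cl; exact: cvgM.
have cdt : dtau (th n) (y n) @[n --> \oo] --> dtau a (ginv a x).
  apply: cvgD => //; apply: cvgM; first by apply: cvgD => //; exact: cvg_cst.
  apply: cvgM cti; apply: cvgM; first exact: cvgM.
  by apply: cvgD => //; exact: cvg_cst.
rewrite (_ : (fun n => _) = fun n => dpush (th n) (rhoh (ga n)) (drhoh_dx (ga n)) (y n)); last first.
  by apply/funext => n; have [_ ->] := thP n.
apply: cvgB; first by apply: cvgM cti; exact: cvgM.
apply: cvgM; first exact: cvgM.
apply: cvgV; first by rewrite expf_neq0.
by rewrite !expr2; exact: cvgM.
Qed.

End ParameterDerivative.

(** * The strict derivative in the parameter *)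

Section StrictDerivative.
Context {R : realType}.
Implicit Types (a b c x y z v s t C K L w T : R) (F f g r p : R -> R) (n m N : nat).

Lemma qbnd_ge0 : 0 <= (qbnd : R).
Proof. by rewrite mulr_ge0 ?ler0n. Qed.

Lemma qcone_ge0 : 0 <= (qcone : R).
Proof. by rewrite addr_ge0 ?mulr_ge0 ?ler0n ?qcst_ge0 ?qbnd_ge0. Qed.

(** [sumS b] inverts the operator [f |-> f - push b f] on the functions whose
    singularity at the origin is weaker than [1 / x]. *)
Lemma sumS_push_inverse b f r C C' x : 0 < b < 1 ->
  (forall y, 0 < y <= 1 -> f y = r y + push b f y) -> log_bounded C' r -> 0 <= C ->
  (forall y, 0 < y <= 1 -> `|f y| <= C * (y `^ (- b) * (1 - ln y))) ->
  0 < x <= 1 -> sumS b r x = f x.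
Proof.
move=> b01 fr rC C0 fC x01; have /andP[b0 b1] := b01; have /andP[x0 _] := x01.
have e n : psum b r n x = f x - jac b n x * f (iter n (ginv b) x).
  elim: n x x01 {x0} => [|n IH] x x01; first by rewrite /= mul1r subrr.
  rewrite iterSr /= IH; last exact: ginv01.
  by rewrite [f x]fr// /push; ring.
have c1 := sumS_cvg b01 x01 rC.
have c2 : psum b r n x @[n --> \oo] --> f x.
  apply: (@cvgn_dist _ _ (fun n => C * tail_rate b n / x)).
    move=> n; rewrite e [f x - _]addrC addrK normrN normrM (gtr0_norm (jac_gt0 _ _ b0)).
    have i01 := iter_ginv01 n b0 x01; have /andP[i0 _] := i01.
    have k := @tail_rate_ge _ b b n _ i0 (iter_ginv_le n _ x01).
    have bb : 0 < b <= b by rewrite b0 lexx.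
    have b01' : 0 < b <= 1 by rewrite b0 ltW.
    have {}k := k b01' bb b1.
    apply: le_trans (ler_pM (ltW (jac_gt0 _ _ b0)) (normr_ge0 _) (jac_le n b0 x01) (fC _ i01)) _.
    rewrite mulrAC ler_wpM2r ?invr_ge0 ?(ltW x0)//.
    by rewrite mulrCA ler_wpM2l.
  rewrite -(mul0r x^-1); apply: cvgM; last exact: cvg_cst.
  apply: cvgn_mul0; exact: tail_rate_cvg0.
by rewrite -(cvg_lim _ c1)// -(cvg_lim _ c2).
Qed.

(** Changing the parameter of the branches only, for a fixed source. *)
Lemma rhoh_change_branch b c x : 0 < c -> c < b -> b < 1 -> 0 < x <= 1 ->
  rhoh c x = sumS b (kfix c) x - (b - c) * sumS b (qquot (rhoh c) b c) x.
Proof.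
move=> c0 cb b1 x01.
have c01 : 0 < c < 1 by rewrite c0; lra.
have b01 : 0 < b < 1 by rewrite b1 andbT; lra.
have bc : b - c != 0 by rewrite gt_eqF// subr_gt0.
have [ql _] := rhoh_qquot c0 cb b1.
rewrite -mulNr -(sumS_lin _ b01 x01 (kfix_log c01) ql).
symmetry; apply: (@sumS_push_inverse b _ _ 24 _ _ b01 _
  (log_bounded_lin _ (kfix_log c01) ql)) => // y y01.
- rewrite [LHS](rhoh_eq c01 y01) -(kfix_rhoh c01 (in01W y01)).
  have e : (b - c) * qquot (rhoh c) b c y = push b (rhoh c) y - push c (rhoh c) y.
    by rewrite /qquot mulrC divfK.
  by rewrite mulNr e -/(push c _ y) opprB -addrA subrK.
- apply: le_trans (rhoh_le c01 y01) _; rewrite ler_wpM2l//.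
  have := ge1_1Bln y01 => l1.
  have y0 : 0 < y by case/andP: y01.
  apply: (@le_trans _ _ (y `^ (- b))); last by rewrite ler_peMr// powR_ge0.
  by apply: ger_powR => //; rewrite lerN2 ltW.
Qed.

Lemma transfer_log_bound a r C v : 0 < a < 1 -> 0 <= v <= 1 -> log_bounded C r ->
  `|transfer a r v| <= 48 * C.
Proof.
move=> a01 v01 rC; have h := sumS_log_bound a01 (half01 v01) rC.
have C0 := log_bounded_ge0 rC.
have a01' : 0 < a <= 1 by case/andP: a01 => -> /ltW ->.
have p2 := powR_half_le a01' v01; have p0 := powR_ge0 ((1 + v) / 2) (- a).
have l2 : 1 - ln ((1 + v) / 2) <= 2.
  have /andP[v0 _] := v01.
  have : ln 2^-1 <= ln ((1 + v) / 2) by rewrite ler_ln ?posrE//; lra.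
  rewrite lnV ?posrE//; have := @le_ln1Dx R 1; rewrite (_ : 1 + 1 = 2); last by ring.
  by move=> h2; have := h2 ltac:(lra); lra.
have l0 := ge1_1Bln (half01 v01).
rewrite /transfer normrM gtr0_norm ?invr_gt0//.
have h2 : ((1 + v) / 2) `^ (- a) * (1 - ln ((1 + v) / 2)) <= 2 * 2.
  by apply: ler_pM => //; lra.
apply: le_trans (ler_wpM2l _ (le_trans h (ler_wpM2l _ h2))) _; rewrite ?invr_ge0 ?mulr_ge0//.
by rewrite le_eqVlt; apply/orP; left; apply/eqP; field.
Qed.

Lemma mass_ext K1 K2 f g : lip01 K1 f -> lip01 K2 g ->
  (forall x, 0 <= x <= 1 -> f x = g x) -> mass f = mass g.
Proof.
move=> h1 h2 fg; apply/eqP; rewrite -subr_eq0 -normr_le0.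
by apply: (mass_dist h1 h2) => x /fg ->; rewrite subrr normr0.
Qed.

Lemma sqcone_lb C : 0 <= C -> sqcone (fun x => C * (1 - ln x)).
Proof.
move=> C0.
apply: (@cone_ext _ _ _ (fun x => (fun=> 0) x + (C + 2 * 0) * (1 - ln x))).
  by move=> x _; rewrite mulr0 addr0 add0r.
apply: (@sqcone_of_derive _ (fun=> 0) (fun=> 0)) => //.
- exact: cvg_cst.
- by move=> z z01; rewrite normr0 mul0r.
- move=> x /andP[x0 x1]; rewrite normr0 divr_ge0 ?(ltW x0)// mulr_ge0//.
  by apply: le_trans (ge1_1Bln _) => //; rewrite x0 ltW.
Qed.

Lemma iter_transfer_ext a r1 r2 m v : 0 < a -> 0 <= v <= 1 ->
  (forall z, 0 <= z <= 1 -> r1 z = r2 z) ->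
  iter m (transfer a) r1 v = iter m (transfer a) r2 v.
Proof.
move=> a0 + e; elim: m v => [|m IH] v v01 /=; first exact: e.
by apply: transfer_ext => // z /in01W; exact: IH.
Qed.

(** Difference quotients in the parameter of [kfix] and [rhoh], and partial sums
    of the Neumann series of [transfer]. *)
Definition kquot b c v : R := (kfix b v - kfix c v) / (b - c).
Definition rquot b c x : R := (rhoh b x - rhoh c x) / (b - c).
Definition resolvent a r N v : R := \sum_(m < N) iter m (transfer a) r v.

(** A bound of the two functions of the cone whose difference is the source of the
    perturbation equation. *)
Definition mbnd : R := 48 * (qbnd + qcone).

Section Quotient.
Variables (b c : R).
Hypotheses (c0 : 0 < c) (cb : c < b) (b1 : b < 1).

Let q := qquot (rhoh c) b c.
Let Q := transfer b q.
Let c01 : 0 < c < 1. Proof. by rewrite c0/=; exact: lt_trans cb b1. Qed.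
Let b01 : 0 < b < 1. Proof. by rewrite b1 andbT; exact: lt_trans c0 cb. Qed.
Let bc : b - c != 0. Proof. by rewrite gt_eqF// subr_gt0. Qed.

Lemma rquot_sumS x : 0 < x <= 1 -> rquot b c x = sumS b (kquot b c) x + sumS b q x.
Proof.
move=> x01; rewrite /rquot (rhoh_change_branch c0 cb b1 x01).
have -> : rhoh b x = sumS b (kfix b) x by [].
have h := sumS_lin (-1) b01 x01 (kfix_log b01) (kfix_log c01).
have hl := log_bounded_lin (-1) (kfix_log b01) (kfix_log c01).
have l0 : log_bounded 0 (fun=> 0 : R) by move=> z _; rewrite normr0 mul0r.
have e : sumS b (kquot b c) x = (sumS b (kfix b) x - sumS b (kfix c) x) / (b - c).
  have h' := sumS_lin ((b - c)^-1) b01 x01 l0 hl.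
  have z0 : sumS b (fun=> 0 : R) x = 0.
    by apply/eqP; rewrite -normr_le0; have := sumS_log_bound b01 x01 l0; rewrite mulr0 mul0r.
  rewrite z0 add0r h mulN1r in h'; rewrite [RHS]mulrC -h'.
  by apply: sumS_ext => // [|z _]; [case/andP: b01 | rewrite /kquot add0r mulN1r mulrC].
rewrite e -/q; move: (sumS b (kfix b) x) (sumS b (kfix c) x) (sumS b q x) => X Y Z.
by field.
Qed.

Lemma kquot_rquot v : 0 <= v <= 1 -> kquot b c v = 2^-1 * rquot b c ((1 + v) / 2).
Proof.
move=> v01; rewrite /kquot (kfix_rhoh b01 v01) (kfix_rhoh c01 v01) /rquot.
by rewrite -mulrBr mulrA.
Qed.

(** The perturbation equation: the difference quotient is a fixed point of the
    operator up to the source [Q], which is the effect of the left branch. *)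
Lemma kquot_eq v : 0 <= v <= 1 -> kquot b c v = transfer b (kquot b c) v + Q v.
Proof.
move=> v01; rewrite kquot_rquot// rquot_sumS; last exact: half01.
by rewrite mulrDr.
Qed.

Lemma transfer_qquotE v : 0 <= v <= 1 ->
  Q v = (transfer b (kfix c) v - kfix c v) / (b - c).
Proof.
move=> v01; rewrite (kfix_rhoh c01 v01) (rhoh_change_branch c0 cb b1 (half01 v01)).
rewrite /Q /transfer -/q; move: (sumS b (kfix c) _) (sumS b q _) => X Y.
by field.
Qed.

(** The source is the difference of two functions of the cone. It has mass 0,
    because [transfer b] preserves the mass of [kfix c]; hence the two functions
    have the same mass and the operator contracts their difference. *)
Lemma iter_transfer_qquot_le m v : 0 <= v <= 1 ->
  `|iter m (transfer b) Q v| <= 16 * mbnd * (7 / 8) ^+ m.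
Proof.
have [ql qC] := rhoh_qquot c0 cb b1; rewrite -/q in ql qC.
pose A x := q x + qcone * (1 - ln x).
pose B x : R := qcone * (1 - ln x).
have lbl : log_bounded qcone B.
  move=> z z01; rewrite ger0_norm// mulr_ge0 ?qcone_ge0//.
  by apply: le_trans (ge1_1Bln z01).
have Al : log_bounded (qbnd + qcone) A.
  by move=> z z01; rewrite mulrDl; apply: le_trans (ler_normD _ _) _; rewrite lerD ?ql ?lbl.
have BC : sqcone B by apply: sqcone_lb; exact: qcone_ge0.
have QA : pcone 2 (transfer b A) by apply: pcone_half; exact: sqcone_sumS b01 Al qC.
have QB : pcone 2 (transfer b B) by apply: pcone_half; exact: sqcone_sumS b01 lbl BC.
have QE v' : 0 <= v' <= 1 -> Q v' = transfer b A v' + -1 * transfer b B v'.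
  move=> v01; rewrite -(transfer_lin (-1) b01 v01 Al lbl) /Q.
  by congr transfer; apply/funext => z; rewrite /A /B; ring.
have mAB : mass (transfer b A) = mass (transfer b B).
  have LA := pcone_lip (pcone24 QA); have LB := pcone_lip (pcone24 QB).
  have Lk := pcone_lip (pcone4_kfix c01).
  have Ltk := pcone_lip (pcone24 (pcone_transfer b01 (pcone4_kfix c01))).
  have e := mass_lin (-1) LA LB; have e' := mass_lin (-1) Ltk Lk.
  have L1 := lip01_lin (-1) LA LB; have L2 := lip01_lin (-1) Ltk Lk.
  have h := mass_lin ((b - c)^-1) (lip01_cst (0 : R)) L2.
  rewrite mass_cst e' (mass_transfer b01 (pcone4_kfix c01)) in h.
  have : mass (fun x => transfer b A x + -1 * transfer b B x) = 0.
    rewrite (mass_ext L1 (lip01_lin ((b - c)^-1) (lip01_cst (0 : R)) L2)).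
      by rewrite h; ring.
    by move=> x x01; rewrite -QE// transfer_qquotE//; ring.
  by rewrite e mulN1r => /subr0_eq.
move=> v01.
have bA z : 0 <= z <= 1 -> `|transfer b A z| <= mbnd.
  by move=> z01; exact: transfer_log_bound.
have bB z : 0 <= z <= 1 -> `|transfer b B z| <= 2 ^+ 2 * transfer b B 0.
  by move=> z01; exact: pcone_bounded.
have -> : iter m (transfer b) Q v =
    iter m (transfer b) (transfer b A) v - iter m (transfer b) (transfer b B) v.
  rewrite -mulN1r -(iter_transfer_lin (-1) m b01 v01 bA bB).
  by apply: iter_transfer_ext => //; case/andP: b01.
apply: le_trans (transfer_contraction m b01 (pcone24 QA) (pcone24 QB) erefl (esym mAB) v01) _.
apply: ler_wpM2r; first by rewrite exprn_ge0// divr_ge0.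
apply: ler_wpM2l => //.
have [z z01 ->] := mass_mean (pcone_lip (pcone24 QA)).
exact: le_trans (ler_norm _) (bA _ z01).
Qed.

Lemma kquot_bounded v : 0 <= v <= 1 -> `|kquot b c v| <= 8 / (b - c).
Proof.
move=> v01; rewrite /kquot normrM [X in _ * X]gtr0_norm ?invr_gt0 ?subr_gt0//.
apply: ler_wpM2r; first by rewrite invr_ge0 subr_ge0 ltW.
have /andP[h1 h2] := kfix_bounds b01 v01; have /andP[h3 h4] := kfix_bounds c01 v01.
by apply: le_trans (ler_normB _ _) _; rewrite !ger0_norm; lra.
Qed.

Lemma transfer_qquot_bounded v : 0 <= v <= 1 -> `|Q v| <= 48 * qbnd.
Proof.
by move=> v01; apply: transfer_log_bound => //; have [] := rhoh_qquot c0 cb b1.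
Qed.

Lemma kquot_resolvent N v : 0 <= v <= 1 ->
  kquot b c v = resolvent b Q N v + iter N (transfer b) (kquot b c) v.
Proof.
move=> v01; have b0 : 0 < b by case/andP: b01.
elim: N => [|N IH]; first by rewrite /resolvent big_ord0 add0r.
rewrite [LHS]IH /resolvent big_ord_recr/= -addrA; congr (_ + _).
have tb z : 0 <= z <= 1 -> `|transfer b (kquot b c) z| <= 6 * (8 / (b - c)).
  by move=> z01; apply: transfer_bound => // w /in01W; exact: kquot_bounded.
rewrite (@iter_transfer_ext b _ (fun z => transfer b (kquot b c) z + 1 * Q z))//.
  rewrite (iter_transfer_lin 1 N b01 v01 tb transfer_qquot_bounded) mul1r addrC.
  by rewrite -iterSr.
by move=> z z01; rewrite mul1r; exact: kquot_eq.
Qed.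

Lemma iter_kquot_cvg0 v : 0 <= v <= 1 ->
  iter N (transfer b) (kquot b c) v @[N --> \oo] --> (0 : R).
Proof.
move=> v01; have b0 : 0 < b by case/andP: b01.
apply: (@cvgn_dist _ _ (fun N => 16 / (b - c) * (7 / 8) ^+ N)); last exact: cvg_geometric78.
move=> N; rewrite subr0.
have bk a z : 0 < a < 1 -> 0 <= z <= 1 -> `|kfix a z| <= 4.
  by move=> a01 z01; have /andP[? ?] := kfix_bounds a01 z01; rewrite ger0_norm; lra.
have l0 z : 0 <= z <= 1 -> `|(fun=> 0 : R) z| <= 0 by rewrite normr0.
have e1 := iter_transfer_lin (-1) N b01 v01 (fun z => bk b z b01) (fun z => bk c z c01).
have e2 := iter_transfer_lin (b - c) N b01 v01 l0 kquot_bounded.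
have z0 : iter N (transfer b) (fun=> 0 : R) v = 0.
  by apply/eqP; rewrite -normr_le0; have := iter_transfer_bound N b01 v01 l0; rewrite mulr0.
have e3 : iter N (transfer b) (fun z => kfix b z + -1 * kfix c z) v =
    iter N (transfer b) (fun z => 0 + (b - c) * kquot b c z) v.
  by apply: iter_transfer_ext => // z _; rewrite /kquot add0r mulN1r mulrC divfK.
rewrite e1 e2 z0 add0r mulN1r in e3.
have h := transfer_contraction N b01 (pcone4_kfix b01) (pcone4_kfix c01)
  (mass_kfix b01) (mass_kfix c01) v01.
rewrite e3 mulr1 normrM (gtr0_norm (_ : 0 < b - c)) ?subr_gt0// in h.
by rewrite mulrAC ler_pdivlMr ?subr_gt0// mulrC.
Qed.

End Quotient.

Lemma resolvent_tail a r M v N N' :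
  (forall m, `|iter m (transfer a) r v| <= 16 * M * (7 / 8) ^+ m) -> (N <= N')%N ->
  `|resolvent a r N' v - resolvent a r N v| <= 128 * M * (7 / 8) ^+ N.
Proof.
move=> h NN'.
have M0 : 0 <= M by have := le_trans (normr_ge0 _) (h 0%N); rewrite expr0 mulr1; lra.
rewrite -(subnKC NN'); move: (N' - N)%N => j.
suff : `|resolvent a r (N + j) v - resolvent a r N v| <=
    128 * M * ((7 / 8) ^+ N - (7 / 8) ^+ (N + j)).
  move/le_trans; apply; rewrite ler_wpM2l ?mulr_ge0 ?ler0n//.
  by rewrite gerBl exprn_ge0// divr_ge0.
elim: j => [|j IH]; first by rewrite addn0 !subrr normr0 mulr0.
rewrite addnS [resolvent _ _ _.+1 _]big_ord_recr/= -/(resolvent a r (N + j) v) addrAC.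
apply: le_trans (ler_normD _ _) _; apply: le_trans (lerD IH (h _)) _.
rewrite exprS; set X := (7 / 8) ^+ N; set Y := (7 / 8) ^+ (N + j).
by rewrite le_eqVlt; apply/orP; left; apply/eqP; field.
Qed.

Lemma kquot_approx b c N v : 0 < c -> c < b -> b < 1 -> 0 <= v <= 1 ->
  `|kquot b c v - resolvent b (transfer b (qquot (rhoh c) b c)) N v| <=
    128 * mbnd * (7 / 8) ^+ N.
Proof.
move=> c0 cb b1 v01; set Q := transfer b _.
have c1 : resolvent b Q n v @[n --> \oo] --> kquot b c v.
  have -> : (fun n => resolvent b Q n v) =
      fun n => kquot b c v - iter n (transfer b) (kquot b c) v.
    by apply/funext => n; rewrite [X in X - _](kquot_resolvent c0 cb b1 n v01) addrK.
  rewrite -[X in _ --> X]subr0; apply: cvgB; first exact: cvg_cst.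
  exact: iter_kquot_cvg0.
have c2 : `|resolvent b Q n v - resolvent b Q N v| @[n --> \oo] -->
    `|kquot b c v - resolvent b Q N v|.
  by apply: cvg_norm; apply: cvgB c1 _; exact: cvg_cst.
apply: (limn_le_near c2); exists N => // n /= Nn.
by apply: resolvent_tail Nn => m; exact: iter_transfer_qquot_le.
Qed.

(** The derivatives of [kfix] and [rhoh] with respect to the parameter: the
    response of the branches is summed over all the returns. *)
Definition dq a x : R := dpush a (rhoh a) (drhoh_dx a) (ginv a x).
Definition dkfix a v : R := limn (fun N => resolvent a (transfer a (dq a)) N v).
Definition drhoh_da a : R -> R := sumS a (fun x => dkfix a x + dq a x).

Section QuotientLimit.
Variables (be ga : nat -> R) (a b : R).
Hypotheses (ga0 : forall n, 0 < ga n) (gabe : forall n, ga n < be n).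
Hypotheses (beb : forall n, be n <= b) (b1 : b < 1) (a0 : 0 < a).
Hypotheses (bea : be n @[n --> \oo] --> a) (gaa : ga n @[n --> \oo] --> a).

Let q n := qquot (rhoh (ga n)) (be n) (ga n).
Let be0b n : 0 < be n <= b.
Proof. by rewrite beb andbT; exact: lt_trans (ga0 n) (gabe n). Qed.
Let be1 n : be n < 1. Proof. exact: le_lt_trans (beb n) b1. Qed.
Let be01 n : 0 < be n < 1. Proof. by rewrite be1 andbT; case/andP: (be0b n). Qed.

Let q_log n : log_bounded qbnd (q n).
Proof. by have [] := rhoh_qquot (ga0 n) (gabe n) (be1 n). Qed.

Let q_cont : cont_cvg q (dq a).
Proof. exact: (qquot_cont ga0 gabe beb b1 a0 bea gaa). Qed.

Let Q_cont : cont_cvg (fun n => transfer (be n) (q n)) (transfer a (dq a)).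
Proof. exact: (transfer_cont be0b b1 a0 bea q_cont q_log). Qed.

Let res_cont N : cont_cvg (fun n => resolvent (be n) (transfer (be n) (q n)) N)
  (resolvent a (transfer a (dq a)) N).
Proof.
elim: N => [|N IH] u x u01 x01 ux.
  rewrite /resolvent big_ord0; under eq_fun do rewrite big_ord0.
  exact: cvg_cst.
rewrite /resolvent big_ord_recr/=; under eq_fun do rewrite big_ord_recr/=.
apply: cvgD; first exact: IH.
have bd n z : 0 <= z <= 1 -> `|transfer (be n) (q n) z| <= 48 * qbnd.
  by move=> z01; exact: transfer_log_bound.
exact: (@iter_transfer_cont _ be a b be0b b1 a0 bea _ _ _ N Q_cont bd).
Qed.

Let dk_approx x N : 0 < x <= 1 ->
  `|dkfix a x - resolvent a (transfer a (dq a)) N x| <= 128 * mbnd * (7 / 8) ^+ N.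
Proof.
move=> x01.
have [||_ h] := @limn_dist _ (fun N => resolvent a (transfer a (dq a)) N x)
  (fun N => 128 * mbnd * (7 / 8) ^+ N).
- move=> n m nm.
  have c : `|resolvent (be k) (transfer (be k) (q k)) m x -
      resolvent (be k) (transfer (be k) (q k)) n x| @[k --> \oo] -->
      `|resolvent a (transfer a (dq a)) m x - resolvent a (transfer a (dq a)) n x|.
    have h1 := cont_cvg_pt (@res_cont m) x01.
    have h2 := cont_cvg_pt (@res_cont n) x01.
    by apply: cvg_norm; exact: (cvgB h1 h2).
  apply: (limn_le_cst c) => k; apply: resolvent_tail nm => j.
  by apply: iter_transfer_qquot_le => //; exact: in01W.
- exact: cvg_geometric78.
- exact: h.
Qed.

Lemma kquot_cont : cont_cvg (fun n => kquot (be n) (ga n)) (dkfix a).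
Proof.
move=> u x u01 x01 ux.
apply: (@cvgn_uniform_approx _ _
  (fun M n => resolvent (be n) (transfer (be n) (q n)) M (u n))
  (fun M => resolvent a (transfer a (dq a)) M x) (fun M => 128 * mbnd * (7 / 8) ^+ M)).
- by move=> M; exact: res_cont.
- by move=> M; apply: nearW => n; apply: kquot_approx => //; exact: in01W.
- by move=> M; exact: dk_approx.
- exact: cvg_geometric78.
Qed.

Definition dbnd : R := 128 * mbnd + qbnd.

Lemma kquot_log n : log_bounded (128 * mbnd) (kquot (be n) (ga n)).
Proof.
apply: bounded_log => z /in01W z01.
have := kquot_approx 0 (ga0 n) (gabe n) (be1 n) z01.
by rewrite /resolvent big_ord0 subr0 expr0 mulr1.
Qed.

(** Strict differentiability: the quotients converge when both parameters and the
    point move. *)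
Lemma rquot_cont : cont_cvg (fun n => rquot (be n) (ga n)) (drhoh_da a).
Proof.
have c1 : cont_cvg (fun n z => kquot (be n) (ga n) z + q n z)
    (fun z => dkfix a z + dq a z).
  by move=> u x u01 x01 ux; apply: cvgD; [exact: kquot_cont | exact: q_cont].
have l1 n : log_bounded dbnd (fun z => kquot (be n) (ga n) z + q n z).
  move=> z z01; rewrite mulrDl; apply: le_trans (ler_normD _ _) _.
  by rewrite lerD ?kquot_log ?q_log.
move=> u x u01 x01 ux.
have -> : (fun n => rquot (be n) (ga n) (u n)) =
    fun n => sumS (be n) (fun z => kquot (be n) (ga n) z + q n z) (u n).
  apply/funext => n; rewrite (rquot_sumS (ga0 n) (gabe n) (be1 n) (u01 n)).
  have := sumS_lin 1 (be01 n) (u01 n) (@kquot_log n) (@q_log n).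
  rewrite mul1r => <-; apply: sumS_ext => // [|z _]; last by rewrite mul1r.
  by case/andP: (be01 n).
exact: (sumS_cont be0b b1 a0 bea c1 l1).
Qed.

Lemma dk_dq_log : log_bounded dbnd (fun z => dkfix a z + dq a z).
Proof.
apply: (@cont_cvg_bound _ (fun n z => kquot (be n) (ga n) z + q n z)).
  by move=> u x u01 x01 ux; apply: cvgD; [exact: kquot_cont | exact: q_cont].
move=> n z z01; rewrite mulrDl; apply: le_trans (ler_normD _ _) _.
by rewrite lerD ?kquot_log ?q_log.
Qed.

End QuotientLimit.

Lemma rquotC b c x : rquot b c x = rquot c b x.
Proof.
rewrite /rquot; move: (rhoh b x) (rhoh c x) => X Y.
by rewrite -(opprB Y X) -(opprB c b) invrN mulrNN.
Qed.

Lemma drhoh_da_bound a x : 0 < a < 1 -> 0 < x <= 1 ->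
  `|drhoh_da a x| <= 24 * dbnd * (x `^ (- a) * (1 - ln x)).
Proof.
move=> a01 x01; have /andP[a0 a1] := a01.
have hr := @harmonic01 R.
pose h n : R := (1 - a) / 2 * harmonic n.
have h0 n : 0 < h n <= (1 - a) / 2.
  have /andP[p1 p2] := hr n.
  by rewrite /h mulr_gt0//=; [rewrite ler_piMr//|]; lra.
apply: sumS_log_bound => //.
apply: (@dk_dq_log (fun n => a + h n) (fun=> a) a ((1 + a) / 2)) => //.
- by move=> n; rewrite ltrDl; case/andP: (h0 n).
- by move=> n; have /andP[p1 p2] := h0 n; lra.
- by lra.
- rewrite -[X in _ --> X]addr0; apply: cvgD; first exact: cvg_cst.
  rewrite /h -(mulr0 ((1 - a) / 2)); apply: cvgM; [exact: cvg_cst | exact: cvg_harmonic].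
- exact: cvg_cst.
Qed.

(** The quotients between [a] and the terms of a sequence are instances of
    [rquot_cont], once each pair of parameters is put in order. *)
Lemma is_derive_rhoh_da a x : 0 < a < 1 -> 0 < x <= 1 ->
  is_derive a 1 (fun t => rhoh t x) (drhoh_da a x).
Proof.
move=> a01 x01; have /andP[a0 a1] := a01.
apply: slope_is_derive => u ua uc.
pose b := (1 + a) / 2.
have b1 : b < 1 by rewrite /b; lra.
have ab : a < b by rewrite /b; lra.
have [N _ NP] : \forall n \near \oo, 0 < u n < b.
  near=> n; apply/andP; split; first by near: n; apply: (cvgr_gt a uc).
  by near: n; apply: (cvgr_lt a uc).
rewrite -(cvg_shiftn N).
pose w n := u (n + N)%N.
have wc : w n @[n --> \oo] --> a by rewrite (cvg_shiftn N).
have w0b n : 0 < w n < b by apply: NP; exact: leq_addl.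
have wa n : w n != a by exact: ua.
pose be n := Num.max (w n) a; pose ga n := Num.min (w n) a.
have e n : (rhoh (w n) x - rhoh a x) / (w n - a) = rquot (be n) (ga n) x.
  rewrite /be /ga; have [wl|wl] := leP (w n) a.
    by rewrite rquotC.
  by [].
rewrite (_ : (fun n => _) = fun n => rquot (be n) (ga n) x); last first.
  by apply/funext => n; exact: e.
suff cc : cont_cvg (fun n => rquot (be n) (ga n)) (drhoh_da a) by exact: (cont_cvg_pt cc x01).
apply: (@rquot_cont be ga a b) => //.
- by move=> n; rewrite lt_min a0 andbT; case/andP: (w0b n).
- move=> n; rewrite /be /ga; have := wa n; have [//|//|-> /eqP//] := ltgtP (w n) a.
- by move=> n; rewrite ge_max (ltW ab) andbT ltW//; case/andP: (w0b n).
- apply: (@cvgn_dist _ _ (fun n => `|w n - a|)).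
    by move=> n; rewrite /be; have [_|_] := leP (w n) a; rewrite ?subrr ?normr0.
  by apply: cvgn_normB0.
- apply: (@cvgn_dist _ _ (fun n => `|w n - a|)).
    by move=> n; rewrite /ga; have [_|_] := leP (w n) a; rewrite ?subrr ?normr0.
  by apply: cvgn_normB0.
Unshelve. all: end_near. Qed.

(** A limit of difference quotients with both ends moving is continuous. *)
Lemma drhoh_da_cont (al : nat -> R) a : (forall n, 0 < al n < 1) -> 0 < a < 1 ->
  al n @[n --> \oo] --> a -> cont_cvg (fun n => drhoh_da (al n)) (drhoh_da a).
Proof.
move=> al01 a01 ala u x u01 x01 ux; have /andP[a0 a1] := a01.
have hr := @harmonic01 R.
have /choice[be beP] : forall n, exists b, [/\ al n < b, b <= al n + (1 - al n) / 2 * harmonic n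
    & `|drhoh_da (al n) (u n) - rquot b (al n) (u n)| <= harmonic n].
  move=> n; have /andP[c0 c1] := al01 n.
  pose h k : R := (1 - al n) / 2 * harmonic k.
  have h0 k : 0 < h k <= (1 - al n) / 2.
    have /andP[p1 p2] := hr k.
    by rewrite /h mulr_gt0//=; [rewrite ler_piMr//|]; lra.
  have hc : rquot (al n + h k) (al n) (u n) @[k --> \oo] --> drhoh_da (al n) (u n).
    suff cc : cont_cvg (fun k => rquot (al n + h k) (al n)) (drhoh_da (al n)).
      exact: (cont_cvg_pt cc (u01 n)).
    apply: (@rquot_cont (fun k => al n + h k) (fun=> al n) (al n) ((1 + al n) / 2)) => //.
    - by move=> k; rewrite ltrDl; case/andP: (h0 k).
    - by move=> k; have /andP[p1 p2] := h0 k; lra.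
    - by lra.
    - rewrite -[X in _ --> X]addr0; apply: cvgD; first exact: cvg_cst.
      rewrite /h -(mulr0 ((1 - al n) / 2)); apply: cvgM; [exact: cvg_cst | exact: cvg_harmonic].
    - exact: cvg_cst.
  have /andP[hn0 _] := hr n.
  have [K _ KP] : \forall k \near \oo,
      `|drhoh_da (al n) (u n) - rquot (al n + h k) (al n) (u n)| <= harmonic n.
    by move/cvgrPdist_le : hc; apply.
  exists (al n + h (maxn K n)); split.
  - by rewrite ltrDl; case/andP: (h0 (maxn K n)).
  - rewrite lerD2l /h ler_wpM2l//; first by lra.
    by rewrite /harmonic lef_pV2 ?posrE ?ltr0n// ler_nat ltnS leq_maxr.
  - by apply: KP; exact: leq_maxl.
pose b := (3 + a) / 4.
have hc0 : (harmonic : nat -> R) n @[n --> \oo] --> (0 : R) by exact: cvg_harmonic.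
have bea : be n @[n --> \oo] --> a.
  apply: (@cvgn_dist _ _ (fun n => harmonic n + `|al n - a|)).
    move=> n; have [b1 b2 _] := beP n; have /andP[p1 p2] := hr n; have /andP[c0 c1] := al01 n.
    rewrite -(subrKA (al n)) (le_trans (ler_normD _ _))// lerD2r.
    rewrite ger0_norm; last by rewrite subr_ge0 ltW.
    have : (1 - al n) / 2 * harmonic n <= harmonic n by rewrite ler_piMl// ?ltW//; lra.
    by lra.
  rewrite -[X in _ --> X]addr0; apply: cvgD => //.
  by apply: cvgn_normB0.
have [N _ NP] : \forall n \near \oo, be n <= b.
  by apply: (cvgr_le a bea); rewrite /b; lra.
have sh (w : nat -> R) l : w n @[n --> \oo] --> l -> w (n + N)%N @[n --> \oo] --> l.
  by rewrite (cvg_shiftn N w).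
have rc : rquot (be n) (al n) (u n) @[n --> \oo] --> drhoh_da a x.
  rewrite -(cvg_shiftn N).
  apply: (@rquot_cont (fun n => be (n + N)%N) (fun n => al (n + N)%N) a b _ _ _ _ _ _ _
    (fun n => u (n + N)%N)) => //.
  - by move=> n; case/andP: (al01 (n + N)%N).
  - by move=> n; have [] := beP (n + N)%N.
  - by move=> n; apply: NP; exact: leq_addl.
  - by rewrite /b; lra.
  - exact: sh.
  - exact: sh.
  - exact: sh.
have d0 : drhoh_da (al n) (u n) - rquot (be n) (al n) (u n) @[n --> \oo] --> (0 : R).
  apply: (@cvgn_dist _ _ harmonic) => // n; rewrite subr0.
  by have [] := beP n.
have -> : (fun n => drhoh_da (al n) (u n)) = fun n =>
    (drhoh_da (al n) (u n) - rquot (be n) (al n) (u n)) + rquot (be n) (al n) (u n).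
  by apply/funext => n; rewrite subrK.
by rewrite -[X in _ --> X]add0r; exact: cvgD.
Qed.

End StrictDerivative.

(** * Integrability of the weights *)

Section seq_continuity.
Context {R : realType}.

Lemma seq_within_continuous (T : pseudoMetricType R) (A : set T) (f : T -> R) :
  (forall (u : nat -> T) x, (forall n, A (u n)) -> A x ->
     u n @[n --> \oo] --> x -> f (u n) @[n --> \oo] --> f x) ->
  {within A, continuous f}.
Proof.
move=> H; apply/subspace_continuousP => x Ax; apply/cvgrPdist_lt => e e0.
rewrite near_withinE; apply: contrapT => Hn.
have /choice[u uP] : forall n : nat, exists y, [/\ ball x n.+1%:R^-1 y, A y & e <= `|f x - f y|].
  move=> n; apply: contrapT => Hy; apply: Hn.
  have n0 : 0 < n.+1%:R^-1 :> R by rewrite invr_gt0.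
  near=> y => Ay; rewrite ltNge; apply/negP => ey; apply: Hy; exists y; split=> //.
  by near: y; exact: nbhsx_ballx.
have ux : u n @[n --> \oo] --> x.
  apply/cvg_ballP => d d0.
  near=> n.
  have [bn _ _] := uP n; apply: le_ball bn; apply: ltW.
  by near: n; exact: near_infty_natSinv_lt (PosNum d0).
have := H u x (fun n => let: And3 _ a _ := uP n in a) Ax ux.
move=> /cvgrPdist_lt/(_ e e0)[N _ /(_ N (leqnn N))] /=.
by have [_ _] := uP N; rewrite leNgt => /negP.
Unshelve. all: by end_near. Qed.
End seq_continuity.

Section weights.
Context {R : realType}.
Local Notation mu := (@lebesgue_measure R).
Local Notation I01 := (`]0, 1]%classic : set (measurableTypeR R)).
Implicit Types s x : R.

Lemma continuous_powR_gt0 s : {in `]0, +oo[%R, continuous (fun x => x `^ s)}.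
Proof.
move=> x; rewrite in_itv/= andbT => x0.
have d := is_derive1_powR s x0.
apply: differentiable_continuous; apply/derivable1_diffP.
exact: ex_derive.
Qed.

Lemma bigcup_shrink :
  \bigcup_n (`[n.+2%:R^-1, 1]%classic : set R) = (`]0, 1]%classic : set R).
Proof.
apply/seteqP; split => x /=.
  move=> [n _] /=; rewrite !in_itv/= => /andP[nx ->].
  by rewrite (lt_le_trans _ nx)// invr_gt0.
rewrite in_itv/= => /andP[x0 x1].
have [N _ /(_ N (leqnn N)) /= Nx] := near_infty_natSinv_lt (PosNum x0).
exists N => //=; rewrite in_itv/= x1 andbT (le_trans _ (ltW Nx))//.
by rewrite lef_pV2 ?posrE// ler_nat.
Qed.

(** The integrals over the intervals from [n.+2%:R^-1] to 1 are bounded, by an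
    explicit primitive. *)
Lemma integrable_powRN s : 0 < s < 1 ->
  mu.-integrable I01 (fun x => (x `^ (- s))%:E).
Proof.
move=> /andP[s0 s1]; apply/integrableP; split.
  by apply/measurable_EFinP; apply: measurable_funTS.
have -> : (\int[mu]_(x in I01) `|(x `^ (- s))%:E| =
    \int[mu]_(x in \bigcup_n (`[(n.+2%:R^-1 : R)%R, 1%R]%classic)) (x `^ (- s))%:E)%E.
  rewrite bigcup_shrink; apply: eq_integral => x _.
  by rewrite gee0_abs// lee_fin powR_ge0.
apply: (@le_lt_trans _ _ ((1 - s)^-1)%:E); last by rewrite ltry.
have nd : nondecreasing_seq (fun n => `[n.+2%:R^-1, 1]%classic : set (measurableTypeR R)).
  move=> m n mn; rewrite subsetEset => x /=; rewrite !in_itv/= => /andP[mx ->].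
  by rewrite andbT (le_trans _ mx)// lef_pV2 ?posrE// ler_nat !ltnS.
have := @ge0_nondecreasing_set_cvg_integral _ (measurableTypeR R) R
  (fun n => `[n.+2%:R^-1, 1]%classic : set (measurableTypeR R))
  (fun x : R => (x `^ (- s))%:E) mu nd (fun n => measurable_itv _).
have mp i : measurable_fun (`[i.+2%:R^-1, 1]%classic : set (measurableTypeR R)) (fun x : R => (x `^ (- s))%:E).
  by apply/measurable_EFinP; apply: measurable_funTS.
move=> /(_ mp) /(_ (fun _ _ _ => powR_ge0 _ _)) cv.
rewrite -(cvg_lim _ cv)//; apply: lime_le; first by apply/cvg_ex; eexists; exact: cv.
near=> n.
have n0 : 0 < n.+2%:R^-1 :> R by rewrite invr_gt0.
have n1 : n.+2%:R^-1 < 1 :> R by rewrite invf_lt1// ltr1n.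
have ss : (1 - s) != 0 by rewrite subr_eq0 gt_eqF.
rewrite (@continuous_FTC2 _ _ (fun x => (1 - s)^-1 * x `^ (1 - s)))//.
- rewrite powR1 mulr1 lee_fin lerBlDr lerDl mulr_ge0 ?powR_ge0// invr_ge0.
  by rewrite subr_ge0 ltW.
- apply: continuous_in_subspaceT => x; rewrite inE/= in_itv/= => /andP[nx _].
  by apply: continuous_powR_gt0; rewrite in_itv/= andbT (lt_le_trans n0).
- have dp x : 0 < x -> derivable (fun x => (1 - s)^-1 * x `^ (1 - s)) x 1.
    move=> x0; have d := is_derive1_powR (1 - s) x0.
    by apply: derivableM => //; exact: ex_derive.
  have cp x : 0 < x -> {for x, continuous (fun x => (1 - s)^-1 * x `^ (1 - s))}.
    by move=> x0; apply: differentiable_continuous; apply/derivable1_diffP; exact: dp.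
  split.
  + by move=> x; rewrite in_itv/= => /andP[nx _]; apply: dp; rewrite (lt_trans n0).
  + by apply: cvg_at_right_filter; exact: cp.
  + by apply: cvg_at_left_filter; exact: cp.
- move=> x; rewrite in_itv/= => /andP[nx _].
  have x0 := lt_trans n0 nx; have d := is_derive1_powR (1 - s) x0.
  rewrite derive1E; apply: derive_val.
  apply: is_derive_eq; rewrite /GRing.scale/= ?mulr0 ?addr0 mulrA mulVf// mul1r.
  by congr (_ `^ _); ring.
Unshelve. all: by end_near. Qed.

(** A logarithm costs an arbitrarily small power. *)
Lemma log_powR_le s t x : 0 < s < t -> 0 < x <= 1 ->
  x `^ (- s) * (1 - ln x) <= (1 + (t - s)^-1) * x `^ (- t).
Proof.
move=> /andP[s0 st] /andP[x0 x1].
have -> : x `^ (- t) = x `^ (- s) * x `^ (s - t).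
  by rewrite -powRD ?(gt_eqF x0) ?implybT//; congr (_ `^ _); ring.
rewrite [leRHS]mulrC -mulrA ler_wpM2l ?powR_ge0//.
have d0 : 0 < t - s by rewrite subr_gt0.
have l0 : ln x <= 0 by rewrite ln_le0.
rewrite powR_expR// (mulrC (expR _)).
have e1 := expR_ge1Dx ((s - t) * ln x).
have e2 : 1 <= expR ((s - t) * ln x).
  rewrite -expR0 ler_expR; nra.
have e3 : - ln x <= (t - s)^-1 * expR ((s - t) * ln x).
  by rewrite -ler_pdivrMl ?invr_gt0// invrK; lra.
rewrite mulrDl mul1r; lra.
Qed.

Lemma integrable_powR_ln s : 0 < s < 1 ->
  mu.-integrable I01 (fun x => (x `^ (- s) * (1 - ln x))%:E).
Proof.
move=> /andP[s0 s1]; pose t := (1 + s) / 2.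
have st : 0 < s < t by rewrite /t; lra.
have t01 : 0 < t < 1 by rewrite /t; lra.
apply: (@le_integrable _ _ _ mu I01 _ _ (fun x => ((1 + (t - s)^-1) * x `^ (- t))%:E)) => //.
- apply/measurable_EFinP; apply: measurable_funTS; apply: measurable_funM => //.
  exact: measurable_funB.
- move=> x; rewrite /= in_itv/= => x01; rewrite lee_fin.
  have lx : ln x <= 0 by case/andP: x01 => *; rewrite ln_le0.
  rewrite ger0_norm; last by rewrite mulr_ge0 ?powR_ge0// subr_ge0; lra.
  exact: le_trans (log_powR_le st x01) (ler_norm _).
- have -> : (fun x : R => ((1 + (t - s)^-1) * x `^ (- t))%:E) =
    (fun x : R => ((1 + (t - s)^-1)%:E * (x `^ (- t))%:E)%E) by apply/funext => x; rewrite EFinM.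
  by apply: integrableZl => //; exact: integrable_powRN.
Qed.

End weights.

(** * From the equation of invariance to an invariant measure *)

Section acip_of_density.
Context {R : realType}.
Local Notation mu := (@lebesgue_measure R).
Local Notation I01 := (`]0, 1]%classic : set (measurableTypeR R)).
Implicit Types (f : R -> R) (a x t : R).

Lemma probability_of_density f : (forall x, 0 <= f x) ->
  mu.-integrable setT (EFin \o f) -> (\int[mu]_x (f x)%:E = 1)%E ->
  exists P : probability (measurableTypeR R) R,
    forall A : set (measurableTypeR R), P A = (\int[mu]_(x in A) (f x)%:E)%E.
Proof.
move=> f0 fi f1.
pose m (A : set (measurableTypeR R)) := (\int[mu]_(x in A) (f x)%:E)%E.
have m0 : m set0 = 0%E by rewrite /m integral_set0.
have m_ge0 A : (0 <= m A)%E by apply: integral_ge0 => x _; rewrite lee_fin.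
have m_add : semi_sigma_additive m.
  move=> A mA tA mUA; rewrite /m integral_bigcup//=; last exact: (integrableS measurableT).
  apply: is_cvg_ereal_nneg_natsum_cond => n _ _.
  by apply: integral_ge0 => x _; rewrite lee_fin.
pose mM := isMeasure.Build _ _ _ m m0 m_ge0 m_add.
pose m' : {measure set (measurableTypeR R) -> \bar R} := HB.pack m mM.
have mT : m' setT = 1%E by [].
pose mP := Measure_isProbability.Build _ _ R m' mT.
pose P : probability (measurableTypeR R) R := HB.pack m mM mP.
by exists P.
Qed.

Lemma measurable_lsv a : measurable_fun (setT : set (measurableTypeR R)) (lsv_map a).
Proof.
apply: measurable_fun_ifT => //.
- exact: measurable_fun_ler.
- apply: measurable_funM => //; apply: measurable_funD => //.
  by apply: measurable_funM => //.
- by apply: measurable_funB => //; apply: measurable_funM.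
Qed.

Lemma lsv_left a x : 0 < x <= 2^-1 -> lsv_map a x = left_branch a x.
Proof.
move=> /andP[x0 x2]; rewrite /lsv_map x2 -powRM ?ler0n ?(ltW x0)//.
by rewrite powR_expR ?mulr_gt0.
Qed.

Lemma lsv_right a x : 2^-1 < x -> lsv_map a x = 2 * x - 1.
Proof. by move=> x2; rewrite /lsv_map leNgt x2. Qed.

Lemma lsv01 a x : 0 < a -> 0 < x <= 1 -> 0 < lsv_map a x <= 1.
Proof.
move=> a0 /andP[x0 x1]; have [x2|x2] := leP x 2^-1; last first.
  by rewrite lsv_right//; lra.
rewrite lsv_left ?x0// /left_branch.
by have := wt_le1 (ltW a0) x2; have := wt_gt0 a x => ? ?; apply/andP; split; nra.
Qed.

Lemma lsv_gt a t x : 0 < a -> 0 < t < 1 -> 0 < x <= 1 ->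
  (t < lsv_map a x) = (ginv a t < x <= 2^-1) || ((1 + t) / 2 < x).
Proof.
move=> a0 /andP[t0 t1] x01; have /andP[x0 x1] := x01.
have t01 : 0 < t <= 1 by rewrite t0 ltW.
have [x2|x2] := leP x 2^-1; last first.
  rewrite lsv_right// andbF /=; apply/idP/idP => ?; lra.
have -> : (1 + t) / 2 < x = false by apply/negP => ?; lra.
have := lsv01 a0 x01; rewrite lsv_left ?x0// andbT orbF => /andP[l0 l1].
have gx : ginv a (left_branch a x) = x by rewrite ginvK// x0.
have [g0 g2 gt] := ginvP a0 t01.
apply/idP/idP => [tl|xg].
  rewrite lt_neqAle -{2}gx ginv_le// ?ltW// andbT.
  by apply/negP => /eqP e; move: tl; rewrite -e gt ltxx.
rewrite ltNge; apply/negP => lt; have := ginv_le a0 l0 lt (ltW t1).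
by rewrite gx leNgt xg.
Qed.

Variables (a : R) (f : R -> R).
Hypotheses (a01 : 0 < a < 1) (f0 : forall x, 0 <= f x)
  (fi : mu.-integrable setT (EFin \o f))
  (fout : forall x, ~ I01 x -> f x = 0)
  (fcont : forall x, 0 < x < 1 -> {for x, continuous f})
  (feq : forall x, 0 < x < 1 ->
     f x = 2^-1 * f ((1 + x) / 2) + f (ginv a x) / tau a (ginv a x)).

Let a0 : 0 < a. Proof. by case/andP: a01. Qed.

Let cdf (x : R) := \int[mu]_(y in `[0, x]) f y.

Let fiS (A : set (measurableTypeR R)) : measurable A -> mu.-integrable A (EFin \o f).
Proof. by move=> mA; apply: (integrableS measurableT). Qed.

Let dcdf x : 0 < x < 1 -> is_derive x 1 cdf (f x).
Proof.
move=> x01; have /andP[x0 x1] := x01.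
have [d e] := continuous_FTC1_closed x1 (fiS (measurable_itv `[0, 1])) x0 (fcont x01).
have e' : 'D_1 cdf x = f x by rewrite -derive1E; exact: e.
exact: (DeriveDef d e').
Qed.

Let cdf_itv (s t : R) : 0 <= s -> s <= t -> \int[mu]_(y in `]s, t]) f y = cdf t - cdf s.
Proof.
move=> s0 st; rewrite /cdf Rintegral_itvB//.
exact: fiS.
Qed.

(** Both sides have the same derivative, by the equation of invariance, and the
    same limit at 0. *)
Lemma cdf_invariant t : 0 < t < 1 ->
  cdf t = cdf (ginv a t) + cdf ((1 + t) / 2) - cdf 2^-1.
Proof.
move=> t01; pose H s := cdf (ginv a s) + cdf ((1 + s) / 2) - cdf s.
have dH (s : R) : 0 < s < 1 -> is_derive s 1 H 0.
  move=> s01; have /andP[s0 s1] := s01.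
  have [g0 g2 _] : [/\ 0 < ginv a s, ginv a s <= 2^-1 & left_branch a (ginv a s) = s].
    by apply: ginvP => //; rewrite s0 ltW.
  have d1 : is_derive s 1 (cdf \o ginv a) (f (ginv a s) * (tau a (ginv a s))^-1).
    by apply: is_derive1_comp; [apply: dcdf; lra|exact: is_derive_ginv].
  have d2 : is_derive s 1 (cdf \o (fun s => (1 + s) / 2)) (f ((1 + s) / 2) * 2^-1).
    apply: is_derive1_comp; first by apply: dcdf; lra.
    by apply: is_derive_eq; rewrite /GRing.scale/=; ring.
  have d3 := dcdf s01.
  have d4 := is_deriveB (is_deriveD d1 d2) d3.
  apply: is_derive_eq d4 _; rewrite [X in _ - X]feq// mulrC; ring.
have Hc (s : R) : 0 < s -> s <= t -> H s = H t.
  move=> s0 st; apply/eqP; rewrite eq_le; apply/andP; split.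
    apply: (@ge0_derive_le _ 0 1 H (fun=> 0)) => //; by case/andP: t01.
  rewrite -lerN2; apply: (@ge0_derive_le _ 0 1 (fun s => - H s) (fun=> 0)) => //; last by case/andP: t01.
  by move=> z /dH dz; have := is_deriveN dz; rewrite oppr0.
have /andP[t0 t1] := t01.
pose u n := t * n.+1%:R^-1.
have u01 n : 0 < u n <= t.
  by rewrite mulr_gt0 ?invr_gt0//= ler_piMr ?(ltW t0)// invf_le1// ler1n.
have uc : u n @[n --> \oo] --> (0 : R).
  rewrite -(mulr0 t); apply: cvgMr; exact: cvg_harmonic.
have Cc : {within `[0, 1], continuous cdf}.
  exact: (@parameterized_integral_continuous R 0 1 f ler01 (fiS (measurable_itv _))).
have Cs (v : nat -> R) x : (forall n, 0 <= v n <= 1) -> 0 <= x <= 1 ->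
    v n @[n --> \oo] --> x -> cdf (v n) @[n --> \oo] --> cdf x.
  move=> v01 x01 vx.
  have /subspace_continuousP/(_ x) := Cc; rewrite /= in_itv/= => /(_ x01) cx.
  apply: cvg_comp cx => A wA.
  have vA : \forall n \near \oo, `[0, 1]%classic (v n) -> A (v n) := vx _ wA.
  by apply: filterS vA => n; apply; rewrite /= in_itv/=.
have gu : ginv a (u n) @[n --> \oo] --> (0 : R).
  apply: (@squeeze_cvgr _ _ _ _ (cst 0) u) => //; last exact: cvg_cst.
  near=> n; have /andP[u0 ut] := u01 n.
  have u1 : 0 < u n <= 1 by rewrite u0 (le_trans ut)// ltW.
  by have [g0 _ _] := ginvP a0 u1; rewrite /= ltW//= ltW// ginv_lt.
have h1 : H (u n) @[n --> \oo] --> cdf 0 + cdf ((1 + 0) / 2) - cdf 0.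
  have ur n : 0 < u n <= 1 by have /andP[u0 ut] := u01 n; rewrite u0 (le_trans ut)// ltW.
  apply: cvgB; [apply: cvgD|]; apply: Cs => //.
  - move=> n; have [g0 g2 _] := ginvP a0 (ur n); lra.
  - by rewrite lexx ler01.
  - by move=> n; have := ur n; lra.
  - by lra.
  - apply: cvgMl; apply: cvgD => //; exact: cvg_cst.
  - by move=> n; have /andP[/ltW-> ->] := ur n.
  - by rewrite lexx ler01.
have h2 : H (u n) @[n --> \oo] --> H t.
  rewrite (_ : (fun n => H (u n)) = cst (H t)); first exact: cvg_cst.
  by apply/funext => n; apply: Hc; have /andP[] := u01 n.
have : cdf 0 + cdf ((1 + 0) / 2) - cdf 0 = H t by exact: (cvg_unique (@Rhausdorff R) h1 h2).
by rewrite /H addr0 mul1r => e; lra.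
Unshelve. all: by end_near. Qed.

Let intE (A : set (measurableTypeR R)) : measurable A ->
  (\int[mu]_(x in A) (f x)%:E = (\int[mu]_(x in A `&` I01) f x)%:E)%E.
Proof.
move=> mA; rewrite /Rintegral fineK; last first.
  apply: integrable_fin_num; first exact: measurableI.
  by apply: fiS; exact: measurableI.
rewrite integral_mkcondr; apply: eq_integral => x _; rewrite patchE.
by case: ifPn => //; rewrite notin_setE => /fout ->.
Qed.

(** Half-lines generate the Borel sets, and the preimage of a half-line consists
    of one interval in each branch. *)
Lemma density_invariant (A : set (measurableTypeR R)) : measurable A ->
  (\int[mu]_x (f x)%:E = 1)%E ->
  (\int[mu]_(x in lsv_map a @^-1` A) (f x)%:E = \int[mu]_(x in A) (f x)%:E)%E.
Proof.
move=> mA f1; have [P PE] := probability_of_density f0 fi f1.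
pose T : measurableTypeR R -> measurableTypeR R := lsv_map a.
have mT : measurable_fun setT T by exact: measurable_lsv.
have mTB (B : set (measurableTypeR R)) : measurable B -> measurable (T @^-1` B).
  by move=> mB; rewrite -[X in measurable X]setTI; exact: mT.
rewrite -!PE.
pose Q : {measure set (measurableTypeR R) -> \bar R} := pushforward P T.
change (Q mT A = P A).
apply: (@measure_unique _ R (measurableTypeR R) (@RGenOInfty.G R)
  (fun n => `](- n%:R)%R, +oo[%classic)) => //.
- exact: RGenOInfty.measurableE.
- by move=> _ _ [s ->] [t ->]; exists (Num.max s t); apply/seteqP; split => x /=; rewrite !in_itv/= !andbT gt_max => /andP.
- by move=> n; eexists.
- apply/seteqP; split => // x _; exists (Num.bound `|x|) => //=.
  by have := archi_boundP (normr_ge0 x); rewrite ltr_norml in_itv/= andbT => /andP[].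
- move=> _ [t ->]; rewrite /Q/= /pushforward !PE !intE//; last exact: mTB.
  congr EFin.
  have [t0|t0] := leP t 0.
    congr (\int[mu]_(x in _) _); rewrite !(setIidr)//= => x; rewrite /= !in_itv/= andbT => x01.
      by apply: le_lt_trans t0 _; case/andP: x01.
    by apply: le_lt_trans t0 _; case/andP: (lsv01 a0 x01).
  have [t1|t1] := leP 1 t.
    have -> : `]t, +oo[ `&` I01 = set0.
      rewrite -subset0 => x /=; rewrite !in_itv/= andbT => -[tx /andP[_ x1]].
      by have := lt_le_trans tx x1; rewrite ltNge t1.
    have -> : T @^-1` `]t, +oo[ `&` I01 = set0.
      rewrite -subset0 => x /=; rewrite !in_itv/= andbT => -[tx x01].
      by have /andP[_ /(lt_le_trans tx)] := lsv01 a0 x01; rewrite ltNge t1.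
    by [].
  have t01 : 0 < t < 1 by rewrite t0.
  have [g0 g2 _] : [/\ 0 < ginv a t, ginv a t <= 2^-1 & left_branch a (ginv a t) = t].
    by apply: ginvP => //; rewrite t0 ltW.
  have -> : `]t, +oo[ `&` I01 = (`]t, 1]%classic : set (measurableTypeR R)).
    apply/seteqP; split => x /=; rewrite !in_itv/= ?andbT.
      by move=> [-> /andP[_ ->]].
    by move=> /andP[tx ->]; rewrite tx (lt_trans t0 tx).
  have -> : T @^-1` `]t, +oo[ `&` I01 =
      (`]ginv a t, 2^-1]%classic `|` `](1 + t) / 2, 1]%classic : set (measurableTypeR R)).
    apply/seteqP; split => x /=; rewrite !in_itv/= ?andbT.
      move=> [tx x01]; move: tx; rewrite /T lsv_gt// => /orP[?|h]; [by left|right].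
      by rewrite h; case/andP: x01.
    move=> h; have x01 : 0 < x <= 1 by case: h => /andP[? ?]; lra.
    split=> //; rewrite /T lsv_gt//; case: h => [->//|/andP[-> _]]; exact: orbT.
  have h2 : 2^-1 <= (1 + t) / 2 by lra.
  rewrite Rintegral_setU//=; last 2 first.
  - by apply: fiS; exact: measurableU.
  - apply/disj_set2P; rewrite -subset0 => x /=; rewrite !in_itv/= => -[/andP[_ x2] /andP[x3 _]].
    by have := lt_le_trans x3 (le_trans x2 h2); rewrite ltxx.
  rewrite !cdf_itv ?(ltW t0) ?(ltW t1) ?(ltW g0)//; try lra.
  by rewrite [cdf t]cdf_invariant//; ring.
- by move=> n; rewrite /Q/= /pushforward (le_lt_trans (probability_le1 P _)) ?ltry//; exact: mTB.
Qed.

Lemma acip_of_density : (\int[mu]_x (f x)%:E = 1)%E ->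
  exists P : probability (measurableTypeR R) R, acip a P /\
    forall A : set (measurableTypeR R), P A = (\int[mu]_(x in A) (f x)%:E)%E.
Proof.
move=> f1; have [P PE] := probability_of_density f0 fi f1.
have PI (A : set (measurableTypeR R)) : measurable A -> P (`[0, 1] `&` A) = P A.
  move=> mA; rewrite !PE !intE//; last exact: measurableI.
  congr (\int[mu]_(x in _) _)%:E; apply/seteqP; split => x /=.
    by move=> [[_ Ax] x01].
  move=> [Ax x01]; do 2!split => //; move: x01; rewrite /= !in_itv/=.
  by move=> /andP[/ltW-> ->].
exists P; split => //; split.
- by rewrite -[`[0, 1]%classic]setIT PI// probability_setT.
- apply/null_content_dominatesP => A mA A0; rewrite PE.
  apply: null_set_integral => //.
  by apply: measurable_funTS; case/integrableP: fi.
- move=> A mA A01.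
  rewrite PI; last by rewrite -[X in measurable X]setTI; exact: measurable_lsv.
  by rewrite !PE; exact: density_invariant.
Qed.

End acip_of_density.

(** * Integrals against a density *)

Section integrable_combine.
Context {R : realType}.
Local Notation mu := (@lebesgue_measure R).
Implicit Types (D : set (measurableTypeR R)) (f g : measurableTypeR R -> R).

Lemma integrable_scale (c : R) D f : measurable D ->
  mu.-integrable D (fun x => (f x)%:E) -> mu.-integrable D (fun x => (c * f x)%:E).
Proof.
move=> mD fi; have -> : (fun x => (c * f x)%:E) = (fun x => (c%:E * (f x)%:E)%E).
  by apply/funext => x; rewrite EFinM.
exact: integrableZl.
Qed.

Lemma integrable_add D f g : measurable D -> mu.-integrable D (fun x => (f x)%:E) ->
  mu.-integrable D (fun x => (g x)%:E) -> mu.-integrable D (fun x => (f x + g x)%:E).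
Proof.
move=> mD fi gi; have -> : (fun x => (f x + g x)%:E) = (fun x => ((f x)%:E + (g x)%:E)%E).
  by apply/funext => x; rewrite EFinD.
exact: integrableD.
Qed.

End integrable_combine.

Section density_integral.
Context {R : realType}.
Local Notation mu := (@lebesgue_measure R).
Local Notation I01 := (`]0, 1]%classic : set (measurableTypeR R)).
Variables (P : probability (measurableTypeR R) R) (f : R -> R).
Hypotheses (f0 : forall x, 0 <= f x) (fi : mu.-integrable setT (EFin \o f))
  (PE : forall A : set (measurableTypeR R), measurable A ->
    P A = (\int[mu]_(x in A) (f x)%:E)%E).

Let Pmu : P `<< mu.
Proof.
apply/null_content_dominatesP => A mA A0; rewrite PE//.
apply: null_set_integral => //.
by apply: measurable_funTS; case/integrableP: fi.
Qed.

(** The density is a Radon-Nikodym derivative, up to equality almost everywhere. *)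
Lemma ge0_density_integral (E : set (measurableTypeR R)) g :
  (forall x, 0 <= g x)%E -> measurable E -> measurable_fun E g ->
  (\int[P]_(x in E) g x = \int[mu]_(x in E) (g x * (f x)%:E))%E.
Proof.
move=> g0 mE mg; rewrite -(Radon_Nikodym_SigmaFinite.change_of_variables Pmu)//.
apply: ae_eq_integral => //.
- apply: emeasurable_funM => //; apply: measurable_funTS.
  exact: measurable_int (Radon_Nikodym_SigmaFinite.f_integrable Pmu).
- by apply: emeasurable_funM => //; apply: measurable_funTS; case/integrableP: fi.
- apply: ae_eqe_mul2l; apply: integral_ae_eq => //.
  + by apply: (integrableS measurableT) => //; exact: Radon_Nikodym_SigmaFinite.f_integrable.
  + by apply: measurable_funTS; case/integrableP: fi.
  + by move=> A AE mA; rewrite -PE// -Radon_Nikodym_SigmaFinite.f_integral.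
Qed.

Lemma density_integral (E : set (measurableTypeR R)) (phi : R -> R) :
  measurable E -> measurable_fun E phi ->
  mu.-integrable E (fun x => (phi x * f x)%:E) ->
  P.-integrable E (EFin \o phi) /\
  \int[P]_(x in E) phi x = \int[mu]_(x in E) (phi x * f x).
Proof.
move=> mE mphi phii.
have Pphi : P.-integrable E (EFin \o phi).
  apply/integrableP; split; first exact/measurable_EFinP.
  rewrite ge0_density_integral//; last first.
    by apply: measurableT_comp => //; exact/measurable_EFinP.
  move/integrableP : phii => [_]; apply: le_lt_trans.
  rewrite le_eqVlt; apply/orP; left; apply/eqP; apply: eq_integral => x _.
  by rewrite /= normrM [X in _ * X]ger0_norm.
split=> //; rewrite /Rintegral; congr fine.
rewrite -(Radon_Nikodym_change_of_variables Pmu)//.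
under [RHS]eq_integral do rewrite EFinM.
apply: ae_eq_integral => //.
- apply: emeasurable_funM; first exact/measurable_EFinP.
  apply: measurable_funTS; apply: (measurable_int mu).
  exact: Radon_Nikodym_integrable.
- by under eq_fun do rewrite -EFinM; case/integrableP: phii.
- apply: ae_eqe_mul2l; apply: integral_ae_eq => //.
  + by apply: (integrableS measurableT) => //; exact: Radon_Nikodym_integrable.
  + by apply: measurable_funTS; case/integrableP: fi.
  + by move=> A AE mA; rewrite -PE// -Radon_Nikodym_integral.
Qed.

End density_integral.

Section Lq_weights.
Context {R : realType}.
Local Notation mu := (@lebesgue_measure R).
Local Notation I01 := (`]0, 1]%classic : set (measurableTypeR R)).

Lemma lebesgue01_integral g : measurable_fun setT g -> (forall x, 0 <= g x)%E ->
  (\int[lebesgue01 R]_x g x = \int[mu]_(x in `[0%R, 1%R]) g x)%E.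
Proof.
move=> mg g0; pose f : R -> R := \1_`[0, 1].
have f0 x : 0 <= f x by rewrite /f indicE.
have f1 : (\int[mu]_x (f x)%:E = 1)%E.
  rewrite /f integral_indic//; transitivity (mu (`[0, 1]%classic : set R)).
    by congr (mu _); rewrite setIT.
  by rewrite lebesgue_measure_itv/= lte_fin ltr01 oppr0 adde0.
have fi : mu.-integrable setT (EFin \o f).
  apply/integrableP; split; first exact/measurable_EFinP/measurable_indic.
  by under eq_integral do rewrite gee0_abs ?lee_fin ?f0//; rewrite /= f1 ltry.
have [P PE] := probability_of_density f0 fi f1.
rewrite (eq_measure_integral P); last first.
  move=> A mA _; apply: etrans _ (esym (PE A)); rewrite /f integral_indic//.
  by rewrite /lebesgue01 /mrestr setIC.
rewrite (ge0_density_integral fi (fun A _ => PE A))//.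
rewrite [RHS]integral_mkcond; apply: eq_integral => x _.
by rewrite patchE /f indicE; case: ifPn => _; rewrite ?mule1 ?mule0.
Qed.

Lemma Lfun01_integrable (q : R) (phi : measurableTypeR R -> R) : 1 <= q ->
  phi \in Lfun (lebesgue01 R) q%:E ->
  mu.-integrable I01 (fun x => (`|phi x| `^ q)%:E).
Proof.
move=> q1 /[dup] /sub_Lfun_mfun; rewrite inE => mphi /(Lfun_integrable q1).
move=> /integrableP[_]; have mp : measurable_fun setT (fun x => (`|phi x| `^ q)%:E).
  by apply/measurable_EFinP/(measurableT_comp (measurable_powR _)); exact: measurableT_comp.
rewrite lebesgue01_integral//; last exact: measurableT_comp.
move=> h; apply/integrableP; split; first exact: measurable_funTS.
apply: le_lt_trans h; apply: ge0_subset_integral => //.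
  by apply: measurable_funTS; exact: measurableT_comp.
by move=> x /=; rewrite !in_itv/= => /andP[/ltW-> ->].
Qed.

(** Young's inequality for an exponent [r] with [b < 1 - r^-1]. Of two exponents
    [v < w] in this gap, the room between [v] and [w] absorbs the logarithm, and
    [w] times the conjugate exponent of [r] is below 1. *)
Lemma Lfun01_weight_integrable (b : R) (q : \bar R) (phi : measurableTypeR R -> R) :
  0 < b < 1 -> ((1 - b)^-1%:E < q)%E -> phi \in Lfun (lebesgue01 R) q ->
  exists2 v, b < v < 1 & mu.-integrable I01 (fun x => (phi x * (x `^ (- v) * (1 - ln x)))%:E).
Proof.
move=> /andP[b0 b1] bq phiq; have mphi : measurable_fun setT phi.
  by have := sub_Lfun_mfun phiq; rewrite inE.
have b10 : 0 < 1 - b by rewrite subr_gt0.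
have [r [br phir]] : exists r : R, (1 - b)^-1 < r /\ phi \in Lfun (lebesgue01 R) r%:E.
  have r1 : (1 <= ((1 - b)^-1 + 1)%:E)%E by rewrite lee_fin lerDr invr_ge0 ltW.
  case: q => [r||] in bq phiq *.
  - by exists r; rewrite -lte_fin.
  - exists ((1 - b)^-1 + 1); split; first by rewrite ltrDl.
    apply: (Lfun_subset r1 _ _ _ phiq) => //=.
    + by rewrite leey.
    + by rewrite /lebesgue01 /mrestr/= setTI lebesgue_measure_itv/= lte_fin ltr01 oppr0 adde0.
    + by rewrite leey.
  - by move: bq; rewrite ltNge leNye.
have r1 : 1 < r by apply: le_lt_trans br; rewrite invf_ge1//; lra.
have r0 : 0 < r := lt_trans ltr01 r1.
have ir : r^-1 < 1 - b by rewrite invf_plt ?posrE.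
have ir0 : 0 < r^-1 by rewrite invr_gt0.
pose v := (2 * b + (1 - r^-1)) / 3; pose w := (b + 2 * (1 - r^-1)) / 3.
have vw : 0 < v < w by rewrite /v /w; lra.
exists v; first by rewrite /v; lra.
pose p := (1 - r^-1)^-1.
have p0 : 0 < p by rewrite invr_gt0; lra.
have wp : 0 < w * p < 1.
  rewrite mulr_gt0//=; last by rewrite /w; lra.
  by rewrite ltr_pdivrMr ?mul1r /w; lra.
have pq : r^-1 + p^-1 = 1 by rewrite /p invrK; lra.
pose C := 1 + (w - v)^-1.
apply: (@le_integrable _ _ _ mu I01 _ _
  (fun x => (C * (`|phi x| `^ r / r + x `^ (- (w * p)) / p))%:E)) => //.
- apply/measurable_EFinP; apply: measurable_funM; first exact: measurable_funTS.
  by apply: measurable_funTS; apply: measurable_funM => //; exact: measurable_funB.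
- move=> x; rewrite /= in_itv/= => x01; rewrite lee_fin normrM.
  have lx : ln x <= 0 by case/andP: x01 => *; rewrite ln_le0.
  rewrite [X in _ * X]ger0_norm; last by rewrite mulr_ge0 ?powR_ge0// subr_ge0; lra.
  have h1 := log_powR_le vw x01.
  have h2 := @conjugate_powR R `|phi x| (x `^ (- w)) r p (normr_ge0 _) (powR_ge0 _ _) r0 p0 pq.
  rewrite -powRrM mulNr in h2.
  apply: le_trans (ler_norm _); apply: le_trans (ler_wpM2l (normr_ge0 _) h1) _.
  rewrite mulrCA ler_wpM2l// addr_ge0// invr_ge0; lra.
- apply: integrable_scale => //; apply: integrable_add => //.
    have -> : (fun x => (`|phi x| `^ r / r)%:E) = (fun x => (r^-1 * `|phi x| `^ r)%:E).
      by apply/funext => x; rewrite mulrC.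
    by apply: integrable_scale => //; apply: Lfun01_integrable => //; exact: ltW.
  have -> : (fun x : R => (x `^ (- (w * p)) / p)%:E) = (fun x => (p^-1 * x `^ (- (w * p)))%:E).
    by apply/funext => x; rewrite mulrC.
  by apply: integrable_scale => //; exact: integrable_powRN.
Qed.

End Lq_weights.

(** * Moments of the density *)

Section density_moments.
Context {R : realType}.
Local Notation mu := (@lebesgue_measure R).
Local Notation I01 := (`]0, 1]%classic : set (measurableTypeR R)).
Implicit Types (a b x v : R) (psi : R -> R).

Lemma dbnd_ge0 : 0 <= dbnd :> R.
Proof.
have h : 0 < (2^-1 : R) < 1 by lra.
have h1 : 0 < (1 : R) <= 1 by rewrite ltr01 lexx.
have := drhoh_da_bound h h1; rewrite powR1 ln1 subr0 !mulr1 => /(le_trans (normr_ge0 _)).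
by rewrite pmulr_rge0.
Qed.

(** The weight that dominates [rhoh] and its derivative in the parameter, up to
    constants, for all the parameters at most [v]. *)
Definition log_weight v x : R := x `^ (- v) * (1 - ln x).

Lemma log_weight_ge a x : 0 < x <= 1 -> x `^ (- a) <= log_weight a x.
Proof.
move=> /andP[x0 x1]; rewrite /log_weight ler_peMr ?powR_ge0//.
by rewrite lerBrDr gerDl ln_le0.
Qed.

Lemma log_weight_ge0 a x : 0 < x <= 1 -> 0 <= log_weight a x.
Proof. by move=> /(log_weight_ge a); apply: le_trans; rewrite powR_ge0. Qed.

Lemma log_weight_le a v x : a <= v -> 0 < x <= 1 -> log_weight a x <= log_weight v x.
Proof.
move=> av /andP[x0 x1]; have l0 : ln x <= 0 by rewrite ln_le0.
rewrite /log_weight ler_wpM2r ?subr_ge0 ?(le_trans l0)// !powR_expR// ler_expR; nra.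
Qed.

Lemma seq_cont_measurable (f : R -> R) :
  cont_cvg (fun=> f) f -> measurable_fun I01 f.
Proof.
move=> cf; apply: subspace_continuous_measurable_fun => //.
apply: seq_within_continuous => u x u01 x01 ux.
apply: (cf u x _ _ ux); first by move=> n; have := u01 n; rewrite /= in_itv.
by move: x01; rewrite /= in_itv.
Qed.

Lemma measurable_rhoh a : 0 < a < 1 -> measurable_fun I01 (rhoh a).
Proof.
move=> /andP[a0 a1]; apply: seq_cont_measurable.
by apply: (@rhoh_cont R (fun=> a) a a) => //; [move=> n; rewrite a0 lexx|exact: cvg_cst].
Qed.

Lemma measurable_drhoh_da a : 0 < a < 1 -> measurable_fun I01 (drhoh_da a).
Proof.
move=> a01; apply: seq_cont_measurable.
by apply: drhoh_da_cont => //; exact: cvg_cst.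
Qed.

Lemma rhoh_log_weight a v x : 0 < a <= v -> v < 1 -> 0 < x <= 1 -> `|rhoh a x| <= 24 * log_weight v x.
Proof.
move=> /andP[a0 av] v1 x01; apply: le_trans (rhoh_le _ x01) _; first by rewrite a0 (le_lt_trans av).
rewrite ler_wpM2l//; exact: le_trans (log_weight_ge _ x01) (log_weight_le av x01).
Qed.

Lemma drhoh_da_log_weight a v x : 0 < a <= v -> v < 1 -> 0 < x <= 1 ->
  `|drhoh_da a x| <= 24 * dbnd * log_weight v x.
Proof.
move=> /andP[a0 av] v1 x01; apply: le_trans (drhoh_da_bound _ x01) _; first by rewrite a0 (le_lt_trans av).
by rewrite ler_wpM2l ?log_weight_le// mulr_ge0// dbnd_ge0.
Qed.

Definition moment psi a := \int[mu]_(x in I01) (psi x * rhoh a x).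
Definition dmoment psi a := \int[mu]_(x in I01) (psi x * drhoh_da a x).

Variables (v : R) (psi : R -> R).
Hypotheses (v1 : v < 1) (mpsi : measurable_fun I01 psi)
  (ipsi : mu.-integrable I01 (fun x => (psi x * log_weight v x)%:E)).

Let dominated (f : R -> R) (C : R) : measurable_fun I01 f ->
  (forall x, 0 < x <= 1 -> `|f x| <= C * log_weight v x) ->
  mu.-integrable I01 (fun x => (psi x * f x)%:E).
Proof.
move=> mf fC; apply: (le_integrable _ _ _ (integrable_scale C _ ipsi)) => //.
  by apply/measurable_EFinP; exact: measurable_funM.
move=> x; rewrite /= in_itv/= => x01; rewrite lee_fin mulrCA.
rewrite (normrM (psi x)) [leRHS](normrM (psi x)) ler_wpM2l//.
by rewrite (le_trans (fC x x01))// ler_norm.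
Qed.

Lemma moment_integrable a : 0 < a < v -> mu.-integrable I01 (fun x => (psi x * rhoh a x)%:E).
Proof.
move=> /andP[a0 av]; apply: (@dominated _ 24).
  by apply: measurable_rhoh; rewrite a0 (lt_trans av).
by move=> x x01; apply: rhoh_log_weight => //; rewrite a0 ltW.
Qed.

Lemma dmoment_integrable a : 0 < a < v -> mu.-integrable I01 (fun x => (psi x * drhoh_da a x)%:E).
Proof.
move=> /andP[a0 av]; apply: (@dominated _ (24 * dbnd)).
  by apply: measurable_drhoh_da; rewrite a0 (lt_trans av).
by move=> x x01; apply: drhoh_da_log_weight => //; rewrite a0 ltW.
Qed.

Let bound x := 24 * dbnd * `|psi x * log_weight v x|.

Let bound_integrable : mu.-integrable I01 (EFin \o bound).
Proof.
apply: integrable_scale => //.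
by have := integrable_abse ipsi; apply: eq_integrable.
Qed.

Let bound_ge a x : 0 < a < v -> 0 < x <= 1 -> `|psi x * drhoh_da a x| <= bound x.
Proof.
move=> /andP[a0 av] x01; rewrite /bound (normrM (psi x)) (normrM (psi x) (log_weight v x)) mulrCA ler_wpM2l//.
rewrite (ger0_norm (log_weight_ge0 v x01)).
by apply: drhoh_da_log_weight => //; rewrite a0 ltW.
Qed.

Lemma is_derive_moment a : 0 < a < v -> is_derive a 1 (moment psi) (dmoment psi a).
Proof.
move=> av; pose f a x := psi x * rhoh a x.
have df a' x : 0 < a' < v -> 0 < x <= 1 -> is_derive a' 1 (f ^~ x) (psi x * drhoh_da a' x).
  move=> /andP[a'0 a'v] x01.
  have d : is_derive a' 1 (fun t => rhoh t x) (drhoh_da a' x).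
    by apply: is_derive_rhoh_da => //; rewrite a'0 (lt_trans a'v).
  exact: is_deriveZ.
have avI : `]0, v[%classic a by rewrite /= in_itv.
have intf t : `]0, v[%classic t -> mu.-integrable I01 (EFin \o f t).
  by rewrite /= in_itv/= => tv; exact: moment_integrable.
have derf t (x : R) : `]0, v[%classic t -> I01 x -> derivable (f ^~ x) t 1.
  by rewrite /= !in_itv/= => tv x01; have d := df t x tv x01; exact: (@ex_derive _ _ _ _ _ _ _ d).
have b0 x : 0 <= bound x by rewrite /bound mulr_ge0// mulr_ge0// dbnd_ge0.
have fb t x : `]0, v[%classic t -> I01 x -> `|partial1of2 f t x| <= bound x.
  rewrite /= !in_itv/= => tv x01; rewrite partial1of2E.
  by have d := df _ _ tv x01; rewrite (@derive_val _ _ _ _ _ _ _ d); exact: bound_ge.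
have mI : measurable I01 by [].
have d1 := derivable_under_integral mI avI intf derf b0 bound_integrable fb.
have d2 := differentiation_under_integral mI avI intf derf b0 bound_integrable fb.
apply: DeriveDef => //; rewrite -derive1E; apply: etrans d2 _.
apply: eq_Rintegral => x; rewrite inE/= in_itv/= => x01.
rewrite partial1of2E; have d := df _ _ av x01.
exact: (@derive_val _ _ _ _ _ _ _ d).
Qed.

Lemma dmoment_continuous a : 0 < a < v -> {for a, continuous (dmoment psi)}.
Proof.
move=> av; pose f a x := psi x * drhoh_da a x.
have avI : `]0, v[%classic a by rewrite /= in_itv.
apply: (@continuity_under_integral R _ (measurableTypeR R) mu f I01 _ 0 v _ _ bound).
- by [].
- by move=> t; rewrite /= in_itv/= => tv; exact: dmoment_integrable.
- apply: aeW => x; rewrite /= in_itv/= => x01.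
  have oI : open (`]0, v[%classic : set R) by exact: interval_open.
  rewrite -(continuous_open_subspace _ oI).
  apply: seq_within_continuous => u t u01 t01 ut.
  apply: cvgM; first exact: cvg_cst.
  apply: (drhoh_da_cont _ _ ut (x := x)) => //; last exact: cvg_cst.
  - by move=> n; have := u01 n; rewrite /= in_itv/= => /andP[-> /lt_trans]; exact.
  - by have := t01; rewrite /= in_itv/= => /andP[-> /lt_trans]; exact.
- exact: bound_integrable.
- move=> t; rewrite /= in_itv/= => tv; apply: aeW => x; rewrite /= in_itv/= => x01.
  exact: bound_ge.
- by rewrite inE.
Qed.

End density_moments.

(** * The normalised density *)

Section normalized_density.
Context {R : realType}.
Local Notation mu := (@lebesgue_measure R).
Local Notation I01 := (`]0, 1]%classic : set (measurableTypeR R)).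
Implicit Types (a b x v : R).

Definition total a := moment (fun=> 1 : R) a.
Definition dtotal a := dmoment (fun=> 1 : R) a.
Definition acim_density a x := rhoh a x / total a.
Definition dacim_density a x := (drhoh_da a x * total a - rhoh a x * dtotal a) / total a ^+ 2.

Lemma one_log_weight_integrable v : 0 < v < 1 -> mu.-integrable I01 (fun x : R => (1 * log_weight v x)%:E).
Proof.
move=> v01; apply: eq_integrable (integrable_powR_ln v01) => // x _.
by rewrite mul1r.
Qed.

Let midP a : 0 < a < 1 -> [/\ 0 < (1 + a) / 2 < 1 & 0 < a < (1 + a) / 2].
Proof. by move=> a01; split; lra. Qed.

Lemma rhoh_integrable a : 0 < a < 1 -> mu.-integrable I01 (fun x => (rhoh a x)%:E).
Proof.
move=> a01; have [v01 av] := midP a01; have /andP[_ v1] := v01.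
apply: eq_integrable (moment_integrable v1 (measurable_cst _) (one_log_weight_integrable v01) av) => // x _.
by rewrite mul1r.
Qed.

Lemma total_ge a : 0 < a < 1 -> 4^-1 <= total a.
Proof.
move=> a01; rewrite /total /moment.
under eq_Rintegral do rewrite mul1r.
have -> : 4^-1 = \int[mu]_(x in I01) (4^-1 : R).
  rewrite Rintegral_cst//= lebesgue_measure_itv/= lte_fin ltr01 oppr0 adde0 /=.
  by rewrite mulr1.
apply: le_Rintegral => //.
- apply: (le_integrable _ _ _ (rhoh_integrable a01)) => //.
    by apply/measurable_EFinP; exact: measurable_cst.
  move=> x; rewrite /= in_itv/= => x01.
  by rewrite lee_fin !ger0_norm ?rhoh_ge// (le_trans _ (rhoh_ge a01 x01)).
- exact: rhoh_integrable.
- by move=> x; rewrite /= in_itv/= => x01; exact: rhoh_ge.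
Qed.

Lemma total_gt0 a : 0 < a < 1 -> 0 < total a.
Proof. by move=> /total_ge; apply: lt_le_trans; rewrite invr_gt0. Qed.

Lemma is_derive_total a : 0 < a < 1 -> is_derive a 1 total (dtotal a).
Proof.
move=> a01; have [v01 av] := midP a01; have /andP[_ v1] := v01.
exact: (is_derive_moment v1 (measurable_cst _) (one_log_weight_integrable v01) av).
Qed.

Lemma dtotal_continuous a : 0 < a < 1 -> {for a, continuous dtotal}.
Proof.
move=> a01; have [v01 av] := midP a01; have /andP[_ v1] := v01.
exact: (dmoment_continuous v1 (measurable_cst _) (one_log_weight_integrable v01) av).
Qed.

Lemma dtotal_bounded b : 0 < b < 1 ->
  exists C, forall a, 0 < a <= b -> `|dtotal a| <= C.
Proof.
move=> b01; have [v01 bv] := midP b01; have /andP[_ v1] := v01.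
set v := (1 + b) / 2 in v01 bv v1.
have i1 := one_log_weight_integrable v01.
exists (\int[mu]_(x in I01) (24 * dbnd * log_weight v x)) => a /andP[a0 ab].
have av : 0 < a < v by rewrite a0 (le_lt_trans ab)//; case/andP: bv.
have i2 := dmoment_integrable v1 (measurable_cst _) i1 av.
apply: le_trans (le_normr_Rintegral _ i2) _ => //.
apply: le_Rintegral => //.
- by have := integrable_abse i2; apply: eq_integrable.
- by apply: integrable_scale => //; exact: integrable_powR_ln.
- move=> x; rewrite /= in_itv/= => x01; rewrite mul1r.
  by apply: drhoh_da_log_weight => //; rewrite a0 ltW//; case/andP: av.
Qed.

Lemma is_derive_acim_density a x : 0 < a < 1 -> 0 < x <= 1 ->
  is_derive a 1 (acim_density ^~ x) (dacim_density a x).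
Proof.
move=> a01 x01; have d1 := is_derive_rhoh_da a01 x01.
have d2 := is_derive_total a01; have t0 := total_gt0 a01.
have tn : total a != 0 by rewrite gt_eqF.
have d3 := is_deriveV tn d2.
have := is_deriveM d1 d3; rewrite /acim_density => d.
apply: (is_derive_eq d); rewrite /GRing.scale/= /dacim_density.
by field.
Qed.

(** The joint continuity of [rhoh] is available for parameters that stay away
    from 1. *)
Lemma seq_shrink (al : nat -> R) a : (forall n, 0 < al n < 1) -> 0 < a < 1 ->
  al n @[n --> \oo] --> a ->
  exists N, forall n, 0 < al (n + N)%N <= (1 + a) / 2.
Proof.
move=> al01 a01 ala; have /andP[a0 a1] := a01.
have h : \forall n \near \oo, al n < (1 + a) / 2.
  by apply: cvgr_lt ala _ _; lra.
have [N _ NP] := h; exists N => n.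
by have /andP[-> _] := al01 (n + N)%N; rewrite /= ltW//; apply: NP => /=; exact: leq_addl.
Qed.

Lemma rhoh_joint (al u : nat -> R) a x : (forall n, 0 < al n < 1) -> 0 < a < 1 ->
  (forall n, 0 < u n <= 1) -> 0 < x <= 1 ->
  al n @[n --> \oo] --> a -> u n @[n --> \oo] --> x ->
  rhoh (al n) (u n) @[n --> \oo] --> rhoh a x.
Proof.
move=> al01 a01 u01 x01 ala ux; have /andP[a0 a1] := a01.
have [N NP] := seq_shrink al01 a01 ala.
rewrite -(cvg_shiftn N).
have b1 : (1 + a) / 2 < 1 by lra.
apply: (rhoh_cont NP b1 a0 _ (u := fun n => u (n + N)%N)) => //.
- by rewrite (cvg_shiftn N).
- by rewrite (cvg_shiftn N).
Qed.

Lemma total_cvg (al : nat -> R) a : 0 < a < 1 -> al n @[n --> \oo] --> a ->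
  total (al n) @[n --> \oo] --> total a.
Proof.
move=> a01 ala; apply: cvg_comp ala _.
apply: differentiable_continuous; apply/derivable1_diffP.
have d := is_derive_total a01; exact: (@ex_derive _ _ _ _ _ _ _ d).
Qed.

Lemma acim_density_continuous :
  {within (`]0, 1[ `*` `]0, 1] : set (R * R)), continuous (fun p : R * R => acim_density p.1 p.2)}.
Proof.
apply: seq_within_continuous => u [a x] u01 [/=]; rewrite !in_itv/= => a01 x01 ux.
have al01 n : 0 < (u n).1 < 1 by have [/=] := u01 n; rewrite in_itv.
have ul01 n : 0 < (u n).2 <= 1 by have [/=] := u01 n; rewrite !in_itv.
have ala : (u n).1 @[n --> \oo] --> a by apply: cvg_comp ux _; exact: cvg_fst.
have ulx : (u n).2 @[n --> \oo] --> x by apply: cvg_comp ux _; exact: cvg_snd.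
apply: cvgM; first exact: rhoh_joint.
by apply: cvgV; [rewrite gt_eqF ?total_gt0|exact: total_cvg].
Qed.

Lemma dacim_density_continuous :
  {within (`]0, 1[ `*` `]0, 1] : set (R * R)), continuous (fun p : R * R => dacim_density p.1 p.2)}.
Proof.
apply: seq_within_continuous => u [a x] u01 [/=]; rewrite !in_itv/= => a01 x01 ux.
have al01 n : 0 < (u n).1 < 1 by have [/=] := u01 n; rewrite in_itv.
have ul01 n : 0 < (u n).2 <= 1 by have [/=] := u01 n; rewrite !in_itv.
have ala : (u n).1 @[n --> \oo] --> a by apply: cvg_comp ux _; exact: cvg_fst.
have ulx : (u n).2 @[n --> \oo] --> x by apply: cvg_comp ux _; exact: cvg_snd.
have tc := total_cvg a01 ala.
have dtc : dtotal (u n).1 @[n --> \oo] --> dtotal a.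
  by apply: cvg_comp ala _; exact: dtotal_continuous.
apply: cvgM.
  apply: cvgB; apply: cvgM; [|exact: tc| |exact: dtc].
    exact: (drhoh_da_cont al01 a01 ala ul01 x01 ulx).
  exact: rhoh_joint.
apply: cvgV; first by rewrite sqrf_eq0 gt_eqF ?total_gt0.
exact: (cvgM tc tc).
Qed.

Lemma acim_density_ge0 a x : 0 < a < 1 -> 0 < x <= 1 -> 0 <= acim_density a x.
Proof.
move=> a01 x01; rewrite divr_ge0 ?(ltW (total_gt0 a01))//.
by apply: le_trans (rhoh_ge a01 x01); rewrite invr_ge0.
Qed.

Lemma acim_density_le a x : 0 < a < 1 -> 0 < x <= 1 -> acim_density a x <= 96 * x `^ (- a).
Proof.
move=> a01 x01; rewrite ler_pdivrMr ?total_gt0//.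
apply: le_trans (le_trans (ler_norm _) (rhoh_le a01 x01)) _.
by have := total_ge a01; have := powR_ge0 x (- a); nra.
Qed.

Lemma dacim_density_le b : 0 < b < 1 -> exists K, forall a x, 0 < a <= b -> 0 < x <= 1 ->
  `|dacim_density a x| <= K * x `^ (- a) * (1 - ln x).
Proof.
move=> b01; have [C CP] := dtotal_bounded b01.
exists (96 * dbnd + 16 * (24 * C)) => a x ab x01.
have a01 : 0 < a < 1 by case/andP: ab b01 => -> ab /andP[_ /(le_lt_trans ab)].
have t4 := total_ge a01; have t0 := total_gt0 a01.
have -> : dacim_density a x = drhoh_da a x / total a - rhoh a x * (dtotal a / total a ^+ 2).
  by rewrite /dacim_density; field; rewrite gt_eqF.
apply: le_trans (ler_normB _ _) _; rewrite -mulrA -/(log_weight a x) mulrDl lerD//.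
  rewrite normrM normfV (gtr0_norm t0) ler_pdivrMr//.
  apply: le_trans (drhoh_da_bound a01 x01) _; rewrite -/(log_weight a x).
  have := mulr_ge0 (@dbnd_ge0 R) (log_weight_ge0 a x01); move: (dbnd) (log_weight a x) => p q; nra.
have C0 : 0 <= C by apply: le_trans (CP a ab).
rewrite normrM normrM normfV [`|total a ^+ 2|]ger0_norm ?sqr_ge0//.
have h1 : `|rhoh a x| <= 24 * log_weight a x.
  by have /andP[a0 a1] := a01; apply: rhoh_log_weight => //; rewrite a0 lexx.
have h2 : `|dtotal a| / total a ^+ 2 <= 16 * C.
  rewrite ler_pdivrMr ?exprn_gt0//; apply: le_trans (CP a ab) _.
  rewrite -mulrA mulrCA ler_peMr//.
  have : 4^-1 * 4^-1 <= total a * total a by apply: ler_pM; rewrite ?invr_ge0.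
  rewrite expr2; lra.
apply: le_trans (ler_pM (normr_ge0 _) _ h1 h2) _.
  by rewrite divr_ge0 ?sqr_ge0.
by rewrite le_eqVlt; apply/orP; left; apply/eqP; ring.
Qed.

End normalized_density.

(** * The main result *)

Section acip_density.
Context {R : realType}.
Local Notation mu := (@lebesgue_measure R).
Local Notation I01 := (`]0, 1]%classic : set (measurableTypeR R)).
Variable a : R.
Hypothesis a01 : 0 < a < 1.

(** The density as a function on the line, null outside the unit interval. *)
Definition pdf x : R := (acim_density a \_ (`]0, 1]%classic : set R)) x.

Lemma pdfE x : 0 < x <= 1 -> pdf x = acim_density a x.
Proof. by move=> x01; rewrite /pdf patchE mem_set//= in_itv. Qed.

Lemma pdf_out x : ~ I01 x -> pdf x = 0.
Proof. by move=> x01; rewrite /pdf patchE memNset. Qed.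

Lemma pdf_ge0 x : 0 <= pdf x.
Proof.
have [x01|x01] := boolP (0 < x <= 1); first by rewrite pdfE// acim_density_ge0.
by rewrite pdf_out//= in_itv/=; exact/negP.
Qed.

Lemma pdf_continuous x : 0 < x < 1 -> {for x, continuous pdf}.
Proof.
have : {in (`]0, 1[%classic : set R), continuous pdf}.
  rewrite -continuous_open_subspace; last exact: interval_open.
  apply: seq_within_continuous => u t u01 t01 ut.
  have u01' n : 0 < u n <= 1.
    by have := u01 n; rewrite /= in_itv/= => /andP[-> /ltW].
  have t01' : 0 < t <= 1 by move: t01; rewrite /= in_itv/= => /andP[-> /ltW].
  rewrite pdfE//; under eq_fun do rewrite pdfE//.
  apply: cvgM; last exact: cvg_cst.
  by apply: (rhoh_joint (al := fun=> a)) => //; exact: cvg_cst.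
by move=> h x01; apply: h; rewrite inE/= in_itv.
Qed.

Lemma pdf_eq x : 0 < x < 1 ->
  pdf x = 2^-1 * pdf ((1 + x) / 2) + pdf (ginv a x) / tau a (ginv a x).
Proof.
move=> /andP[x0 x1]; have a0 : 0 < a by case/andP: a01.
have x01 : 0 < x <= 1 by rewrite x0 ltW.
have [g0 g2 _] := ginvP a0 x01.
rewrite !pdfE//; try lra.
by rewrite /acim_density rhoh_eq// mulrDl; congr (_ + _); rewrite -!mulrA//; congr (_ * _); rewrite mulrC.
Qed.

Lemma acim_density_integrable : mu.-integrable I01 (fun x => (acim_density a x)%:E).
Proof.
apply: eq_integrable (integrable_scale (total a)^-1 _ (rhoh_integrable a01)) => // x _.
by rewrite mulrC.
Qed.

Lemma pdf_integrable : mu.-integrable setT (EFin \o pdf).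
Proof.
have mI : measurable I01 by exact: measurable_itv.
have := acim_density_integrable; rewrite (integrable_mkcond _ mI).
by apply: eq_integrable => // x _; rewrite /= /pdf !patchE; case: ifP.
Qed.

Lemma pdf_integral (A : set (measurableTypeR R)) :
  (\int[mu]_(x in A) (pdf x)%:E = \int[mu]_(x in A `&` I01) (acim_density a x)%:E)%E.
Proof.
rewrite integral_mkcondr; apply: eq_integral => x _; rewrite /pdf !patchE.
by case: ifP.
Qed.

Lemma pdf_mass : (\int[mu]_x (pdf x)%:E = 1)%E.
Proof.
rewrite pdf_integral setTI.
rewrite -[LHS]fineK; last exact: integrable_fin_num acim_density_integrable.
have -> : fine (\int[mu]_(x in I01) (acim_density a x)%:E)%E = total a / total a.
  rewrite [in RHS]/total /moment -RintegralZr//; last first.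
    by apply: eq_integrable (rhoh_integrable a01) => // x _; rewrite /= mul1r.
  by apply: eq_Rintegral => x _; rewrite mul1r.
by rewrite divff// gt_eqF// total_gt0.
Qed.

(** The measure with this density is invariant and absolutely continuous, so that
    uniqueness identifies it. *)
Lemma unique_acip_pdf (nu : probability (measurableTypeR R) R) :
  unique_acip a nu -> forall A : set (measurableTypeR R), measurable A ->
  nu A = (\int[mu]_(x in A) (pdf x)%:E)%E.
Proof.
move=> [_ nuU] A mA.
have [P [Pac PE]] := acip_of_density a01 pdf_ge0 pdf_integrable pdf_out
  pdf_continuous pdf_eq pdf_mass.
by rewrite -PE (nuU P Pac).
Qed.

Lemma unique_acip_density (nu : probability (measurableTypeR R) R) :
  unique_acip a nu -> is_density nu (acim_density a).
Proof.
move=> nuU; split.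
- by case/integrableP: acim_density_integrable => /measurable_EFinP.
- by move=> x; rewrite in_itv/= => x01; exact: acim_density_ge0.
- by move=> A mA _; rewrite (unique_acip_pdf nuU)// pdf_integral.
Qed.

Lemma unique_acip_integral (nu : probability (measurableTypeR R) R) (v : R)
    (phi : measurableTypeR R -> R) :
  unique_acip a nu -> a < v -> v < 1 -> measurable_fun setT phi ->
  mu.-integrable I01 (fun x => (phi x * log_weight v x)%:E) ->
  nu.-integrable `[0, 1]%classic (EFin \o phi) /\
  \int[nu]_(x in `[0, 1]) phi x = moment phi a / total a.
Proof.
move=> nuU av v1 mphi iphi.
have avI : 0 < a < v by rewrite av andbT; case/andP: a01.
have mI : measurable_fun I01 phi by exact: measurable_funTS.
have i1 := moment_integrable v1 mI iphi avI.
have sub : (`[0, 1]%classic : set (measurableTypeR R)) `&` I01 = I01.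
  rewrite setIidr// => x; rewrite /= !in_itv/= => /andP[x0 ->].
  by rewrite ltW.
have i2 : mu.-integrable (`[0, 1]%classic : set (measurableTypeR R))
    (fun x => (phi x * pdf x)%:E).
  apply: (integrableS measurableT) => //.
  have := integrable_scale (total a)^-1 (measurable_itv _) i1.
  have mI01 : measurable I01 by exact: measurable_itv.
  rewrite (integrable_mkcond _ mI01).
  apply: eq_integrable => // x _; rewrite /= /pdf !patchE.
  by case: ifP => _; rewrite ?mulr0// /acim_density mulrC mulrA.
have [j1 j2] := density_integral pdf_ge0 pdf_integrable (unique_acip_pdf nuU)
  (measurable_itv _) (measurable_funTS mphi) i2.
split => //; rewrite j2 /moment -RintegralZr// -[in RHS]sub Rintegral_mkcondr.
apply: eq_Rintegral => x _; rewrite /pdf !patchE; case: ifP => _.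
  by rewrite mulrA.
by rewrite mulr0.
Qed.

End acip_density.

Lemma within_punctured_slope (R : realType) (D : set R) (f g : R -> R) (a l : R) :
  (forall x, D x -> f x = g x) -> D a -> is_derive a 1 g l ->
  (f b - f a) / (b - a) @[b --> within (D `\ a) (nbhs a)] --> l.
Proof.
move=> fg Da gl.
have h : (g b - g a) / (b - a) @[b --> a^'] --> l.
  apply/cvgr_dnbhsP => u [ua uc]; exact: (is_derive_slope gl).
have h2 : (g b - g a) / (b - a) @[b --> within (D `\ a) (nbhs a)] --> l.
  by apply: cvg_trans h; apply: cvg_app; apply: within_subset => x [_ /eqP].
apply: cvg_trans h2; apply: near_eq_cvg; near=> x.
have [Dx _] : (D `\ a) x by near: x; exact: withinT.
by rewrite !fg.
Unshelve. all: by end_near. Qed.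

Theorem theorem1p2 (R : realType)
    (nu : R -> probability (measurableTypeR R) R)
    (hnu : forall alpha, alpha \in `]0, 1[ -> unique_acip alpha (nu alpha)) :
  (exists rho : R -> R -> R,
    [/\ (forall alpha, alpha \in `]0, 1[ -> is_density (nu alpha) (rho alpha)),
        (forall alpha x, alpha \in `]0, 1[ -> x \in `]0, 1] ->
           derivable (rho ^~ x) alpha 1),
        {within (`]0, 1[ `*` `]0, 1] : set (R * R)),
           continuous (fun p : R * R => rho p.1 p.2)},
        {within (`]0, 1[ `*` `]0, 1] : set (R * R)),
           continuous (fun p : R * R => derive1 (rho ^~ p.2) p.1)}
      & forall am ap : R, 0 < am -> am <= ap -> ap < 1 ->
          exists K : R, forall alpha x, alpha \in `[am, ap] -> x \in `]0, 1] ->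
            rho alpha x <= K * x `^ (- alpha) /\
            `|derive1 (rho ^~ x) alpha| <= K * x `^ (- alpha) * (1 - ln x)])
  /\
  (forall am ap : R, 0 < am -> am <= ap -> ap < 1 ->
   forall q : \bar R, (((1 - ap)^-1)%:E < q)%E ->
   forall phi : measurableTypeR R -> R, phi \in Lfun (lebesgue01 R) q ->
     (forall alpha, alpha \in `[am, ap] ->
        (nu alpha).-integrable `[0, 1]%classic (EFin \o phi)) /\
     continuously_differentiable_on `[am, ap]
       (fun alpha => \int[nu alpha]_(x in `[0, 1]) phi x)).
Proof.
have dacim_densityE (a x : R) : 0 < a < 1 -> 0 < x <= 1 -> derive1 (acim_density ^~ x) a = dacim_density a x.
  move=> a01 x01; have d := is_derive_acim_density a01 x01.
  by rewrite derive1E; exact: (@derive_val _ _ _ _ _ _ _ d).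
split.
  exists acim_density; split.
  - move=> a; rewrite in_itv/= => a01; apply: unique_acip_density => //.
    by apply: hnu; rewrite in_itv.
  - move=> a x; rewrite !in_itv/= => a01 x01; have d := is_derive_acim_density a01 x01.
    exact: (@ex_derive _ _ _ _ _ _ _ d).
  - exact: acim_density_continuous.
  - apply: subspace_eq_continuous dacim_density_continuous => -[a x].
    by rewrite inE => -[/=]; rewrite !in_itv/= => a01 x01; apply: esym; exact: dacim_densityE.
  - move=> am ap am0 amp ap1.
    have ap01 : 0 < ap < 1 by rewrite (lt_le_trans am0).
    have [K KP] := dacim_density_le ap01.
    exists (Num.max 96 K) => a x; rewrite !in_itv/= => /andP[ama aap] x01.
    have a0 : 0 < a := lt_le_trans am0 ama.
    have a01 : 0 < a < 1 by rewrite a0 (le_lt_trans aap).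
    split.
      apply: le_trans (acim_density_le a01 x01) _.
      by rewrite ler_wpM2r ?powR_ge0// le_max lexx.
    rewrite dacim_densityE//; apply: le_trans (KP a x _ x01) _; first by rewrite a0.
    by rewrite -!mulrA ler_wpM2r ?log_weight_ge0// le_max lexx orbT.
move=> am ap am0 amp ap1 q apq phi phiq.
have ap01 : 0 < ap < 1 by rewrite (lt_le_trans am0).
have [v /andP[apv v1] iphi] := Lfun01_weight_integrable ap01 apq phiq.
have mphi : measurable_fun setT phi by have := sub_Lfun_mfun phiq; rewrite inE.
have mphiI : measurable_fun (`]0, 1]%classic : set (measurableTypeR R)) phi.
  exact: measurable_funTS.
have inI (a : R) : `[am, ap]%classic a -> 0 < a < 1 /\ 0 < a < v.
  rewrite /= in_itv/= => /andP[ama aap].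
  by rewrite (lt_le_trans am0 ama) (le_lt_trans aap ap1) (le_lt_trans aap apv).
have intE (a : R) : `[am, ap]%classic a ->
    (nu a).-integrable `[0, 1]%classic (EFin \o phi) /\
    \int[nu a]_(x in `[0, 1]) phi x = moment phi a / total a.
  move=> /inI[a01 /andP[_ av]]; apply: (unique_acip_integral a01 _ av v1) => //.
  by apply: hnu; rewrite in_itv.
split; first by move=> a aI; exact: (intE a aI).1.
pose dJ (a : R) := (dmoment phi a * total a - moment phi a * dtotal a) / total a ^+ 2.
have dm a : `[am, ap]%classic a -> is_derive a 1 (moment phi) (dmoment phi a).
  by move=> /inI[_ av]; exact: (is_derive_moment v1 mphiI iphi).
exists dJ; split.
  apply: seq_within_continuous => u a uI aI ua; have [a01 av] := inI _ aI.
  have c1 : moment phi (u n) @[n --> \oo] --> moment phi a.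
    apply: cvg_comp ua _; apply: differentiable_continuous; apply/derivable1_diffP.
    exact: (@ex_derive _ _ _ _ _ _ _ (dm _ aI)).
  have c2 : dmoment phi (u n) @[n --> \oo] --> dmoment phi a.
    by apply: cvg_comp ua _; exact: (dmoment_continuous v1 mphiI iphi av).
  have c3 := total_cvg a01 ua.
  have c4 : dtotal (u n) @[n --> \oo] --> dtotal a.
    by apply: cvg_comp ua _; exact: dtotal_continuous.
  apply: cvgM.
    by apply: cvgB; [exact: (cvgM c2 c3)|exact: (cvgM c1 c4)].
  apply: cvgV; first by rewrite sqrf_eq0 gt_eqF ?total_gt0.
  exact: (cvgM c3 c3).
move=> a aI; have [a01 av] := inI _ aI.
apply: (@within_punctured_slope _ _ _ (fun b => moment phi b / total b)) => //.
  by move=> b bI; exact: (intE b bI).2.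
have d1 := dm _ aI; have t0 := total_gt0 a01.
have tn : total a != 0 by rewrite gt_eqF.
have d3 := is_deriveV tn (is_derive_total a01).
apply: (is_derive_eq (is_deriveM d1 d3)); rewrite /GRing.scale/= /dJ.
by field.
Qed.
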